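(* Let $n\ge2$, let $\lambda=(N-m,1^m)$ be a hook-shaped Young diagram of size $N$ with $\ell(\lambda)=m+1<n$ and $\gcd(n,N)=1$. Let $\mathsf{C}$ be the cyclic group of order $n$ generated by $\mathsf{c}=\mathsf{s}_1\mathsf{s}_2\cdots\mathsf{s}_{n-1}$ acting on $\mathsf{SST}_n(\lambda)$, and let $\mathsf{P}$ be the cyclic group generated by the permutation $\mathsf{pr}^n$ of $\mathsf{SST}_n(\lambda)$, where $\mathsf{pr}$ is the promotion operator (the actions of $\mathsf C$ and $\mathsf P$ commute). Let $\mathsf{d}$ be the order of $\mathsf{pr}^n$ on $\mathsf{SST}_n(\lambda)$ and, for $\alpha\in\mathbb{Z}_{\ge0}^n$ with $\mathsf{SST}_n(\lambda,\alpha)\neq\emptyset$, let $\mathsf{d}_\alpha$ be the order of the restriction $\mathsf{pr}^n|_\alpha$ of $\mathsf{pr}^n$ to $\mathsf{SST}_n(\lambda,\alpha)$. Set $$S_\lambda(q,t):=q^{-\kappa(\lambda)}\sum_{\mu\vdash N}t^{A_\mu}\,K_{\lambda,\mu}\bigl(t^{\mathsf{d}/\mathsf{d}_\mu}\bigr)\, m_\mu(1,q,q^2,\ldots,q^{n-1}),$$ where $$A_\mu=\frac{\mathsf{d}}{\mathsf{d}_\mu}\Bigl(-\kappa(\mu)+m\,\mu_1'-\frac{m(m+1)}{2}\Bigr)$$ and only those $\mu\vdash N$ with at most $n$ parts and $\mathsf{SST}_n(\lambda,\mu)\ne\emptyset$ contribute to the sum (the other terms being zero). Then the triple $(\mathsf{SST}_n(\lambda),\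 \mathsf{C}\times\mathsf{P},\ S_\lambda(q,t))$ exhibits the bicyclic sieving phenomenon.
   Context: Partitions are identified with Young diagrams (English convention); $\ell(\lambda)$ is the number of positive parts, $\kappa(\lambda)=\sum_k(k-1)\lambda_k$, and $\mu'$ is the conjugate partition, so $\mu_1'=\ell(\mu)$. $\mathsf{SST}_n(\lambda)$ is the set of semistandard tableaux of shape $\lambda$ with entries in $\{1,\dots,n\}$ (rows weakly increasing, columns strictly increasing). The content of $T$ is $(c_1(T),\dots,c_n(T))$ with $c_k(T)$ the number of entries $k$ in $T$; for $\alpha\in\mathbb{Z}_{\ge0}^n$, $\mathsf{SST}_n(\lambda,\alpha)$ is the set of $T\in\mathsf{SST}_n(\lambda)$ with content $\alpha$ (a partition $\mu$ with at most $n$ parts is viewed in $\mathbb{Z}_{\ge0}^n$ by appending zeros). $m_\mu(x_1,\dots,x_n)$ is the monomial symmetric polynomial (zero if $\ell(\mu)>n$), and $K_{\lambda,\mu}(t)$ is the Kostka–Foulkes polynomial (in Macdonald's convention). Crystal reflections: for $1\le i\le n-1$, $\mathsf{s}_i$ acts on $T\in\mathsf{SST}_n(\lambda)$ as follows. Read the entries row by row, each row left to right, from the bottom row to the top row; regard each $i+1$ as ''('' and each $i$ as '')'' and match parentheses in the usual way; the unmatched letters form a subword $i^a(i+1)^b$, which $\mathsf{s}_i$ replaces by $i^b(i+1)^a$ in the same positions. (This is the Weyl group action from the standard $U_q(\mathfrak{sl}_n)$-crystal structure.) The $\mathsf{s}_i$ define an action of $\mathfrak{S}_n$, so the cyclic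 group $\mathsf C$ of order $n$ generated by the Coxeter element $\mathsf{c}=\mathsf{s}_1\cdots\mathsf{s}_{n-1}$ (composition, rightmost applied first) acts on $\mathsf{SST}_n(\lambda)$. Promotion: for $T\in\mathsf{SST}_n(\lambda)$, $\mathsf{pr}(T)$ is obtained as follows. If $T$ has no entry $n$, add 1 to every entry. Otherwise replace each entry $n$ by a dot; process the dots from left to right, and slide each toward the northwest by jeu de taquin: repeatedly exchange the dot with the larger of the (non-dot) entries immediately above and immediately to the left of it (with the one above in case of equality, and with the only one available if just one exists), until there is no non-dot entry above or to the left. Finally add 1 to all remaining entries and replace all dots by 1. $\mathsf{pr}$ is a bijection of $\mathsf{SST}_n(\lambda)$, and $\mathsf{pr}^n$ preserves contents. Bicyclic sieving phenomenon: for $d\ge1$ let $\omega_d$ be a primitive $d$-th root of unity. If finite cyclic groups $C,C'$ act on a finite set $X$ with commuting actions, and $f(q,t)$ is a polynomial with nonnegative integer coefficients, then $(X,C\times C',f(q,t))$ exhibits the bicyclic sieving phenomenon if for all $g\in C$, $g'\in C'$ one has $\#\{x\in X:(g,g')x=x\}=f(\omega_{o(g)},\omega_{o(g')})$, where $o(\cdot)$ denotes the order of an element. *)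

(* Defs.v *)
From HB Require Import structures.
From mathcomp Require Import all_boot all_order all_algebra all_fingroup.
From mathcomp Require Import all_solvable all_field polyXY fraction mpoly.
From Stdlib Require Import ClassicalEpsilon.

Set Implicit Arguments.
Unset Strict Implicit.
Unset Printing Implicit Defensive.

Import GRing.Theory.

Local Open Scope nat_scope.

(* Partitions: weakly decreasing sequences of positive integers, so that
   [size] is the length. *)

Definition is_partition_of (N : nat) (mu : seq nat) : bool :=
  [&& sorted geq mu, 0 \notin mu & sumn mu == N].

(* A partition of N has at most N parts, each at most N: it is a weakly
   decreasing N-tuple in {0, ..., N} stripped of its zeros. *)
Definition partitions (N : nat) : seq (seq nat) :=
  [seq mu <- undup [seq filter (ltn 0) (map val t) | t : N.-tuple 'I_N.+1]
     | is_partition_of N mu].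

Lemma partitions_uniq N : uniq (partitions N).
Proof. by rewrite filter_uniq ?undup_uniq. Qed.

Lemma mem_partitions N mu : (mu \in partitions N) = is_partition_of N mu.
Proof.
rewrite mem_filter mem_undup; apply: andb_idr => /and3P[_ mu0 /eqP muN].
have le_nth i : nth 0 mu i < N.+1.
  rewrite ltnS -muN; elim: {mu0 muN}mu i => [|x s IHs] [|i] //=.
    exact: leq_addr.
  exact: leq_trans (IHs i) (leq_addl _ _).
have le_size : size mu <= N.
  rewrite -muN; elim: {muN le_nth}mu mu0 => //= x s IHs.
  by rewrite inE negb_or eq_sym -lt0n => /andP[x0 /IHs]; case: x x0 => // x _;
    rewrite addSn ltnS => /leq_trans-> //; apply: leq_addl.
apply/imageP; exists [tuple inord (nth 0 mu i) | i < N] => //.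
rewrite /= -map_comp.
have -> : [seq (val \o (fun i : 'I_N => inord (nth 0 mu i) : 'I_N.+1)) i
            | i <- enum 'I_N] = mkseq (nth 0 mu) N.
  rewrite /mkseq -val_enum_ord -map_comp.
  by apply: eq_map => i /=; rewrite inordK.
rewrite -(subnKC le_size) /mkseq iotaD map_cat filter_cat -/(mkseq _ _).
rewrite mkseq_nth (_ : filter _ mu = mu); last first.
  by apply/all_filterP/allP => x xmu; rewrite /= lt0n; apply: contraNneq mu0 => <-.
rewrite (_ : filter _ _ = [::]) ?cats0 //.
apply/eqP; rewrite -[_ == _]negbK -has_filter -all_predC; apply/allP => x.
by case/mapP => i; rewrite mem_iota => /andP[lei _] ->; rewrite /= nth_default.
Qed.

Definition kappa (la : seq nat) : nat := \sum_(k < size la) k * nth 0 la k.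

Definition conj_part (mu : seq nat) (j : nat) : nat := count (leq j) mu.

Definition hook (N m : nat) : seq nat := (N - m) :: nseq m 1.

Definition pad (k : nat) (mu : seq nat) : seq nat := mu ++ nseq (k - size mu) 0.

(* A filling of the diagram of la is encoded by a matrix on its bounding box;
   the entry 0 marks the boxes which do not belong to the diagram. *)

Definition filling (n : nat) (la : seq nat) :=
  'M['I_n.+1]_(size la, head 0 la).

Definition semistandard (n : nat) (la : seq nat) (T : filling n la) : bool :=
  [&& [forall i : 'I_(size la), forall j : 'I_(head 0 la),
        (0 < T i j) == (j < nth 0 la i)],
      [forall i : 'I_(size la), forall j : 'I_(head 0 la),
        forall j' : 'I_(head 0 la),
        (j < j') && (j' < nth 0 la i) ==> (T i j <= T i j')]
    & [forall i : 'I_(size la), forall i' : 'I_(size la),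
        forall j : 'I_(head 0 la),
        (i < i') && (j < nth 0 la i') ==> (T i j < T i' j)]].

Definition SST (n : nat) (la : seq nat) :=
  {T : filling n la | semistandard T}.

Definition content (n : nat) (la : seq nat) (T : SST n la) (k : nat) : nat :=
  #|[set p : 'I_(size la) * 'I_(head 0 la) | val T p.1 p.2 == k :> nat]|.

(* alpha is completed by zeros when it has less than n terms. *)
Definition SST_content (n : nat) (la alpha : seq nat) : {set SST n la} :=
  [set T : SST n la | [forall k : 'I_n, content T k.+1 == nth 0 alpha k]].

(* The operators below are computed on maps from boxes (row, column), both
   numbered from 0, to entries, with value 0 off the diagram. *)

Definition box := (nat * nat)%type.

Definition entry (n : nat) (la : seq nat) (T : SST n la) (p : box) : nat :=
  match insub p.1, insub p.2 with
  | Some i, Some j => val T i j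
  | _, _ => 0
  end.

(* The operators map semistandard tableaux to semistandard tableaux and are
   bijective; the default values T and 1 are never used. *)
Definition of_entries (n : nat) (la : seq nat) (T : SST n la) (f : box -> nat) :
    SST n la :=
  insubd T (\matrix_(i, j) inord (f (val i, val j)))%R.

Definition perm_of_fun (X : finType) (f : X -> X) : {perm X} :=
  insubd (1%g : {perm X}) [ffun x => f x].

Definition reading_boxes (la : seq nat) : seq box :=
  [seq (r, c) | r <- rev (iota 0 (size la)), c <- iota 0 (nth 0 la r)].

(* The first component of the state collects the unmatched ")", the second
   is the stack of the "(" not matched so far. *)
Definition bracket_step (f : box -> nat) (i : nat)
    (s : seq box * seq box) (p : box) : seq box * seq box :=
  if f p == i.+1 then (s.1, p :: s.2)
  else if f p == i then
    if s.2 is _ :: opened then (s.1, opened) else (rcons s.1 p, [::])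
  else s.

Definition unmatched (la : seq nat) (f : box -> nat) (i : nat) :
    seq box * seq box :=
  let s := foldl (bracket_step f i) ([::], [::]) (reading_boxes la) in
  (s.1, rev s.2).

Definition crystal_entries (la : seq nat) (i : nat) (f : box -> nat) :
    box -> nat :=
  let: (unmatched_i, unmatched_iS) := unmatched la f i in
  let u := unmatched_i ++ unmatched_iS in
  fun p => if p \in u
           then if index p u < size unmatched_iS then i else i.+1
           else f p.

Definition crystal_refl (n : nat) (la : seq nat) (i : nat) (T : SST n la) :
    SST n la :=
  of_entries T (crystal_entries la i (entry T)).

Definition coxeter (n : nat) (la : seq nat) : {perm SST n la} :=
  perm_of_fun (fun T => foldr (@crystal_refl n la) T (iota 1 n.-1)).

Definition set_box (f : box -> nat) (p : box) (v : nat) : box -> nat :=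
  fun p' => if p' == p then v else f p'.

(* Sliding of the dot in box (i, j).  Dots are represented by 0, so that a
   neighbour equal to 0 is a dot or does not exist; k bounds the number of
   steps. *)
Fixpoint slide (k : nat) (f : box -> nat) (i j : nat) : box -> nat :=
  if k is k'.+1 then
    let up := if i is i'.+1 then f (i', j) else 0 in
    let left := if j is j'.+1 then f (i, j') else 0 in
    if (up == 0) && (left == 0) then f
    else if left <= up
         then slide k' (set_box (set_box f (i, j) up) (i.-1, j) 0) i.-1 j
         else slide k' (set_box (set_box f (i, j) left) (i, j.-1) 0) i j.-1
  else f.

(* Boxes with entry n, from left to right. *)
Definition dots (n : nat) (la : seq nat) (f : box -> nat) : seq box :=
  [seq p <- [seq (r, c) | c <- iota 0 (head 0 la), r <- iota 0 (size la)]
     | f p == n].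

(* The last step adds 1 to the remaining entries and turns the dots, that is
   the zeros, into 1. *)
Definition promotion_entries (n : nat) (la : seq nat) (f : box -> nat) :
    box -> nat :=
  let f0 := fun p => if f p == n then 0 else f p in
  let f1 := foldl (fun g p => slide (p.1 + p.2) g p.1 p.2) f0 (dots n la f) in
  fun p => if p.2 < nth 0 la p.1 then (f1 p).+1 else 0.

Definition promotion (n : nat) (la : seq nat) : {perm SST n la} :=
  perm_of_fun (fun T => of_entries T (promotion_entries n la (entry T))).

Definition ord_prn (n : nat) (la : seq nat) : nat :=
  #[promotion n la ^+ n]%g.

Definition ord_prn_content (n : nat) (la alpha : seq nat) : nat :=
  #[restr_perm (SST_content n la alpha) (promotion n la ^+ n)]%g.

Local Open Scope ring_scope.

(* m_mu(x_1, ..., x_n) *)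
Definition monomial_sym (R : comNzRingType) (n : nat) (mu : seq nat)
    (x : 'I_n -> R) : R :=
  if (size mu <= n)%N then
    \sum_(a <- permutations (pad n mu)) \prod_(i < n) x i ^+ nth 0%N a i
  else 0.

Definition schur (R : comNzRingType) (k : nat) (la : seq nat)
    (x : 'I_k -> R) : R :=
  \sum_(T : SST k la) \prod_(i < k) x i ^+ content T i.+1.

(* v_mu(t) in k variables: the product over all i >= 0 of v_(m_i)(t), where m_i
   is the multiplicity of i in mu, completed by zeros to length k, and
   v_m(t) = prod_(1 <= j <= m) (1 - t^j) / (1 - t). *)
Definition hall_littlewood_v (F : fieldType) (k : nat) (mu : seq nat) (t : F) :
    F :=
  \prod_(i <- undup (pad k mu))
    \prod_(1 <= j < (count_mem i (pad k mu)).+1) ((1 - t ^+ j) / (1 - t)).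

(* P_mu(x_1, ..., x_k; t) *)
Definition hall_littlewood (F : fieldType) (k : nat) (mu : seq nat)
    (x : 'I_k -> F) (t : F) : F :=
  (hall_littlewood_v k mu t)^-1 *
  \sum_(w : 'S_k)
    (\prod_(i < k) x (w i) ^+ nth 0%N mu i) *
    \prod_(i < k) \prod_(j < k | (i < j)%N)
       ((x (w i) - t * x (w j)) / (x (w i) - x (w j))).

(* s_la = sum_mu K_mu(t) P_mu(x; t) as rational functions in t and in |la|
   variables x; every partition of |la| has at most |la| parts, so the P_mu are
   linearly independent and K_mu is determined for all of them. *)
Definition kostka_foulkes_spec (la : seq nat) (K : seq nat -> {poly int}) :
    Prop :=
  let N := sumn la in
  let x (i : 'I_N) : {fraction {mpoly {poly int}[N]}} := tofrac 'X_i in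
  let t : {fraction {mpoly {poly int}[N]}} := tofrac ('X : {poly int})%:MP in
  schur la x =
    \sum_(mu <- partitions N) tofrac (K mu)%:MP * hall_littlewood mu x t.

Definition kostka_foulkes (la mu : seq nat) : {poly int} :=
  epsilon (inhabits (fun _ : seq nat => 0 : {poly int}))
          (kostka_foulkes_spec la) mu.

(* Polynomials f(q, t) are elements of Z[t][q]: q = 'X and t = 'Y. *)

Definition eval_qt (f : {poly {poly int}}) (a b : algC) : algC :=
  (map_poly (map_poly intr) f).[a, b].

Definition bicyclic_sieving (omega : nat -> algC)
    (gT gT' : finGroupType) (X : finType)
    (C : {group gT}) (to : {action gT &-> X})
    (C' : {group gT'}) (to' : {action gT' &-> X})
    (f : {poly {poly int}}) : Prop :=
  [/\ cyclic C, cyclic C',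
      {in C & C', forall g g' x, to (to' x g') g = to' (to x g) g'},
      forall i j, 0 <= f`_i`_j
    & {in C & C', forall g g',
        #|[set x | to (to' x g') g == x]|%:R
          = eval_qt f (omega #[g]%g) (omega #[g']%g)}].

Definition A_exp (n N m : nat) (mu : seq nat) : int :=
  (ord_prn n (hook N m) %/ ord_prn_content n (hook N m) mu)%N%:Z *
  (- (kappa mu)%:Z + m%:Z * (conj_part mu 1)%:Z - (m * m.+1 %/ 2)%N%:Z).

(* S_la(q, t) for la = (N - m, 1^m), a priori a Laurent polynomial. *)
Definition S_hook (n N m : nat) : {fraction {poly {poly int}}} :=
  let la := hook N m in
  let q : {fraction {poly {poly int}}} := tofrac 'X in
  let t : {fraction {poly {poly int}}} := tofrac 'Y in
  q ^- kappa la *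
  \sum_(mu <- partitions N
          | (size mu <= n)%N && (SST_content n la mu != set0))
     t ^ A_exp n N m mu *
     (map_poly intr (kostka_foulkes la mu)).[
        t ^+ (ord_prn n la %/ ord_prn_content n la mu)] *
     monomial_sym mu (fun i : 'I_n => q ^+ i).

(* Main.v *)
Require Import Defs.
From HB Require Import structures.
From mathcomp Require Import all_boot all_order all_algebra all_fingroup.
From mathcomp Require Import all_solvable all_field polyXY fraction mpoly.
From mathcomp Require Import zify ring.
From Stdlib Require Import FunctionalExtensionality ClassicalEpsilon.

Set Implicit Arguments.
Unset Strict Implicit.
Unset Printing Implicit Defensive.

Import GRing.Theory.

(** A tableau of hook shape is determined by its content [a] and by the set of
    its leg entries.  The corner is the least letter of the support of [a], so
    the leg is recorded by a bit vector [b] of length [k - 1], where [k] is the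
    number of letters occurring.  In these coordinates the crystal reflections
    permute [a] and leave [b] unchanged, and promotion rotates [a] by one step
    and rotates [b] by one step exactly when the letter [n] occurs.  Hence the
    Coxeter element rotates [a] and fixes [b], whereas the [n]-th power of
    promotion fixes [a] and rotates [b] by [k] steps, that is, by one step.

    As [n] and [N] are coprime, no content has a rotational symmetry: if [g] is
    not the identity then [(g, g')] has no fixed point, and rotating exponents
    shows that [m_mu(1, w, ..., w^(n-1))] vanishes.  If [g] is the identity the
    count is the cyclic sieving of [m]-subsets of [Z/(k-1)] by the Gaussian
    binomial.  That this is [t^A_mu K_(la,mu)] follows from
    [sum_mu t^kappa(mu) prod_(j < l(mu)) (1 - t^(-j) y) P_mu(x; t) =
     prod_i (1 - x_i y) / (1 - x_i)],
    which is obtained by removing first columns and reduces to a Lagrange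
    interpolation identity; since [P_mu] at [t = 0] is a Schur function, the
    [P_mu] are linearly independent and this determines [K]. *)

(* all_solvable exports another constant rot. *)
Local Notation rot := seq.rot.

(** * Hook tableaux as pairs (row, leg) *)

(** A content with k letters carries C(k-1, m) tableaux, so (1 - y) times the sum over m of (-y)^m
    s_(N-m,1^m) is the degree N part of prod_i (1 - x_i y) / (1 - x_i). In the expansion of that
    product in the P_mu every term contains the factor j = 0, which is 1 - y; once it is cancelled,
    the coefficient of y^m comes from the q-binomial theorem. This gives K as a power of t times a
    Gaussian binomial, and A_mu is -d/d_mu times the exponent of that power. The ratio d/d_mu adapts
    one root of unity to all contents: on content mu, pr^n rotates k - 1 places and has order d_mu =
    k - 1 when 0 < m < k - 1, whereas t is evaluated at a root whose order is that of an element of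
    P. For m = 0 and m = k - 1 the Gaussian binomial is 1. K is only given as a chosen solution of
    the expansion of the Schur polynomial, so both a solution and its uniqueness have to be
    established, the latter over Z[t], where t can be set to 0. *)

Section Entries.
Variables (n : nat) (la : seq nat).
Implicit Types (T : SST n la) (f : box -> nat).

(** Semistandardness for maps on all boxes, the form in which the crystal and promotion operators
    compute; the bound by [n] makes [inord] faithful. *)
Definition sst_entries f :=
  [/\ forall r c, (0 < f (r, c)) = (c < nth 0 la r),
      forall p, f p <= n,
      forall r c c', c < c' -> c' < nth 0 la r -> f (r, c) <= f (r, c')
    & forall r r' c, r < r' -> c < nth 0 la r' -> f (r, c) < f (r', c)].

Lemma entryE T (i : 'I_(size la)) (j : 'I_(head 0 la)) :
  entry T (val i, val j) = val T i j.
Proof. by rewrite /entry /= !valK. Qed.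

Lemma entry_out T r c : ~~ ((r < size la) && (c < head 0 la)) ->
  entry T (r, c) = 0.
Proof.
rewrite /entry /=; case: insubP => [i ->|//] _; case: insubP => [j ->|//] _.
by [].
Qed.

Lemma entry_inj T T' : entry T =1 entry T' -> T = T'.
Proof.
move=> E; apply/val_inj/matrixP => i j; apply: val_inj.
by have := E (val i, val j); rewrite !entryE.
Qed.

Hypothesis la_sorted : forall r, nth 0 la r <= head 0 la.

Lemma nth_la_size r c : c < nth 0 la r -> r < size la.
Proof. by case: (ltnP r (size la)) => // le; rewrite nth_default. Qed.

Lemma entry_sst T : sst_entries (entry T).
Proof.
case/and3P: (valP T) => /forallP H1 /forallP H2 /forallP H3.
have inb r c : c < nth 0 la r -> (r < size la) && (c < head 0 la).
  by move=> h; rewrite (nth_la_size h) (leq_trans h).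
split.
- move=> r c; case: (boolP ((r < size la) && (c < head 0 la))); last first.
    move=> h; rewrite entry_out //; apply/esym/negbTE.
    by apply: contra h; apply: inb.
  case/andP=> hr hc; rewrite -[r]/(val (Ordinal hr)) -[c]/(val (Ordinal hc)).
  by rewrite entryE; move/forallP: (H1 (Ordinal hr)) => /(_ (Ordinal hc))/eqP.
- case=> r c; case: (boolP ((r < size la) && (c < head 0 la))); last first.
    by move=> h; rewrite entry_out.
  case/andP=> hr hc; rewrite -[r]/(val (Ordinal hr)) -[c]/(val (Ordinal hc)).
  by rewrite entryE -ltnS.
- move=> r c c' lt h; case/andP: (inb _ _ h) => hr hc'.
  have hc : c < head 0 la by exact: ltn_trans hc'.
  rewrite -[r]/(val (Ordinal hr)) -[c]/(val (Ordinal hc)) entryE.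
  rewrite -[c']/(val (Ordinal hc')) entryE.
  move/forallP: (H2 (Ordinal hr)) => /(_ (Ordinal hc))/forallP/(_ (Ordinal hc')).
  by move/implyP; apply; rewrite /= lt.
- move=> r r' c lt h; case/andP: (inb _ _ h) => hr' hc.
  have hr : r < size la by exact: ltn_trans hr'.
  rewrite -[r]/(val (Ordinal hr)) -[c]/(val (Ordinal hc)) entryE.
  rewrite -[r']/(val (Ordinal hr')) entryE.
  move/forallP: (H3 (Ordinal hr)) => /(_ (Ordinal hr'))/forallP/(_ (Ordinal hc)).
  by move/implyP; apply; rewrite /= lt.
Qed.

Lemma sst_entries_mx f : sst_entries f ->
  semistandard ((\matrix_(i, j) inord (f (val i, val j)))%R : filling n la).
Proof.
case=> f1 f2 f3 f4.
have v (i : 'I_(size la)) (j : 'I_(head 0 la)) :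
    ((\matrix_(i, j) inord (f (val i, val j)))%R : filling n la) i j
     = f (val i, val j) :> nat by rewrite mxE inordK // ltnS.
apply/and3P; split.
- by apply/forallP => i; apply/forallP => j; rewrite v f1.
- apply/forallP => i; apply/forallP => j; apply/forallP => j'.
  by apply/implyP => /andP[lt h]; rewrite !v; apply: f3.
- apply/forallP => i; apply/forallP => i'; apply/forallP => j.
  by apply/implyP => /andP[lt h]; rewrite !v; apply: f4.
Qed.

Lemma entry_mx f (H : sst_entries f) T :
  val T = (\matrix_(i, j) inord (f (val i, val j)))%R -> entry T =1 f.
Proof.
case: (H) => f1 f2 f3 f4 vT [r c].
case: (boolP ((r < size la) && (c < head 0 la))) => [/andP[hr hc]|h].
  rewrite -[r]/(val (Ordinal hr)) -[c]/(val (Ordinal hc)) entryE vT mxE.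
  by rewrite inordK // ltnS.
rewrite entry_out //; apply/eqP; rewrite eq_sym -leqn0 leqNgt f1.
apply: contra h => h.
by rewrite (nth_la_size h) (leq_trans h).
Qed.

Lemma entry_of_entries T f : sst_entries f -> entry (of_entries T f) =1 f.
Proof.
move=> H; apply: entry_mx => //.
by rewrite /of_entries val_insubd sst_entries_mx.
Qed.

Lemma sst_entriesP f : sst_entries f -> {T : SST n la | entry T =1 f}.
Proof.
move=> H; exists (Sub _ (sst_entries_mx H)); apply: entry_mx => //.
Qed.

Lemma contentE T k : content T k =
  \sum_(r < size la) \sum_(c < head 0 la) (entry T (val r, val c) == k).
Proof.
rewrite /content cardsE -sum1_card big_mkcond /= pair_bigA /=.
apply: eq_bigr => -[i j] _ /=.
by rewrite entryE unfold_in /= -eqnE; case: eqn.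
Qed.

End Entries.

(* The row contains the corner box, the leg does not. *)
Definition hookf (row leg : seq nat) : box -> nat := fun p =>
  if p.1 is r.+1 then if p.2 is 0 then nth 0 leg r else 0 else nth 0 row p.2.

Section HookModel.
Variables (n N m : nat).
Hypothesis ltmN : m < N.
Local Notation la := (hook N m).
Implicit Types (T : SST n la) (row leg : seq nat).

Lemma size_hook : size la = m.+1.
Proof. by rewrite /= size_nseq. Qed.

Lemma nth_hook r : nth 0 la r = if r is r'.+1 then (r' < m : nat) else N - m.
Proof. by case: r => //= r; rewrite nth_nseq; case: ltnP. Qed.

Lemma hook_le r : nth 0 la r <= head 0 la.
Proof. rewrite nth_hook; case: r => [|r] //=; lia. Qed.

Definition hook_valid row leg :=
  [&& size row == N - m, size leg == m, sorted leq row,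
      path ltn (head 0 row) leg & all (fun v => 0 < v <= n) (row ++ leg)].

Definition row_of T := mkseq (fun c => entry T (0, c)) (N - m).
Definition leg_of T := mkseq (fun r => entry T (r.+1, 0)) m.

Lemma entry_hookf T : entry T = hookf (row_of T) (leg_of T).
Proof.
case: (entry_sst hook_le T) => e1 _ _ _.
have z r c : nth 0 la r <= c -> entry T (r, c) = 0.
  by move=> h; apply/eqP; rewrite -leqn0 leqNgt e1 -leqNgt.
apply: functional_extensionality => -[[|r] c]; rewrite /hookf /=.
  case: (ltnP c (N - m)) => h; first by rewrite nth_mkseq.
  by rewrite nth_default ?size_mkseq // z.
case: c => [|c]; last by rewrite z // nth_hook; case: (r < m).
case: (ltnP r m) => h; first by rewrite nth_mkseq.
by rewrite nth_default ?size_mkseq // z // nth_hook ltnNge h.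
Qed.

Lemma hookf_sst row leg : hook_valid row leg -> sst_entries n la (hookf row leg).
Proof.
case/and5P=> /eqP sr /eqP sl so pa al.
have pos s i : all (fun v => 0 < v <= n) s ->
    (0 < nth 0 s i) = (i < size s).
  move=> /allP h; case: (ltnP i (size s)) => hi; last by rewrite nth_default.
  by case/andP: (h _ (mem_nth 0 hi)).
have le s i : all (fun v => 0 < v <= n) s -> nth 0 s i <= n.
  move=> /allP h; case: (ltnP i (size s)) => hi; last by rewrite nth_default.
  by case/andP: (h _ (mem_nth 0 hi)).
move: al; rewrite all_cat => /andP[ar al].
have nm0 : 0 < N - m by lia.
split.
- move=> [|r] c; rewrite /hookf nth_hook /=; first by rewrite pos // sr.
  by case: c => [|c]; [rewrite pos // sl; case: (r < m) | case: (r < m)].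
- by move=> [[|r] c]; rewrite /hookf /=; [exact: le | case: c => *; rewrite ?le].
- move=> [|r] c c' lt; rewrite nth_hook /= => h.
    apply: (sorted_leq_nth leq_trans leqnn 0 so); rewrite ?inE ?sr // /=; lia.
  by case: (r < m) h; lia.
- move=> r [|r'] c //; rewrite nth_hook => lt h.
  have {h} [-> hr'] : c = 0 /\ r' < m by case: (r' < m) h; lia.
  case: r lt => [|r] lt; rewrite /hookf /=.
    rewrite nth0; have /allP -> // := order_path_min ltn_trans pa.
    by rewrite mem_nth ?sl.
  apply: (sorted_ltn_nth ltn_trans 0 (path_sorted pa)); rewrite ?inE ?sl; lia.
Qed.

Lemma model_valid T : hook_valid (row_of T) (leg_of T).
Proof.
case: (entry_sst hook_le T) => e1 e2 e3 e4.
have nm0 : 0 < N - m by lia.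
rewrite /hook_valid !size_mkseq !eqxx /=.
apply/and3P; split.
- apply/(sortedP 0) => i; rewrite size_mkseq => h.
  by rewrite !nth_mkseq //; [apply: e3 | lia].
- rewrite -nth0 nth_mkseq //; apply/(pathP 0) => i; rewrite size_mkseq => h.
  rewrite nth_mkseq //.
  case: i h => [|i] h /=; first by apply: e4; rewrite // nth_hook h.
  by rewrite nth_mkseq; [apply: e4; rewrite // nth_hook h | lia].
- apply/allP => v; rewrite mem_cat => /orP[]/mapP[i];
    rewrite mem_iota => /andP[_ hi] ->; rewrite e2 e1 nth_hook //.
  all: by move: hi; rewrite add0n => ->.
Qed.

Lemma modelK row leg T : hook_valid row leg -> entry T =1 hookf row leg ->
  row_of T = row /\ leg_of T = leg.
Proof.
case/and5P=> /eqP sr /eqP sl _ _ _ e; split; apply: (@eq_from_nth _ 0);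
   rewrite size_mkseq // => i hi; rewrite nth_mkseq // e //.
Qed.

Lemma model_inj T T' : row_of T = row_of T' -> leg_of T = leg_of T' -> T = T'.
Proof. by move=> er el; apply: entry_inj => p; rewrite !entry_hookf er el. Qed.

Lemma model_surj row leg : hook_valid row leg ->
  exists T, row_of T = row /\ leg_of T = leg.
Proof.
by move=> v; case: (sst_entriesP hook_le (hookf_sst v)) => T e; exists T;
  apply: modelK.
Qed.

Lemma model_of_entries T f row leg : f =1 hookf row leg -> hook_valid row leg ->
  row_of (of_entries T f) = row /\ leg_of (of_entries T f) = leg.
Proof.
move=> /functional_extensionality -> v; apply: modelK => //.
by apply: entry_of_entries; [exact: hook_le | exact: hookf_sst].
Qed.

(** The letter 0 is excluded because it also fills the bounding box outside the hook. *)
Lemma content_model T k : 0 < k ->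
  content T k = count_mem k (row_of T) + count_mem k (leg_of T).
Proof.
move=> k0; rewrite contentE entry_hookf size_hook big_ord_recl /=.
have cnt s b : size s = b ->
    \sum_(c < b) (nth 0 s c == k) = count_mem k s.
  move=> <-; rewrite -sum1_count (big_nth 0) big_mkord [RHS]big_mkcond /=.
  by apply: eq_bigr => i _; case: (_ == k).
congr (_ + _); first by rewrite -(cnt _ (N - m)) ?size_mkseq.
rewrite -(cnt _ m) ?size_mkseq //; apply: eq_bigr => r _.
have : 0 < N - m by lia.
case: (N - m) => // b _; rewrite big_ord_recl /= big1 ?addn0 //.
by move=> i _; rewrite /hookf /=; rewrite eqn_leq (leqNgt k) k0 andbF.
Qed.

End HookModel.

(** * Crystal reflections on hooks *)

Lemma sorted_split (i : nat) (s : seq nat) : sorted leq s ->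
  exists lo x hi, [/\ s = lo ++ nseq x i ++ hi, all (gtn i) lo & all (ltn i) hi].
Proof.
elim: s => [|v s IHs]; first by exists [::], 0, [::].
move=> /= vs; case: (IHs (path_sorted vs)) => lo [x [hi [es hlo hhi]]].
case: (ltngtP v i) => hv.
- by exists (v :: lo), x, hi; rewrite es /= hv hlo.
- exists [::], 0, (v :: s); split=> //=; rewrite hv /=.
  apply/allP => w ws; apply: leq_trans hv _.
  by move/allP: (order_path_min leq_trans vs) => /(_ w ws).
- have lo0 : lo = [::].
    case: lo es hlo => // u lo es /= /andP[hu _]; move: vs; rewrite es /=.
    by case/andP; rewrite hv leqNgt hu.
  by exists [::], x.+1, hi; split => //; rewrite es lo0 hv.
Qed.

Lemma sorted_split2 (i : nat) (s : seq nat) : sorted leq s ->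
  exists lo x y hi, [/\ s = lo ++ nseq x i ++ nseq y i.+1 ++ hi,
     all (gtn i) lo & all (ltn i.+1) hi].
Proof.
move=> ss; have [lo [x [s1 [es hlo hs1]]]] := sorted_split i ss.
have ss1 : sorted leq s1.
  by apply: (subseq_sorted leq_trans _ ss);
      rewrite es !(subseq_trans _ (suffix_subseq _ _)).
have [lo1 [y [hi [es1 hlo1 hhi]]]] := sorted_split i.+1 ss1.
have lo10 : lo1 = [::].
  case: lo1 es1 hlo1 => // u l es1 /= /andP[h _]; move: hs1.
  by rewrite es1 /= => /andP[]; lia.
by exists lo, x, y, hi; split=> //; rewrite es es1 lo10.
Qed.

Section Bracket.
Variables (f : box -> nat) (i : nat).
Local Notation step := (bracket_step f i).

Lemma bracket_skip s bs : all (fun p => (f p != i) && (f p != i.+1)) bs ->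
  foldl step s bs = s.
Proof.
elim: bs s => //= p bs IH s /andP[/andP[h1 h2] h3].
by rewrite IH // /bracket_step (negbTE h1) (negbTE h2).
Qed.

Lemma bracket_open s bs : all (fun p => f p == i.+1) bs ->
  foldl step s bs = (s.1, rev bs ++ s.2).
Proof.
elim: bs s => [[]|p bs IH s] //= /andP[h h'].
by rewrite IH // /bracket_step h /= rev_cons cat_rcons.
Qed.

(** Each closing letter pops one opened box, so exactly the first [size s.2] of them are matched. *)
Lemma bracket_close s bs : all (fun p => f p == i) bs ->
  foldl step s bs = (s.1 ++ drop (size s.2) bs, drop (size bs) s.2).
Proof.
elim: bs s => [[s1 s2]|p bs IH s] /=; first by rewrite cats0 drop0.
case/andP=> h h'; rewrite IH // /bracket_step (eqP h) (ltn_eqF (ltnSn i)) eqxx.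
case: s => s1 [|q s2] //=; by rewrite drop0 cat_rcons.
Qed.
End Bracket.

Definition legb a k : seq box := [seq (r.+1, 0) | r <- iota a k].
Definition rowb a k : seq box := [seq (0, c) | c <- iota a k].

Lemma legb_cat a k l : legb a (k + l) = legb a k ++ legb (a + k) l.
Proof. by rewrite /legb iotaD map_cat. Qed.

Lemma rowb_cat a k l : rowb a (k + l) = rowb a k ++ rowb (a + k) l.
Proof. by rewrite /rowb iotaD map_cat. Qed.

Lemma mem_rowb a k r c : ((r, c) \in rowb a k) = (r == 0) && (a <= c < a + k).
Proof.
apply/mapP/idP => [[d]|]; first by rewrite mem_iota => h [-> ->].
by case/andP => /eqP-> h; exists c; rewrite ?mem_iota.
Qed.

Lemma index_rowb a k c : a <= c < a + k -> index (0, c) (rowb a k) = c - a.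
Proof.
move=> h; rewrite /rowb index_map; last by move=> ? ? [].
have lt : c - a < size (iota a k) by rewrite size_iota; lia.
have e : nth 0 (iota a k) (c - a) = c by rewrite nth_iota; lia.
by rewrite -{1}e index_uniq ?iota_uniq.
Qed.

Lemma all_legb (P : pred nat) row l0 l1 l2 (Q : pred nat) :
  all Q l1 -> (forall v, Q v -> P v) ->
  all (fun p => P (hookf row (l0 ++ l1 ++ l2) p)) (legb (size l0) (size l1)).
Proof.
move=> /allP h hPQ; rewrite all_map; apply/allP => r.
rewrite mem_iota => /andP[h1 h2]; rewrite /= /hookf /=; apply/hPQ/h.
rewrite nth_cat ltnNge h1 /= nth_cat.
have lt : r - size l0 < size l1 by lia.
by rewrite lt mem_nth.
Qed.

Lemma all_rowb (P : pred nat) leg l0 l1 l2 (Q : pred nat) :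
  all Q l1 -> (forall v, Q v -> P v) ->
  all (fun p => P (hookf (l0 ++ l1 ++ l2) leg p)) (rowb (size l0) (size l1)).
Proof.
move=> /allP h hPQ; rewrite all_map; apply/allP => r.
rewrite mem_iota => /andP[h1 h2]; rewrite /= /hookf /=; apply/hPQ/h.
rewrite nth_cat ltnNge h1 /= nth_cat.
have lt : r - size l0 < size l1 by lia.
by rewrite lt mem_nth.
Qed.

Section HookOperators.
Variables (n N m : nat).
Hypothesis ltmN : m < N.
Local Notation la := (hook N m).
Implicit Types (T : SST n la) (row leg : seq nat).

Lemma reading_hook : reading_boxes la = rev (legb 0 m) ++ rowb 0 (N - m).
Proof.
rewrite /reading_boxes size_hook -addn1 addnC iotaD rev_cat.
rewrite map_cat flatten_cat; congr (_ ++ _); last by rewrite /= cats0.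
rewrite add0n (iotaDl 1 0) /legb -!map_rev -map_comp.
have : all (gtn m) (rev (iota 0 m)).
  by rewrite all_rev; apply/allP => x; rewrite mem_iota.
elim: (rev _) => //= r s IH /andP[h /IH->].
by rewrite nth_nseq h.
Qed.

(** The leg is read upwards and before the row, so the letters [i] and [i.+1] form the word (i+1)^b
    i^a i^x (i+1)^y: only the [b] openings of the leg can be matched, with the first closings that
    follow. *)
Lemma unmatched_hook i lo x y hi l1 a b l2 :
  let row := lo ++ nseq x i ++ nseq y i.+1 ++ hi in
  let leg := l1 ++ nseq a i ++ nseq b i.+1 ++ l2 in
  size row = N - m -> size leg = m ->
  all (gtn i) lo -> all (ltn i.+1) hi -> all (gtn i) l1 -> all (ltn i.+1) l2 ->
  a <= 1 -> b <= 1 ->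
  unmatched la (hookf row leg) i =
    (drop b (legb (size l1) a) ++ drop (b - a) (rowb (size lo) x),
     drop (a + x) (legb (size l1 + a) b) ++ rowb (size lo + x) y).
Proof.
move=> row leg srow sleg hlo hhi hl1 hl2 ha hb.
rewrite /unmatched reading_hook foldl_cat.
have ea : size (nseq a i) = a by rewrite size_nseq.
have eb : size (nseq b i.+1) = b by rewrite size_nseq.
have ex : size (nseq x i) = x by rewrite size_nseq.
have ey : size (nseq y i.+1) = y by rewrite size_nseq.
have -> : legb 0 m = legb 0 (size l1) ++ legb (size l1) a ++
    legb (size l1 + a) b ++ legb (size l1 + a + b) (size l2).
  rewrite -!legb_cat -sleg /leg !size_cat ea eb; congr (legb _ _); lia.
have -> : rowb 0 (N - m) = rowb 0 (size lo) ++ rowb (size lo) x ++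
    rowb (size lo + x) y ++ rowb (size lo + x + y) (size hi).
  rewrite -!rowb_cat -srow /row !size_cat ex ey; congr (rowb _ _); lia.
have F0 : all (fun p => (hookf row leg p != i) && (hookf row leg p != i.+1))
   (legb (size l1 + a + b) (size l2)).
  have := @all_legb (fun v => (v != i) && (v != i.+1)) row
    (l1 ++ nseq a i ++ nseq b i.+1) l2 [::] (ltn i.+1).
  rewrite !size_cat ea eb cats0 addnA -!catA; apply => // v /=; lia.
have F1 : all (fun p => hookf row leg p == i.+1) (legb (size l1 + a) b).
  have := @all_legb (fun v => v == i.+1) row
    (l1 ++ nseq a i) (nseq b i.+1) l2 (pred1 i.+1).
  rewrite !size_cat ea eb -!catA; apply => //; exact: all_pred1_nseq.
have F2 : all (fun p => hookf row leg p == i) (legb (size l1) a).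
  have := @all_legb (fun v => v == i) row
    l1 (nseq a i) (nseq b i.+1 ++ l2) (pred1 i).
  rewrite ea; apply => //; exact: all_pred1_nseq.
have F3 : all (fun p => (hookf row leg p != i) && (hookf row leg p != i.+1))
   (legb 0 (size l1)).
  have := @all_legb (fun v => (v != i) && (v != i.+1)) row
    [::] l1 (nseq a i ++ nseq b i.+1 ++ l2) (gtn i).
  apply => // v /=; lia.
have G0 : all (fun p => (hookf row leg p != i) && (hookf row leg p != i.+1))
   (rowb (size lo + x + y) (size hi)).
  have := @all_rowb (fun v => (v != i) && (v != i.+1)) leg
    (lo ++ nseq x i ++ nseq y i.+1) hi [::] (ltn i.+1).
  rewrite !size_cat ex ey cats0 addnA -!catA; apply => // v /=; lia.
have G1 : all (fun p => hookf row leg p == i.+1) (rowb (size lo + x) y).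
  have := @all_rowb (fun v => v == i.+1) leg
    (lo ++ nseq x i) (nseq y i.+1) hi (pred1 i.+1).
  rewrite !size_cat ex ey -!catA; apply => //; exact: all_pred1_nseq.
have G2 : all (fun p => hookf row leg p == i) (rowb (size lo) x).
  have := @all_rowb (fun v => v == i) leg
    lo (nseq x i) (nseq y i.+1 ++ hi) (pred1 i).
  rewrite ex; apply => //; exact: all_pred1_nseq.
have G3 : all (fun p => (hookf row leg p != i) && (hookf row leg p != i.+1))
   (rowb 0 (size lo)).
  have := @all_rowb (fun v => (v != i) && (v != i.+1)) leg
    [::] lo (nseq x i ++ nseq y i.+1 ++ hi) (gtn i).
  apply => // v /=; lia.
rewrite !rev_cat !foldl_cat.
rewrite (bracket_skip _ (bs := rev (legb _ (size l2)))) ?all_rev //.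
rewrite (bracket_open _ (bs := rev (legb _ b))) ?all_rev // revK /= cats0.
rewrite (bracket_close _ (bs := rev (legb _ a))) ?all_rev //=.
rewrite (bracket_skip _ (bs := rev (legb 0 _))) ?all_rev //.
rewrite (bracket_skip _ (bs := rowb 0 _)) //.
rewrite (bracket_close _ (bs := rowb _ x)) //=.
rewrite (bracket_open _ (bs := rowb _ y)) //=.
rewrite (bracket_skip _ (bs := rowb _ (size hi))) //=.
have sl c k : size (legb c k) = k by rewrite size_map size_iota.
have sr c k : size (rowb c k) = k by rewrite size_map size_iota.
have rv c k : k <= 1 -> rev (legb c k) = legb c k by case: k => [|[]].
rewrite rev_cat revK size_rev !size_drop !sl sr rv // drop_drop.
congr (_, _ ++ _); rewrite addnC.
by move: hb; case: (b) => [|[]] // _; case: (a + x).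
Qed.

(** A leg letter [i] or [i.+1] is kept when both letters occur in the tableau, because it is then
    matched or lies in the part of the unmatched word that keeps its value; when only one of them
    occurs, all its copies are renamed. *)
Lemma crystal_hook i lo x y hi l1 a b l2 :
  let row := lo ++ nseq x i ++ nseq y i.+1 ++ hi in
  let leg := l1 ++ nseq a i ++ nseq b i.+1 ++ l2 in
  size row = N - m -> size leg = m ->
  all (gtn i) lo -> all (ltn i.+1) hi -> all (gtn i) l1 -> all (ltn i.+1) l2 ->
  a <= 1 -> b <= 1 ->
  exists z a' b', [/\ z <= x + y, z + a' = y + b, a' + b' = a + b,
    a' = if (0 < a + x) && (0 < b + y) then a else b &
    crystal_entries la i (hookf row leg) =1
      hookf (lo ++ nseq z i ++ nseq (x + y - z) i.+1 ++ hi)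
            (l1 ++ nseq a' i ++ nseq b' i.+1 ++ l2)].
Proof.
move=> row leg srow sleg hlo hhi hl1 hl2 ha hb.
(* The changed boxes of the row form an interval starting after [z'] untouched copies of [i]; below,
   [z'] is 1 exactly when the first [i] of the row is matched with the [i.+1] of the leg. *)
have patchE s k z z' (c : nat) :
   s = size lo + z' -> s + k = size lo + x + y -> z' <= x -> z <= k ->
   nth 0 (lo ++ nseq (z + z') i ++ nseq (x + y - (z + z')) i.+1 ++ hi) c =
   if s <= c < s + k then if c - s < z then i else i.+1 else nth 0 row c.
  move=> -> hk hz' hz; rewrite /row !nth_cat !size_nseq !nth_nseq.
  case: (ltnP c (size lo)) => h1; first by rewrite ifF //; lia.
  case: (ltnP (c - size lo) (z + z')) => h2.
    case: ifP => h3; first by rewrite ifT //; lia.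
    by rewrite (_ : c - size lo < x = true) //; lia.
  case: (ltnP (c - size lo - (z + z')) (x + y - (z + z'))) => h3.
    by rewrite ifT ?ifF //; lia.
  rewrite ifF; last by lia.
  rewrite ifF; last by lia.
  rewrite ifF; last by lia.
  congr nth; lia.
rewrite /crystal_entries (unmatched_hook srow sleg) //.
have sl c k : size (legb c k) = k by rewrite size_map size_iota.
have sr c k : size (rowb c k) = k by rewrite size_map size_iota.
case: (eqVneq a b) => [eab|neab].
  subst b; exists y, a, a; split=> //; first lia.
    by case: ifP.
  have -> : drop a (legb (size l1) a) = [::] by rewrite drop_oversize ?sl.
  have -> : drop (a + x) (legb (size l1 + a) a) = [::].
    by rewrite drop_oversize ?sl // leq_addr.
  rewrite subnn drop0 !cat0s -rowb_cat sr => -[r c].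
  rewrite mem_rowb; case: r => [|r] //=.
  have := patchE (size lo) (x + y) y 0 c; rewrite !addn0 /hookf /= => ->; try lia.
  by case: ifP => // h; rewrite index_rowb.
have [[ea eb]|[ea eb]] : (a = 0 /\ b = 1) \/ (a = 1 /\ b = 0) by lia.
  subst a b; case: x @row srow patchE => [|x] row srow patchE.
    exists y, 1, 0; split=> //; try lia.
    rewrite /= !addn0; set p0 := (_.+1, 0) => -[r c]; rewrite in_cons mem_rowb.
    have rE : nth 0 (lo ++ nseq y i ++ nseq (0 + y - y) i.+1 ++ hi) c =
       if size lo <= c < size lo + y then i else nth 0 row c.
      have := patchE (size lo) y y 0 c; rewrite !addn0 => ->; try lia.
      by case: ifP => // h; rewrite ifT //; lia.
    case: r => [|r] /=.
      rewrite /hookf /= rE; case: ifP => // h.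
      by rewrite index_rowb // sr ifT //; lia.
    case: c rE => [|c] rE; rewrite /hookf /= ?orbF ?xpair_eqE ?andbF //.
    rewrite andbT eqSS /p0; case: eqP => [->|ne].
      by rewrite eqxx /= ?nth_cat ltnn subnn.
    rewrite /leg nth_cat [RHS]nth_cat; case: (ltnP r (size l1)) => // h.
    have : r - size l1 != 0 by lia.
    by case: (r - size l1).
  (* The first [i] of the row is matched and stays, whence the [.+1]. *)
  exists y.+1, 0, 1; split=> //; try lia.
  have -> : drop (1 - 0) (rowb (size lo) x.+1) = rowb (size lo).+1 x by rewrite /= drop0.
  rewrite /= -[size lo + x.+1]addSnnS -rowb_cat sr.
  move=> [r c]; rewrite mem_rowb; case: r => [|r] //=.
  have := patchE (size lo).+1 (x + y) y 1 c; rewrite !addn1 /hookf /= => ->; try lia.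
  by case: ifP => // h; rewrite index_rowb.
subst a b; exists y.-1, (0 < y : nat), (y == 0 : nat); split=> //; try lia.
rewrite sub0n /= drop0 -cat_cons -rowb_cat sr => -[r c].
rewrite cat_cons -rowb_cat; set p0 := (_.+1, 0); rewrite in_cons mem_rowb.
case: r => [|r] /=.
  have := patchE (size lo) (x + y) y.-1 0 c; rewrite !addn0 /hookf /= => ->; try lia.
  case: ifP => // h; rewrite index_rowb //; congr (if _ then _ else _); lia.
case: c => [|c]; rewrite /hookf /= ?orbF ?xpair_eqE ?andbF //.
rewrite andbT eqSS /p0; case: eqP => [->|ne].
  rewrite eqxx /= nth_cat ltnn subnn; by case: (y).
rewrite /leg nth_cat [RHS]nth_cat; case: (ltnP r (size l1)) => // h.
have : r - size l1 != 0 by lia.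
by case: (r - size l1) => // k _ /=; case: (y).
Qed.

End HookOperators.

Lemma sorted_leq_cat (s1 s2 : seq nat) (b : nat) :
  sorted leq s1 -> sorted leq s2 -> all (geq b) s1 -> all (leq b) s2 ->
  sorted leq (s1 ++ s2).
Proof.
move=> h1 h2 /allP a1 /allP a2.
rewrite (sorted_pairwise leq_trans) pairwise_cat -!(sorted_pairwise leq_trans).
rewrite h1 h2 !andbT; apply/allrelP => u v /a1 /= hu /a2; exact: leq_trans.
Qed.

Lemma sorted_ltn_cat (s1 s2 : seq nat) (b : nat) :
  sorted ltn s1 -> sorted ltn s2 -> all (gtn b) s1 -> all (leq b) s2 ->
  sorted ltn (s1 ++ s2).
Proof.
move=> h1 h2 /allP a1 /allP a2.
rewrite (sorted_pairwise ltn_trans) pairwise_cat -!(sorted_pairwise ltn_trans).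
rewrite h1 h2 !andbT; apply/allrelP => u v /a1 /= hu /a2; exact: leq_trans.
Qed.

Lemma sorted_leq_nseq k (v : nat) : sorted leq (nseq k v).
Proof. by case: k => //= k; elim: k => //= k ->; rewrite leqnn. Qed.

Lemma count_mem0 (T : eqType) (v : T) (s : seq T) :
  v \notin s -> count_mem v s = 0.
Proof. by move/count_memPn. Qed.

Definition swapS (i v : nat) :=
  if v == i then i.+1 else if v == i.+1 then i else v.

Section CrystalModel.
Variables (n N m : nat).
Hypothesis ltmN : m < N.
Local Notation la := (hook N m).
Implicit Types (T : SST n la) (row leg : seq nat).

Lemma crystal_model T i : 0 < i < n ->
  let T' := crystal_refl i T in
  (forall k, 0 < k -> content T' k = content T (swapS i k)) /\
  (forall v, (v \in leg_of T') =
     ((if (0 < content T i) && (0 < content T i.+1) then v else swapS i v)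
        \in leg_of T)).
Proof.
move=> /andP[i0 ltin] T'.
have /and5P[/eqP sr /eqP sl so pa al] := model_valid ltmN T.
have [lo [x [y [hi [erow hlo hhi]]]]] := sorted_split2 i so.
have [l1 [a [b [l2 [eleg hl1 hl2]]]]] :
    exists lo x y hi, [/\ leg_of T = lo ++ nseq x i ++ nseq y i.+1 ++ hi,
     all (gtn i) lo & all (ltn i.+1) hi].
  apply: sorted_split2; apply: (sub_sorted (e := ltn)); last exact: path_sorted pa.
  by move=> ? ? /ltnW.
have : uniq (leg_of T) by apply: (sorted_uniq ltn_trans ltnn (path_sorted pa)).
move=> U; have ha : a <= 1.
  have := count_uniq_mem i U; rewrite eleg !count_cat !count_nseq /= eqxx; clear; lia.
have hb : b <= 1.
  have := count_uniq_mem i.+1 U; rewrite eleg !count_cat !count_nseq /= eqxx; clear; lia.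
have srow : size (lo ++ nseq x i ++ nseq y i.+1 ++ hi) = N - m by rewrite -erow.
have sleg : size (l1 ++ nseq a i ++ nseq b i.+1 ++ l2) = m by rewrite -eleg.
have [z [a' [b' [hz hza hab ea' eqc]]]] :=
  crystal_hook ltmN srow sleg hlo hhi hl1 hl2 ha hb.
set row' := lo ++ nseq z i ++ nseq (x + y - z) i.+1 ++ hi in eqc.
set leg' := l1 ++ nseq a' i ++ nseq b' i.+1 ++ l2 in eqc.
have nlo j : i <= j -> count_mem j lo = 0.
  move=> h; apply/count_memPn; apply/negP => /(allP hlo) /=; clear -h; lia.
have nl1 j : i <= j -> count_mem j l1 = 0.
  move=> h; apply/count_memPn; apply/negP => /(allP hl1) /=; clear -h; lia.
have nhi j : j <= i.+1 -> count_mem j hi = 0.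
  move=> h; apply/count_memPn; apply/negP => /(allP hhi) /=; clear -h; lia.
have nl2 j : j <= i.+1 -> count_mem j l2 = 0.
  move=> h; apply/count_memPn; apply/negP => /(allP hl2) /=; clear -h; lia.
have ci : content T i = a + x.
  rewrite content_model // erow eleg !count_cat !count_nseq /= eqxx.
  rewrite nlo // nl1 // nhi // nl2 // gtn_eqF //; clear -hza; lia.
have ciS : content T i.+1 = b + y.
  rewrite content_model // erow eleg !count_cat !count_nseq /= eqxx.
  rewrite nlo // nl1 // nhi // nl2 // ltn_eqF //; clear; lia.
have sorow : sorted leq lo /\ sorted leq hi.
  split; apply: (subseq_sorted leq_trans _ so); rewrite erow.
    exact: prefix_subseq.
  by rewrite !catA; exact: suffix_subseq.
have soleg : sorted ltn l1 /\ sorted ltn l2.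
  split; apply: (subseq_sorted ltn_trans _ (path_sorted pa)); rewrite eleg.
    exact: prefix_subseq.
  by rewrite !catA; exact: suffix_subseq.
have ab : (a' = a) * (b' = b) + (a' = b) * (b' = a).
  by move: ea'; case: ifP => _ e; [left|right]; split=> //; clear -hab e; lia.
have ha' : a' <= 1 by rewrite ea'; case: ifP.
have hb' : b' <= 1 by case: ab => -[_ ->].
have sorow' : sorted leq row'.
  apply: (@sorted_leq_cat _ _ i); first by case: sorow.
  - apply: (@sorted_leq_cat _ _ i); first exact: sorted_leq_nseq.
    + apply: (@sorted_leq_cat _ _ i.+1); first exact: sorted_leq_nseq.
      * by case: sorow.
      * by rewrite all_nseq /= leqnn orbT.
      * by apply: sub_all hhi => v /=; exact: ltnW.
    + by rewrite all_nseq /= leqnn orbT.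
    + rewrite all_cat all_nseq /= leqnSn orbT /=.
      by apply: sub_all hhi => v /=; clear; lia.
  - by apply: sub_all hlo => v /=; exact: ltnW.
  - rewrite !all_cat !all_nseq /= leqnn leqnSn !orbT /=.
    by apply: sub_all hhi => v /=; clear; lia.
have soleg' : sorted ltn leg'.
  apply: (@sorted_ltn_cat _ _ i) => //; first by case: soleg.
  - apply: (@sorted_ltn_cat _ _ i.+1); first by case: (a') ha' => [|[]].
    + apply: (@sorted_ltn_cat _ _ i.+2); first by case: (b') hb' => [|[]].
      * by case: soleg.
      * by rewrite all_nseq /= ltnSn orbT.
      * by apply: sub_all hl2.
    + by rewrite all_nseq /= ltnSn orbT.
    + rewrite all_cat all_nseq /= leqnn orbT /=.
      by apply: sub_all hl2 => v /=; clear; lia.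
  - rewrite !all_cat !all_nseq /= leqnn leqnSn !orbT /=.
    by apply: sub_all hl2 => v /=; clear; lia.
move: (pa); rewrite (path_sortedE ltn_trans) => /andP[hd _].
have V : hook_valid n N m row' leg'.
  apply/and5P; split => //.
  - by rewrite -srow !size_cat !size_nseq; apply/eqP; clear -hz; lia.
  - by rewrite -sleg !size_cat !size_nseq; apply/eqP; clear -hab; lia.
  (* The new leg must lie above the new corner. The corner can change only if [lo] is empty; in that
     case the new corner is [i], [i.+1] or the head of [hi]. *)
  - rewrite (path_sortedE ltn_trans) soleg' andbT.
    move: hd; rewrite erow eleg /row' /leg' !all_cat !all_nseq.
    case/and4P => hd1 hd2 hd3 hd4.
    case: (lo) hlo hd1 hd2 hd3 hd4 => [|v l] /=.
      move=> _; case: (x) ci hza hz ea' => [|x'] ci hza hz ea' /=.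
        case: (y) ciS hza hz ea' => [|y'] ciS hza hz ea' /=.
          have -> : z = 0 by clear -hz; lia.
          move=> /= -> h1 h2 ->; rewrite andbT /=.
          have hh : (head 0 hi == 0) || (i.+1 < head 0 hi).
            by case: (hi) hhi => //= v l /andP[-> _]; rewrite orbT.
          by case: ab => -[-> ->]; clear -h1 h2 hh i0; lia.
        rewrite ?ltnn ?orbF => hd1 ha0 hb0 hd4.
        have [a'0 b'0] : a' = 0 /\ b' = 0 by clear -ha0 hb0 ab; case: ab => -[]; lia.
        have l10 : l1 = [::].
          case: (l1) hl1 hd1 => //= v l /andP[h _] /andP[h' _]; clear -h h'; lia.
        have -> : z = y'.+1 by clear -hza a'0 hb0; lia.
        rewrite l10 a'0 b'0 /=; apply: sub_all hl2 => v /=; clear; lia.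
      rewrite !ltnn !orbF => hd1 ha0 hb0 hd4.
      have a0 : a = 0 by clear -ha0; lia.
      have a'0 : a' = 0 by move: ea'; case: ifP; clear -a0 hza hz ab; lia.
      have l10 : l1 = [::].
        case: (l1) hl1 hd1 => //= v l /andP[h _] /andP[h' _]; clear -h h'; lia.
      rewrite l10 a'0 /=.
      case: z hza hz {row' eqc sorow'} => [|z] hza hz.
        have -> : b' = 0 by clear -hza a'0 a0 hab; lia.
        rewrite subn0 addSn /=; apply: sub_all hl2 => v /=; clear; lia.
      rewrite /= ltnSn orbT /=; apply: sub_all hl2 => v /=; clear; lia.
    case/andP=> hv _ -> _ _ ->; rewrite hv !orbT /= andbT.
    by rewrite (ltn_trans hv) ?orbT.
  - move: al; rewrite erow eleg !all_cat !all_nseq.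
    case/andP=> /and4P[-> _ _ ->] /and4P[-> _ _ ->].
    by rewrite i0 (ltnW ltin) /= ltin !orbT.
have [eR eL] : row_of T' = row' /\ leg_of T' = leg'.
  apply: model_of_entries => // p.
  by rewrite entry_hookf // erow eleg eqc.
split.
  move=> k k0; rewrite content_model // eR eL !count_cat !count_nseq /=.
  rewrite /swapS; case: (eqVneq k i) => [->|ki].
    rewrite ciS ?eqxx nlo // nl1 // nhi // nl2 // gtn_eqF //; clear -hza; lia.
  case: (eqVneq k i.+1) => [->|kiS].
    rewrite ci ?eqxx nlo // nl1 // nhi // nl2 // ?ltn_eqF //; clear -hza hz hab; lia.
  rewrite content_model // erow eleg !count_cat !count_nseq /=.
  by rewrite ![_ == k]eq_sym (negbTE ki) (negbTE kiS).
move=> v; rewrite eL eleg /leg' ci ciS !mem_cat !mem_nseq.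
have nl : (i \in l1 = false) * (i.+1 \in l1 = false) * (i \in l2 = false) * (i.+1 \in
    l2 = false).
  do !split; apply/negbTE; rewrite -has_pred1 has_count -leqNgt leqn0 ?nl1 ?nl2 //.
rewrite ea'; case: ifP ea' => [h ea'|h ea'].
  by have -> : b' = b by clear -hab ea'; lia.
have -> : b' = a by clear -hab ea'; lia.
rewrite /swapS; case: (eqVneq v i) => [->|vi].
  by rewrite !nl eqxx (gtn_eqF (ltnSn i)) (ltn_eqF (ltnSn i)) !andbF !orbF.
case: (eqVneq v i.+1) => [->|viS].
  by rewrite !nl eqxx (ltn_eqF (ltnSn i)) !andbF !orbF.
by rewrite (negbTE vi) (negbTE viS) !andbF.
Qed.

End CrystalModel.

(** * Promotion on hooks *)

(** A dot of the first row stops at column 0 or against an earlier dot, which is encoded by 0. *)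
Lemma slide_stop k row leg z : (z = 0 \/ nth 0 row z.-1 = 0) ->
  slide k (hookf row leg) 0 z = hookf row leg.
Proof.
case: k => //= k h; case: z h => [|z] //= [] // h.
by rewrite /hookf /= h eqxx.
Qed.

Lemma slide_row k z s rest leg : size s <= k -> all (ltn 0) s ->
  slide k (hookf (nseq z 0 ++ s ++ 0 :: rest) leg) 0 (z + size s) =
  hookf (nseq z.+1 0 ++ s ++ rest) leg.
Proof.
elim/last_ind: s k rest => [|s v IHs] k rest.
  move=> _ _; rewrite addn0 slide_stop; last first.
    case: z => [|z]; [by left|right].
    by rewrite nth_cat size_nseq ltnSn nth_nseq ltnSn.
  rewrite /= -[0 :: rest]/(nseq 1 0 ++ rest) catA -nseqD addn1 //.
rewrite size_rcons all_rcons => + /andP[/= hv hs]; case: k => // k hk.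
rewrite addnS /=.
have fv : hookf (nseq z 0 ++ rcons s v ++ 0 :: rest) leg (0, z + size s) = v.
  rewrite /hookf /= nth_cat size_nseq ltnNge leq_addr /= addKn.
  by rewrite nth_cat size_rcons ltnSn nth_rcons ltnn eqxx.
rewrite fv (gtn_eqF hv) leqNgt hv /= [in RHS]cat_rcons.
rewrite -[RHS]/(hookf (nseq z.+1 0 ++ s ++ v :: rest) leg) -(IHs k) //.
congr slide; apply: functional_extensionality => -[[|r] c];
  rewrite /set_box /hookf /= ?xpair_eqE //=.
rewrite !nth_cat !size_nseq; case: (ltnP c z) => hc.
  by rewrite !ifF //; lia.
rewrite size_rcons nth_rcons.
case: (ltngtP (c - z) (size s)) => h.
- have -> : c - z < (size s).+1 by lia.
  by rewrite !ifF //; lia.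
- rewrite ifF; last by lia.
  case: eqP => [->|ne].
    have -> : (z + size s).+1 - z - size s = 1 by lia.
    by [].
  have -> : c - z < (size s).+1 = false by lia.
  have : c - z - size s > 1 by lia.
  have -> : c - z - (size s).+1 = (c - z - size s).-1 by lia.
  by case: (c - z - size s) => [|[]].
have -> : c = z + size s by lia.
by rewrite eqxx addKn subnn.
Qed.

(** A leg box has no left neighbour, so the dot climbs to the corner and the entries it passes move
    down. *)
Lemma slide_col k c0 r l rest : size l < k -> 0 < c0 -> all (ltn 0) l ->
  slide k (hookf (c0 :: r) (l ++ 0 :: rest)) (size l).+1 0 =
  hookf (0 :: r) (c0 :: l ++ rest).
Proof.
elim/last_ind: l k rest => [|l v IHl] [|k] rest // hk h0 hl.
  rewrite /= {1 2 3}/hookf /= (gtn_eqF h0) /=.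
  rewrite -[hookf (0 :: r) _](@slide_stop k _ _ 0); last by left.
  congr slide; apply: functional_extensionality => -[[|[|?]] [|?]] //.
move: hl hk; rewrite size_rcons all_rcons => /andP[/= hv hl] hk.
rewrite [slide _ _ _ _]/=.
have fv : hookf (c0 :: r) (rcons l v ++ 0 :: rest) ((size l).+1, 0) = v.
  by rewrite /hookf /= nth_cat size_rcons ltnSn nth_rcons ltnn eqxx.
rewrite fv (gtn_eqF hv) /= [in RHS]cat_rcons -(IHl k (v :: rest)) //.
congr slide; apply: functional_extensionality => -[[|i] c];
  rewrite /set_box /hookf //= ?xpair_eqE //=.
case: c => [|c]; rewrite ?andbF ?andbT //= !eqSS.
rewrite cat_rcons !nth_cat; case: (ltngtP i (size l)) => h.
- by rewrite ifF //; lia.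
- case: eqP => [->|ne]; first by rewrite subSnn.
  have : i - size l > 1 by lia.
  by case: (i - size l) => [|[]].
- by rewrite h subnn.
Qed.

(** Taken from left to right, the dots pile up at the beginning of the row. *)
Lemma foldl_slide_row z s d rest leg : all (ltn 0) s ->
  foldl (fun g p => slide (p.1 + p.2) g p.1 p.2)
    (hookf (nseq z 0 ++ s ++ nseq d 0 ++ rest) leg) (rowb (z + size s) d) =
  hookf (nseq (z + d) 0 ++ s ++ rest) leg.
Proof.
move=> hs; elim: d z => [|d IHd] z; first by rewrite addn0.
rewrite /= add0n slide_row ?leq_addl // -[(z + size s).+1]addSn -/(rowb _ d).
by rewrite IHd addSnnS.
Qed.

Section Promotion.
Variables (n N m : nat).
Hypotheses (ltmN : m < N) (n_gt0 : 0 < n).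
Local Notation la := (hook N m).
Implicit Types (T : SST n la) (row leg : seq nat).

(** Boxes are listed by columns, so a dot in the leg precedes the dots of the row. The last
    hypothesis expresses that the corner is not [n] when the leg contains [n]. *)
Lemma dots_hook r0 d l0 e :
  let row := r0 ++ nseq d n in let leg := l0 ++ nseq e n in
  size row = N - m -> size leg = m ->
  all (gtn n) r0 -> all (gtn n) l0 -> (0 < e -> 0 < size r0) ->
  dots n la (hookf row leg) = legb (size l0) e ++ rowb (size r0) d.
Proof.
move=> row leg sr sl hr hl h; rewrite /dots size_hook /=.
have E1 : [seq p <- legb 0 m | hookf row leg p == n] = legb (size l0) e.
  have -> : legb 0 m = legb 0 (size l0) ++ legb (size l0) e.
    by rewrite -legb_cat -sl /leg size_cat size_nseq.
  rewrite filter_cat (_ : filter _ (legb 0 _) = [::]) ?cat0s.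
    apply/all_filterP.
    have := @all_legb (pred1 n) row l0 (nseq e n) [::] (pred1 n).
    by rewrite cats0 size_nseq; apply; rewrite ?all_pred1_nseq.
  apply/eqP; rewrite -[_ == _]negbK -has_filter -all_predC.
  have := @all_legb (predC1 n) row [::] l0 (nseq e n) (gtn n).
  apply=> // v /=; lia.
have E2 : [seq p <- rowb 0 (N - m) | hookf row leg p == n] = rowb (size r0) d.
  have -> : rowb 0 (N - m) = rowb 0 (size r0) ++ rowb (size r0) d.
    by rewrite -rowb_cat -sr /row size_cat size_nseq.
  rewrite filter_cat (_ : filter _ (rowb 0 _) = [::]) ?cat0s.
    apply/all_filterP.
    have := @all_rowb (pred1 n) leg r0 (nseq d n) [::] (pred1 n).
    by rewrite cats0 size_nseq; apply; rewrite ?all_pred1_nseq.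
  apply/eqP; rewrite -[_ == _]negbK -has_filter -all_predC.
  have := @all_rowb (predC1 n) leg [::] r0 (nseq d n) (gtn n).
  apply=> // v /=; lia.
have E3 k s : [seq p <- flatten [seq [seq (r, c) | r <- iota 0 m.+1] | c <- iota k.+1 s]
      | hookf row leg p == n] = [seq p <- rowb k.+1 s | hookf row leg p == n].
  elim: s k => [|s IHs] k //.
  rewrite [iota k.+1 s.+1]/= [map _ (_ :: _)]/= [flatten _]/= -cat_cons.
  rewrite filter_cat IHs [rowb k.+1 _]/= [RHS]/= -/(rowb k.+2 s).
  rewrite [X in X ++ _](_ : _ = if hookf row leg (0, k.+1) == n then [:: (0,
      k.+1)] else [::]).
    by case: ifP.
  rewrite /= (_ : filter _ _ = [::]) //; apply/eqP.
  rewrite -[_ == _]negbK -has_filter -all_predC; apply/allP => p /mapP[r].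
  rewrite mem_iota => /andP[r1 _] -> /=; case: r r1 => // r _.
  by rewrite /hookf /= ltn_eqF.
have nm0 : 0 < N - m by lia.
case eNm : (N - m) nm0 E2 => [|b] // _ E2.
rewrite [iota 0 b.+1]/= [map _ (_ :: _)]/= [flatten _]/= -cat_cons filter_cat E3.
have -> : (0, 0) :: [seq (r, 0) | r <- iota 1 m] = (0, 0) :: legb 0 m.
  by rewrite /legb (iotaDl 1 0) -map_comp.
move: E2; rewrite /= -/(rowb 1 b) E1.
case: ifP => h0; last by move=> <-.
case: e @leg sl E1 E3 h h0 => [|e] leg sl E1 E3 h h0 /=; first by move=> <-.
case: r0 @row sr hr {E1 E3} h h0 => [|v r0] row sr hr h; first by have := h isT.
by move: hr => /= /andP[hv _]; rewrite /hookf /= ltn_eqF.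
Qed.

(** A dot at the foot of the leg rises to the corner, which pushes the old corner entry into the
    leg; all dots then gather at the start of the row. *)
Lemma promotion_hook r0 d l0 e :
  let row := r0 ++ nseq d n in let leg := l0 ++ nseq e n in
  size row = N - m -> size leg = m ->
  all (fun v => 0 < v < n) r0 -> all (fun v => 0 < v < n) l0 ->
  e <= 1 -> (0 < e -> 0 < size r0) ->
  promotion_entries n la (hookf row leg) =1
    if e == 0 then hookf (nseq d 1 ++ map S r0) (map S l0)
    else hookf (nseq d.+1 1 ++ map S (behead r0)) (map S (head 0 r0 :: l0)).
Proof.
move=> row leg sr sl hr hl e1 h; rewrite /promotion_entries dots_hook //;
  try by apply: sub_all (hl) => v /andP[].
  2: by apply: sub_all (hr) => v /andP[].
have -> : (fun p => if hookf row leg p == n then 0 else hookf row leg p) =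
   hookf (r0 ++ nseq d 0) (l0 ++ nseq e 0).
  have E s : all (fun v => 0 < v < n) s -> forall k c,
     (if nth 0 (s ++ nseq k n) c == n then 0 else nth 0 (s ++ nseq k n) c) =
     nth 0 (s ++ nseq k 0) c.
    move=> hs k c; rewrite !nth_cat; case: ltnP => hc.
      by case/andP: (allP hs _ (mem_nth 0 hc)) => _ hv; rewrite ltn_eqF.
    by rewrite !nth_nseq; case: ltnP; rewrite ?eqxx //; case: ifP.
  apply: functional_extensionality => -[[|r] c]; rewrite /hookf /=.
    exact: E.
  by case: c => [|c]; [exact: E | case: eqP].
have pr s : all (fun v => 0 < v < n) s -> all (ltn 0) s.
  by apply: sub_all => v /andP[].
have fin row1 leg1 : size row1 = N - m -> size leg1 = m ->
   (fun p => if p.2 < nth 0 la p.1 then (hookf row1 leg1 p).+1 else 0) =1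
   hookf (map S row1) (map S leg1).
  move=> s1 s2 [[|r] c]; rewrite nth_hook /hookf /=.
    case: ltnP => hc; first by rewrite (nth_map 0) ?s1.
    by rewrite nth_default ?size_map ?s1.
  case: (ltnP r m) => hr'; last by case: c => [|c] //=; rewrite nth_default ?size_map ?s2.
  by case: c => [|c] //=; rewrite (nth_map 0) ?s2.
rewrite {}/row in sr *; rewrite {}/leg in sl *.
move: e1; case: e sl h => [|[|e]] // sl h _.
  rewrite cat0s cats0 -[r0 ++ nseq d 0]/(nseq 0 0 ++ r0 ++ nseq d 0) -[nseq d 0]cats0.
  rewrite -[size r0]add0n foldl_slide_row ?pr // add0n cats0 => p.
  rewrite fin ?map_cat ?map_nseq //.
    by rewrite -sr !size_cat !size_nseq addnC.
  by rewrite -sl cats0.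
case: r0 sr hr h => [|v r0] sr; first by move=> _ /(_ isT).
move=> /andP[/andP[v0 vn] hr0] _.
have H1 g : foldl (fun g p => slide (p.1 + p.2) g p.1 p.2) g (legb (size l0) 1) =
    slide ((size l0).+1 + 0) g (size l0).+1 0 by [].
rewrite foldl_cat H1 addn0 slide_col ?pr // cats0 -[0 :: _]/(nseq 1 0 ++ r0 ++ nseq d 0).
rewrite -[nseq d 0]cats0 -[size (v ::
    r0)]/(1 + size r0) foldl_slide_row ?pr // cats0 => p.
rewrite fin ?map_cat ?map_nseq //.
  by rewrite -sr /= !size_cat !size_nseq addnC.
by rewrite -sl /= size_cat addn1.
Qed.

End Promotion.

(** * Contents and bit vectors *)

Definition supp (a : seq nat) : seq nat :=
  [seq k.+1 | k <- iota 0 (size a) & 0 < nth 0 a k].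

Lemma mem_supp a v : (v \in supp a) = (0 < v) && (0 < nth 0 a v.-1).
Proof.
apply/mapP/idP => [[k]|/andP[v0 h]].
  by rewrite mem_filter => /andP[h _] ->.
exists v.-1; last by rewrite prednK.
rewrite mem_filter h mem_iota add0n /=.
by case: (ltnP v.-1 (size a)) h => // h'; rewrite nth_default.
Qed.

Lemma sorted_supp a : sorted ltn (supp a).
Proof.
rewrite sorted_map; apply: (sorted_filter (leT := ltn) ltn_trans).
exact: iota_ltn_sorted.
Qed.

Lemma size_supp a : size (supp a) = count (ltn 0) a.
Proof.
rewrite size_map size_filter -[in RHS](mkseq_nth 0 a) count_map.
by apply: eq_count.
Qed.

Lemma supp_rcons a z :
  supp (rcons a z) = supp a ++ nseq (0 < z) (size a).+1.
Proof.
rewrite /supp size_rcons -[in iota _ _]addn1 iotaD filter_cat map_cat.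
congr (_ ++ _); last first.
  by rewrite /= nth_rcons ltnn eqxx; case: (0 < z).
congr map; apply: eq_in_filter => k; rewrite mem_iota /= => h.
by rewrite nth_rcons h.
Qed.

Lemma supp_cons a z : supp (z :: a) = nseq (0 < z) 1 ++ map S (supp a).
Proof.
rewrite /supp [size _]/= -[in iota _ _]add1n iotaD filter_cat map_cat.
congr (_ ++ _); first by rewrite /=; case: (0 < z).
rewrite -map_comp add0n (iotaDl 1 0) filter_map -map_comp; congr map.
Qed.

Section Code.
Variables (n N m : nat).
Hypothesis ltmN : m < N.
Local Notation la := (hook N m).
Implicit Types (T : SST n la) (row leg : seq nat).

Definition cont T : seq nat := mkseq (fun k => content T k.+1) n.
(* [bits T] marks the leg letters inside the support deprived of its minimum,
   which is the corner of T. *)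
Definition bits T : bitseq := [seq v \in leg_of T | v <- behead (supp (cont T))].

Lemma size_cont T : size (cont T) = n.
Proof. exact: size_mkseq. Qed.

Lemma nth_cont T k : 0 < k <= n -> nth 0 (cont T) k.-1 = content T k.
Proof. by case: k => // k /andP[_ h]; rewrite nth_mkseq. Qed.

Lemma mem_supp_cont T v : (v \in supp (cont T)) =
  (v \in row_of T ++ leg_of T).
Proof.
have /and5P[_ _ _ _ al] := model_valid ltmN T.
rewrite mem_supp; case: v => [|v] /=.
  by apply/esym/negP => /(allP al).
case: (ltnP v n) => h.
  rewrite nth_mkseq // content_model // mem_cat -!has_pred1 !has_count.
  by rewrite addn_gt0.
rewrite nth_default ?size_mkseq // ltnn; apply/esym/negP => /(allP al) /=; lia.
Qed.

Lemma supp_cont T : exists s, supp (cont T) = head 0 (row_of T) :: s /\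
  {subset leg_of T <= s}.
Proof.
have /and5P[/eqP sr /eqP sl so pa al] := model_valid ltmN T.
have row0 : row_of T = head 0 (row_of T) :: behead (row_of T).
  by case: (row_of T) sr => //=; lia.
have cs : head 0 (row_of T) \in supp (cont T).
  by rewrite mem_supp_cont mem_cat row0 inE eqxx.
have mn v : v \in supp (cont T) -> head 0 (row_of T) <= v.
  rewrite mem_supp_cont mem_cat => /orP[].
    rewrite row0 inE => /orP[/eqP->//|h].
    move: so; rewrite row0 /= => /(order_path_min leq_trans)/allP; exact.
  by move: pa => /(order_path_min ltn_trans)/allP h /h /ltnW.
have lg v : v \in leg_of T -> v \in supp (cont T).
  by move=> h; rewrite mem_supp_cont mem_cat h orbT.
have lt v : v \in leg_of T -> head 0 (row_of T) < v.
  by move: pa => /(order_path_min ltn_trans)/allP h /h.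
case E : (supp (cont T)) (sorted_supp (cont T)) cs mn lg => [|u s] // so' cs mn lg.
have e : u = head 0 (row_of T).
  apply/eqP; rewrite eqn_leq mn ?inE ?eqxx // andbT.
  move: cs; rewrite inE => /orP[/eqP-> //|h].
  by apply: ltnW; move: so' => /= /(order_path_min ltn_trans)/allP ->.
exists s; split; first by rewrite e.
move=> v hv; have := lg v hv; rewrite inE => /orP[/eqP h|//].
by have := lt v hv; rewrite h e ltnn.
Qed.

Lemma leg_maskE T : leg_of T = mask (bits T) (behead (supp (cont T))).
Proof.
have /and5P[/eqP sr /eqP sl so pa al] := model_valid ltmN T.
have [s [E sub]] := supp_cont T.
rewrite /bits -filter_mask E /=.
apply: (irr_sorted_eq ltn_trans ltnn).
- exact: path_sorted pa.
- apply: (sorted_filter ltn_trans).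
  by have := sorted_supp (cont T); rewrite E => /path_sorted.
- move=> v; rewrite mem_filter /=; case: (boolP (v \in leg_of T)) => //= h.
  by rewrite sub.
Qed.

(** [bits] selects the leg inside the support; the row is what the content leaves, in increasing
    order. *)
Lemma code_inj T T' : cont T = cont T' -> bits T = bits T' -> T = T'.
Proof.
move=> ec eb; have el : leg_of T = leg_of T' by rewrite !leg_maskE ec eb.
apply: model_inj => //.
have /and5P[_ _ so _ al] := model_valid ltmN T.
have /and5P[_ _ so' _ al'] := model_valid ltmN T'.
apply: (sorted_eq leq_trans anti_leq so so').
apply/allP => v _ /=; apply/eqP.
case: (boolP (0 < v <= n)) => h; last first.
  move: al al'; rewrite !all_cat => /andP[a1 _] /andP[a2 _].
  have z s : all (fun v => 0 < v <= n) s -> count_mem v s = 0.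
    by move=> a3; apply/count_memPn; apply: contra h => /(allP a3).
  by rewrite !z.
have := nth_cont T h; rewrite ec nth_cont // !content_model //; try by case/andP: h.
by rewrite el => /addIn.
Qed.

Lemma size_bits T : size (bits T) = (count (ltn 0) (cont T)).-1.
Proof. by rewrite size_map size_behead size_supp. Qed.

Lemma count_bits T : count id (bits T) = m.
Proof.
rewrite -(size_mask (s := behead (supp (cont T)))) ?size_map //.
by rewrite -leg_maskE size_mkseq.
Qed.

Lemma sum_count_mem (s : seq nat) : all (fun v => 0 < v <= n) s ->
  sumn (mkseq (fun k => count_mem k.+1 s) n) = size s.
Proof.
elim: s => [|v s IHs] /=.
  by move=> _; rewrite sumnE big_map big1.
case/andP=> hv /IHs <-; rewrite !sumnE !big_map big_split /=.
rewrite -[RHS]add1n; congr (_ + _);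
    rewrite -/(index_iota 0 n) (bigD1_seq v.-1) ?iota_uniq //=.
  have v0 : 0 < v by lia.
  rewrite (prednK v0) eqxx big1 // => k /eqP h.
  by apply/eqP; rewrite eqb0; apply/eqP; lia.
rewrite mem_iota; lia.
Qed.

Lemma sumn_cont T : sumn (cont T) = N.
Proof.
have /and5P[/eqP sr /eqP sl _ _ al] := model_valid ltmN T.
transitivity (size (row_of T ++ leg_of T)); last first.
  by rewrite size_cat sr sl subnK // ltnW.
rewrite -sum_count_mem //.
congr sumn; apply: eq_map => k; by rewrite content_model // count_cat.
Qed.

Lemma code_surj (a : seq nat) (b : bitseq) : size a = n -> sumn a = N ->
  size b = (count (ltn 0) a).-1 -> count id b = m ->
  exists T, cont T = a /\ bits T = b.
Proof.
move=> sa suma sb cb.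
pose leg := mask b (behead (supp a)).
pose row := flatten [seq nseq (nth 0 a v.-1 - (v \in leg)) v | v <- iota 1 n].
have sleg : size leg = m by rewrite size_mask // size_behead size_supp.
have N0 : 0 < N by lia.
have supp0 : 0 < size (supp a).
  rewrite size_supp -has_count; case: (boolP (has _ _)) => // /hasPn h.
  have : sumn a = 0.
    elim: (a) h => //= x s IHs h; rewrite IHs ?addn0.
      by have := h x; rewrite inE eqxx => /(_ isT); lia.
    by move=> v hv; apply: h; rewrite inE hv orbT.
  by rewrite suma; lia.
case E : (supp a) supp0 => [|c s] // _.
have so := sorted_supp a.
have legs : {subset leg <= s} by move=> v; rewrite /leg E => /mem_mask.
have soleg : sorted ltn leg.
  rewrite /leg E; apply: (subseq_sorted ltn_trans (mask_subseq _ _)).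
  by move: so; rewrite E => /path_sorted.
have cleg : all (ltn c) leg.
  apply/allP => v /legs; move: so; rewrite E.
  by move/(order_path_min ltn_trans)/allP; apply.
have rng v : v \in supp a -> 0 < v <= n.
  rewrite mem_supp => /andP[-> h] /=; move: h.
  by case: (ltnP v.-1 (size a)) => h; [lia | rewrite nth_default].
have legn v : v \in leg -> 0 < v <= n.
  by move=> /legs h; apply: rng; rewrite E inE h orbT.
have lega v : v \in leg -> 0 < nth 0 a v.-1.
  by move=> /legs h; have := mem_supp a v; rewrite E inE h orbT => /esym/andP[].
have uleg : uniq leg by exact: (sorted_uniq ltn_trans ltnn).
have cntr v : 0 < v <= n -> count_mem v row = nth 0 a v.-1 - (v \in leg).
  move=> hv; rewrite count_flatten -map_comp sumnE big_map.
  rewrite (bigD1_seq v) ?iota_uniq ?mem_iota ?add1n //=.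
  rewrite count_nseq /= eqxx mul1n big1 ?addn0 // => w hw.
  by rewrite count_nseq /= (negbTE hw).
have rown : all (fun v => 0 < v <= n) row.
  apply/allP => v /flatten_mapP[w]; rewrite mem_iota mem_nseq => hw /andP[_ /eqP->].
  lia.
have srow : size row = N - m.
  rewrite -(sum_count_mem rown); apply/eqP; rewrite -(eqn_add2r m) subnK ?(ltnW ltmN) //.
  rewrite -[X in _ + X]sleg -sum_count_mem; last by apply/allP.
  rewrite !sumnE !big_map -big_split /= -[X in _ == X]suma sumnE.
  rewrite [X in _ == X](big_nth 0) sa /index_iota subn0; apply/eqP; apply:
      eq_big_seq => k.
  rewrite mem_iota => /andP[_ hk]; rewrite cntr // (count_uniq_mem _ uleg) subnK //.
  by case: (boolP (_ \in _)) => // /lega.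
have sorow : sorted leq row.
  rewrite /row; elim: (n) 1 => //= k IHk j.
  apply: (@sorted_leq_cat _ _ j) => //; first exact: sorted_leq_nseq.
    by rewrite all_nseq /= leqnn orbT.
  apply/allP => v /flatten_mapP[w]; rewrite mem_iota mem_nseq => hw /andP[_ /eqP->] /=.
  lia.
have V : hook_valid n N m row leg.
  apply/and5P; split; rewrite ?srow ?sleg //; last by rewrite all_cat rown; apply/allP.
  rewrite (path_sortedE ltn_trans) soleg andbT.
  (* The least letter [c] is not in the leg, so it occurs in the row, whose head is therefore at
     most [c] and lies below the leg. *)
  have cr : c \in row.
    rewrite -has_pred1 has_count cntr; last by apply: rng; rewrite E inE eqxx.
    have -> : c \in leg = false by apply/negP => /(allP cleg) /=; rewrite ltnn.
    by rewrite subn0; have := mem_supp a c; rewrite E inE eqxx => /esym/andP[].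
  apply: sub_all cleg => v /=; apply: leq_ltn_trans.
  case: (row) sorow cr => //= h r pr; rewrite inE => /orP[/eqP-> //|hc].
  by move/allP: (order_path_min leq_trans pr) => /(_ _ hc).
have [T [eR eL]] := model_surj ltmN V.
have ec : cont T = a.
  apply: (@eq_from_nth _ 0); rewrite size_mkseq // => k hk.
  rewrite nth_mkseq // content_model // eR eL cntr // (count_uniq_mem _ uleg) subnK //.
  by case: (boolP (_ \in _)) => // /lega.
exists T; split=> //.
rewrite /bits ec eL /leg E /=.
have us : uniq s by apply: (sorted_uniq ltn_trans ltnn); move: so; rewrite E =>
    /path_sorted.
have sbs : size b = size s by rewrite sb -size_supp E.
by elim: (s) (b) us sbs => [|v s' IHs] [|b0 b'] //= /andP[vs us] [sz];
  case: b0 => /=; rewrite ?inE ?eqxx /=; congr (_ :: _); (try by apply/negbTE;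
   apply: contra vs => /mem_mask); rewrite -[RHS](IHs b' us sz);
   apply/eq_in_map => w hw; rewrite ?inE //; case: eqP => // e; move: vs; rewrite -e hw.
Qed.

End Code.

Lemma swapSK i : involutive (swapS i).
Proof.
move=> v; rewrite /swapS; case: (eqVneq v i) => [->|h]; first by rewrite eqxx gtn_eqF.
by case: (eqVneq v i.+1) => [->|h']; rewrite ?eqxx // (negbTE h) (negbTE h').
Qed.

Lemma eq_supp (a b : seq nat) : supp a =i supp b -> supp a = supp b.
Proof.
by apply: (irr_sorted_eq ltn_trans ltnn); exact: sorted_supp.
Qed.

Section CodeActions.
Variables (n N m : nat).
Hypotheses (ltmN : m < N) (n_gt0 : 0 < n).
Local Notation la := (hook N m).
Implicit Types (T : SST n la).

Lemma mem_supp_content T v : (v \in supp (cont T)) = (0 < v <= n) && (0 < content T v).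
Proof.
rewrite mem_supp; case: (ltnP 0 v) => //= v0.
case: (leqP v n) => h; first by rewrite nth_cont ?v0.
by rewrite nth_default // size_cont; lia.
Qed.

Lemma swapS_range i v : 0 < i < n -> (0 < swapS i v <= n) = (0 < v <= n).
Proof. by rewrite /swapS => h; case: eqP => [->|_]; [|case: eqP => [->|_]]; lia. Qed.

(** If both letters occur, neither support nor leg changes. Otherwise both are renamed by [swapS i],
    which is increasing on the support because [i] and [i.+1] are not both in it; the pattern of leg
    letters is thus the same. *)
Lemma bits_crystal T i : 0 < i < n -> bits (crystal_refl i T) = bits T.
Proof.
move=> hi; have [hc hl] := crystal_model ltmN T hi.
set T' := crystal_refl i T in hc hl *.
case: (boolP ((0 < content T i) && (0 < content T i.+1))) hl => [both hl|nboth hl].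
  have e : supp (cont T') = supp (cont T).
    apply: eq_supp => v; rewrite !mem_supp_content; case: (boolP (0 < v <= n)) => //= hv.
    rewrite hc; last by case/andP: hv.
    rewrite /swapS; case: eqP => [->|_]; first by case/andP: both => -> ->.
    by case: eqP => [->|_] //; case/andP: both => -> ->.
  by rewrite /bits e; apply: eq_map.
have e : supp (cont T') = map (swapS i) (supp (cont T)).
  apply: (irr_sorted_eq ltn_trans ltnn); first exact: sorted_supp.
    apply: (@homo_sorted_in _ _ (mem (supp (cont T))) (swapS i) ltn ltn);
      [| by apply/allP | exact: sorted_supp].
    move=> u v; rewrite ![_ \in mem _]mem_supp_content => /andP[_ hu] /andP[_ hv] lt.
    rewrite /swapS; case: (eqVneq u i) => [eu|nu].
      case: (eqVneq v i) => [ev|nv]; first by lia.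
      case: (eqVneq v i.+1) => [ev|nv']; last by lia.
      by move: nboth; rewrite -ev -eu hu hv.
    case: (eqVneq u i.+1) => [eu|nu'].
      by case: (eqVneq v i) => [ev|nv]; [lia | case: (eqVneq v i.+1) => ?; lia].
    by case: (eqVneq v i) => [ev|nv]; [lia | case: (eqVneq v i.+1) => ?; lia].
  move=> v; rewrite -[v in RHS](swapSK i) mem_map; last exact: inv_inj (swapSK i).
  rewrite !mem_supp_content swapS_range //; case: (boolP (0 < v <= n)) => //= hv.
  by rewrite hc //; case/andP: hv.
rewrite /bits e behead_map -map_comp; apply: eq_map => v /=.
by rewrite hl swapSK.
Qed.

Definition cox T := foldr (@crystal_refl n la) T (iota 1 n.-1).

Lemma cox_code T : cont (cox T) = rotr 1 (cont T) /\ bits (cox T) = bits T.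
Proof.
(* The reflections with indices n - j, ..., n - 1, applied from the last one, bring the last
   multiplicity to place n - j and move those from place n - j on up by one. *)
have H j : j < n ->
    let T' := foldr (@crystal_refl n la) T (iota (n - j) j) in
    bits T' = bits T /\ forall k, 0 < k <= n -> content T' k =
      if k < n - j then content T k else if k == n - j then content T n
      else content T k.-1.
  elim: j => [|j IHj] hj /=.
    split=> // k hk; rewrite subn0; case: ltngtP => // h; last by rewrite h.
    by move: hk; lia.
  have [IHb IHc] := IHj (ltnW hj); move: IHb IHc.
  have -> : (n - j.+1).+1 = n - j by lia.
  set T1 := foldr _ _ _ => IHb IHc.
  have hi : 0 < n - j.+1 < n by lia.
  rewrite bits_crystal //; split=> // k hk.
  have [hc _] := crystal_model ltmN T1 hi; rewrite hc; last by case/andP: hk.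
  rewrite IHc ?swapS_range // /swapS.
  have e : (n - j.+1).+1 = n - j by lia.
  rewrite e; case: (ltngtP k (n - j.+1)) => h.
  - have -> : k == n - j = false by lia.
    by have -> : k < n - j by lia.
  - case: (eqVneq k (n - j)) => [ek|nk].
      have -> : n - j.+1 < n - j by lia.
      by congr content; lia.
    have -> : k < n - j = false by lia.
    by rewrite (negbTE nk).
  - by rewrite ltnn eqxx.
have hn : n.-1 < n by lia.
have := H _ hn; have -> : n - n.-1 = 1 by lia.
rewrite -/(cox T) => -[hb hc]; split=> //.
apply: (@eq_from_nth _ 0); first by rewrite size_rotr !size_cont.
rewrite size_cont => k hk; rewrite -[k]/(k.+1.-1) nth_cont // hc // ltnS ltn0.
case: n hk {H hn hc hb} T => // n' hk T.
have -> : cont T = rcons (mkseq (fun k => content T k.+1) n') (content T n'.+1).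
  by rewrite -mkseqS.
rewrite rotr1_rcons; case: k hk => [|k] hk //=.
by rewrite nth_mkseq.
Qed.

Definition prom T := of_entries T (promotion_entries n la (entry T)).

Lemma sorted_max_split (s : seq nat) : sorted leq s -> all (fun v => 0 < v <= n) s ->
  exists r d, s = r ++ nseq d n /\ all (fun v => 0 < v < n) r.
Proof.
move=> /(sorted_split n) [lo [x [hi [-> hlo hhi]]]].
rewrite !all_cat => /and3P[h1 _ h3].
have -> : hi = [::] by case: (hi) hhi h3 => //= v l /andP[? _] /andP[? _]; lia.
exists lo, x; rewrite cats0; split=> //; apply/allP => v hv.
by move/allP: h1 => /(_ v hv); move/allP: hlo => /(_ v hv) /=; lia.
Qed.

Lemma prom_model T :
  [/\ content (prom T) 1 = content T n,
      forall k, 0 < k < n -> content (prom T) k.+1 = content T k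
    & forall v, (v.+1 \in leg_of (prom T)) =
        ((v \in leg_of T) && (v != n))
        || ((n \in leg_of T) && (v == head 0 (row_of T)))].
Proof.
have /and5P[/eqP sr /eqP sl so pa al] := model_valid ltmN T.
move: (pa); rewrite (path_sortedE ltn_trans) => /andP[hd sol].
move: al; rewrite all_cat => /andP[alr alg].
have [r0 [d [er hr]]] := sorted_max_split so alr.
have [l0 [e [el hl]]] : exists r d, leg_of T = r ++ nseq d n /\ all (fun v =>
    0 < v < n) r.
  apply: sorted_max_split alg; apply: sub_sorted sol; exact: ltnW.
have U : uniq (leg_of T) by apply: (sorted_uniq ltn_trans ltnn).
have he : e <= 1.
  have := count_uniq_mem n U; rewrite el !count_cat !count_nseq /= eqxx; clear; lia.
have nr0 : n \notin r0 by apply/negP => /(allP hr); rewrite ltnn andbF.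
have nl0 : n \notin l0 by apply/negP => /(allP hl); rewrite ltnn andbF.
(* A row consisting of copies of [n] only would have corner [n], which is not below a leg letter
   [n]. *)
have her : 0 < e -> 0 < size r0.
  case: e el {he} => // e el _; case: (r0) er => // er.
  have := allP hd n; rewrite el mem_cat mem_nseq eqxx orbT => /(_ isT).
  rewrite er; case: (d) er => [|d'] er /=; last by rewrite ltnn.
  by move: sr; rewrite er /=; clear -ltmN; lia.
rewrite er in sr; rewrite el in sl.
have eqp := promotion_hook ltmN n_gt0 sr sl hr hl he her.
have p0 s : all (fun v => 0 < v < n) s -> count_mem 1 (map S s) = 0.
  move=> hs; apply/count_memPn/negP => /mapP[v /(allP hs) h [e0]].
  by rewrite -e0 in h.
have cS k s : count_mem k.+1 (map S s) = count_mem k s.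
  by rewrite count_map; apply: eq_count.
have srt s : sorted leq s -> sorted leq (map S s) by rewrite sorted_map.
have srt' s : sorted ltn s -> sorted ltn (map S s) by rewrite sorted_map.
have rS s : all (fun v => 0 < v < n) s -> all (fun v => 0 < v <= n) (map S s).
  by rewrite all_map; apply: sub_all => v /=; case/andP.
have so0 : sorted leq r0 by apply: (subseq_sorted leq_trans _ so);
    rewrite er prefix_subseq.
have sl0 : sorted ltn l0 by apply: (subseq_sorted ltn_trans _ sol);
    rewrite el prefix_subseq.
have ge1 s : all (leq 1) (map S s) by rewrite all_map; apply/allP.
move: eqp; case: (posnP e) => [e0|e0].
  rewrite e0 in el sl * => eqp.
  have V : hook_valid n N m (nseq d 1 ++ map S r0) (map S l0).
    apply/and5P; split.
    - by rewrite -sr !size_cat !size_nseq size_map addnC.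
    - by rewrite -sl size_cat size_map addn0.
    - apply: (@sorted_leq_cat _ _ 1) => //; rewrite ?srt ?sorted_leq_nseq //.
      by rewrite all_nseq orbT.
    - rewrite (path_sortedE ltn_trans) srt' // andbT all_map.
      case: (d) er => [|d'] er /=.
        move: hd; rewrite el er !cats0; case: (r0) er sr => [|c r] er sr //=.
        by move=> _; apply/allP.
      by apply: sub_all hl => v /= /andP[].
    - by rewrite !all_cat !rS // all_nseq n_gt0 orbT.
  have [eR eL] : row_of (prom T) = nseq d 1 ++ map S r0 /\ leg_of (prom T) = map S l0.
    apply: model_of_entries => // p; by rewrite entry_hookf // er el eqp.
  split.
  - rewrite !content_model // eR eL er el !count_cat !count_nseq /= eqxx !p0 //.
    by rewrite !count_mem0 // !addn0.
  - move=> k /andP[k0 kn]; rewrite !content_model // eR eL er el !count_cat !cS.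
    rewrite !count_nseq /= (gtn_eqF kn).
    by case: k k0 {kn} => // k _ /=; rewrite ?mul0n !addn0.
  - move=> v; rewrite eL el cats0 (negbTE nl0) orbF (mem_map succn_inj).
    by case: eqP => [->|_]; rewrite ?andbT // (negbTE nl0).
have e1 : e = 1 by clear -he e0; lia.
rewrite e1 in el sl her *; have := her isT.
case: r0 er hr nr0 sr so0 {her} => [|c r0] // er hr nr0 sr so0 _ eqp.
move: (hr) => /= /andP[hc hr0].
rewrite er /= in hd.
have V : hook_valid n N m (nseq d.+1 1 ++ map S r0) (map S (c :: l0)).
  apply/and5P; split.
  - by rewrite -sr !size_cat !size_nseq size_map /=; clear; lia.
  - by rewrite -sl size_cat size_map /= addn1.
  - apply: (@sorted_leq_cat _ _ 1) => //;
      rewrite ?srt ?sorted_leq_nseq ?(path_sorted so0) //.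
    by rewrite all_nseq orbT.
  - rewrite (path_sortedE ltn_trans) srt' /=; last first.
      rewrite (path_sortedE ltn_trans) sl0 andbT.
      by move: hd; rewrite el all_cat => /andP[].
    by rewrite andbT ltnS; case/andP: hc => -> _; rewrite all_map; apply:
        sub_all hl => v /andP[].
  - by rewrite !all_cat !rS //= ?hc // n_gt0 all_nseq n_gt0 orbT.
have [eR eL] : row_of (prom T) = nseq d.+1 1 ++ map S r0 /\ leg_of (prom T) = map S
    (c :: l0).
  apply: model_of_entries => // p; by rewrite entry_hookf // er el eqp.
have hcl0 : all (fun v => 0 < v < n) (c :: l0) by rewrite /= hc.
split.
- rewrite !content_model // eR eL er el !count_cat !p0 // !count_nseq /= eqxx.
  move: nr0; rewrite inE negb_or eq_sym => /andP[nc nr0].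
  by rewrite !count_mem0 // (negbTE nc) /=; clear; lia.
- move=> k /andP[k0 kn]; rewrite !content_model // eR eL er el !count_cat !cS.
  rewrite !count_nseq /= (gtn_eqF kn).
  by case: k k0 {kn} => // k _ /=; clear; lia.
- move=> v; rewrite eL el er (mem_map succn_inj) !mem_cat !inE /= eqxx orbT /=.
  case: (eqVneq v n) => [->|_]; last by rewrite orbF orbC !andbT.
  by rewrite (negbTE nl0) orbF.
Qed.

(** When [n] occurs and is not the only letter, its bit is the last one. After promotion the least
    letter is 1, and the old corner, raised by one, is the first letter to carry a bit: it lies in
    the leg exactly when [n] did, so the last bit moves to the front. When [n] does not occur, all
    letters are merely raised. *)
Lemma prom_code T : cont (prom T) = rotr 1 (cont T) /\
  bits (prom T) = if 0 < content T n then rotr 1 (bits T) else bits T.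
Proof.
have [c1 cS lg] := prom_model T.
pose a := mkseq (fun k => content T k.+1) n.-1.
have ea : cont T = rcons a (content T n).
  have E (g : nat -> nat) : mkseq g n = rcons (mkseq g n.-1) (g n.-1).
    by rewrite -mkseqS prednK.
  by rewrite /cont E prednK.
have ec : cont (prom T) = rotr 1 (cont T).
  rewrite ea rotr1_rcons; apply: (@eq_from_nth _ 0).
    by rewrite size_cont /= size_mkseq prednK.
  rewrite size_cont => -[|k] hk; rewrite nth_mkseq //=.
  by rewrite nth_mkseq ?cS //; lia.
split=> //.
have [s [es sub]] := supp_cont ltmN T.
have sa : size a = n.-1 by rewrite size_mkseq.
rewrite /bits ec ea rotr1_rcons supp_cons supp_rcons sa prednK //.
move: es; rewrite ea supp_rcons sa prednK //.
have nsup : n \notin supp a.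
  by rewrite mem_supp n_gt0 /= nth_default // sa.
have lea v : v \in leg_of T -> v \in supp a ++ nseq (0 < content T n) n.
  have := mem_supp_cont ltmN T v; rewrite ea supp_rcons sa prednK // => ->.
  by rewrite mem_cat orbC => ->.
case: (posnP (content T n)) => h; rewrite ?h /=.
  rewrite cats0 => es; rewrite behead_map -map_comp; apply/eq_in_map => v /=.
  move=> /mem_behead hv; rewrite lg.
  have -> : n \in leg_of T = false.
    apply/negP => /lea; rewrite h cats0; exact/negP.
  rewrite orbF; case: eqP => [e|_]; rewrite ?andbT //.
  by move: hv; rewrite e (negbTE nsup).
case ea' : (supp a) => [|u s'] //= [eu es'].
rewrite cats1 map_rcons rotr1_rcons /= lg.
have lt : path ltn u s' by have := sorted_supp a; rewrite ea'.
have un : u != n by move: nsup; rewrite ea' inE eq_sym; case: eqP.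
congr (_ :: _).
  rewrite -eu eqxx andbT.
  case: (boolP (u \in leg_of T)) => //= hu.
  move: nsup; rewrite ea' => nsup.
  have := sub _ hu; rewrite -es' cats1 mem_rcons inE (negbTE un) /= => us.
  by move/allP: (order_path_min ltn_trans lt) => /(_ _ us); rewrite ltnn.
rewrite -map_comp; apply/eq_in_map => v hv /=; rewrite lg.
have vn : v != n by apply: contraNneq nsup => <-; rewrite ea' inE hv orbT.
have vu : v != u.
  by apply: contraTneq hv => ->; apply/negP => us;
    move/allP: (order_path_min ltn_trans lt) => /(_ _ us); rewrite ltnn.
by rewrite -eu (negbTE vu) vn andbT andbF orbF.
Qed.

End CodeActions.

(** * Rotations of sequences *)

Section Rotation.
Variables (T : eqType).
Implicit Types (s : seq T).

Lemma iter_rotrK l s : iter l (rot 1) (iter l (rotr 1) s) = s.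
Proof. by elim: l s => //= l IH s; rewrite -iterS iterSr rotrK IH. Qed.

Lemma iter_rotKr l s : iter l (rotr 1) (iter l (rot 1) s) = s.
Proof. by elim: l s => //= l IH s; rewrite -iterS iterSr rotK IH. Qed.

Lemma iter_rotr_fix l s : (iter l (rotr 1) s == s) = (iter l (rot 1) s == s).
Proof.
apply/eqP/eqP => h; first by rewrite -{1}h iter_rotrK.
by rewrite -{1}h iter_rotKr.
Qed.

Lemma size_iter_rot l s : size (iter l (rot 1) s) = size s.
Proof. by elim: l => //= l <-; rewrite size_rot. Qed.

Lemma size_iter_rotr l s : size (iter l (rotr 1) s) = size s.
Proof. by elim: l => //= l <-; rewrite size_rotr. Qed.

Lemma nth_iter_rot x0 l s i : i < size s ->
  nth x0 (iter l (rot 1) s) i = nth x0 s ((i + l) %% size s).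
Proof.
elim: l i => [|l IHl] i hi; first by rewrite addn0 modn_small.
rewrite iterS.
have [e|ne] := eqVneq i.+1 (size s).
  have s0 : 0 < size s by lia.
  rewrite /rot nth_cat size_drop size_iter_rot -e subn1 /= ltnn subnn.
  rewrite nth_take // IHl // -addSnnS e add0n modnDl //.
have lt : i.+1 < size s by lia.
rewrite /rot nth_cat size_drop size_iter_rot subn1.
have -> : i < (size s).-1 by lia.
by rewrite nth_drop add1n IHl // addSnnS.
Qed.

Lemma nth_iter_rotr x0 l s i : i < size s -> l <= i ->
  nth x0 (iter l (rotr 1) s) i = nth x0 s (i - l).
Proof.
move=> hi hl; rewrite -[in RHS](iter_rotrK l s) nth_iter_rot size_iter_rotr; last by lia.
by rewrite subnK // modn_small.
Qed.

Lemma iter_rot_size s : iter (size s) (rot 1) s = s.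
Proof.
case: s => // x0 s'; set s := x0 :: s'.
apply: (@eq_from_nth _ x0); rewrite size_iter_rot // => i hi.
by rewrite nth_iter_rot // modnDr modn_small.
Qed.

Lemma iter_rotr_size s : iter (size s) (rotr 1) s = s.
Proof. by rewrite -{2}(iter_rot_size s) iter_rotKr. Qed.

(** A sequence invariant under rotation by [l] and by its length is invariant, by Bezout, under
    rotation by their gcd; hence it repeats its prefix of that length. *)
Lemma iter_rot_fixP l s : 0 < size s ->
  let g := gcdn l (size s) in
  reflect (s = flatten (nseq (size s %/ g) (take g s))) (iter l (rot 1) s == s).
Proof.
move=> s0 g.
have g0 : 0 < g by rewrite gcdn_gt0 s0 orbT.
have gs : g %| size s by exact: dvdn_gcdr.
have gl : g %| l by exact: dvdn_gcdl.
have gle : g <= size s by exact: dvdn_leq.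
case: s s0 @g g0 gs gl gle => // x0 s' _; set s := x0 :: s' => g g0 gs gl gle.
have st : size (take g s) = g by rewrite size_takel.
have nthf (t : seq T) e i : size t = g -> i < e * g ->
    nth x0 (flatten (nseq e t)) i = nth x0 t (i %% g).
  move=> szt; elim: e i => [|e IHe] i //= hi; rewrite nth_cat szt.
  case: ltnP => h; first by rewrite modn_small.
  by rewrite IHe; [rewrite -{2}(subnK h) modnDr | move: hi; rewrite mulSn; lia].
apply: (iffP eqP) => h.
  pose f i := nth x0 s (i %% size s).
  have fl i : f (i + l) = f i.
    transitivity (nth x0 (iter l (rot 1) s) (i %% size s)); last by rewrite h.
    by rewrite nth_iter_rot ?ltn_mod // modnDml.
  have fs i : f (i + size s) = f i by rewrite /f modnDr.
  have fkl k i : f (i + k * l) = f i.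
    by elim: k i => [|k IHk] i; rewrite ?addn0 // mulSn addnA IHk fl.
  have fks k i : f (i + k * size s) = f i.
    by elim: k i => [|k IHk] i; rewrite ?addn0 // mulSn addnA IHk fs.
  have fg i : f (i + g) = f i.
    case: (posnP l) => [l0|l0].
      by rewrite /g l0 gcd0n fs.
    case: (egcdnP (size s) l0) => u v e _.
    by rewrite -(fks v) -addnA addnC [g + _]addnC -e addnC fkl.
  have fkg k i : f (i + k * g) = f i.
    by elim: k i => [|k IHk] i; rewrite ?addn0 // mulSn addnA IHk fg.
  apply: (@eq_from_nth _ x0).
    rewrite size_flatten /shape map_nseq st sumn_nseq mulnC divnK //.
  move=> i hi; rewrite nthf //; last by rewrite divnK.
  rewrite nth_take ?ltn_mod //.
  have := fkg (i %/ g) (i %% g); rewrite addnC -divn_eq /f modn_small // => ->.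
  by rewrite modn_small // (leq_trans _ gle) // ltn_mod.
have hp i : i < size s -> nth x0 s i = nth x0 (take g s) (i %% g).
  by move=> hi; rewrite {1}h nthf // divnK.
apply: (@eq_from_nth _ x0); rewrite size_iter_rot // => i hi.
rewrite nth_iter_rot // !hp ?ltn_mod //.
rewrite modn_dvdm // -modnDmr (eqP gl) addn0 //.
Qed.

End Rotation.

(** * Powers of the Coxeter element and of promotion *)

Lemma perm_of_funE (X : finType) (f : X -> X) :
  injective f -> perm_of_fun f =1 f.
Proof.
move=> inj x; rewrite /perm_of_fun -pvalE val_insubd.
have -> : injectiveb [ffun x => f x] by apply/injectiveP => u v; rewrite !ffunE => /inj.
by rewrite ffunE.
Qed.

Section Perms.
Variables (n N m : nat).
Hypotheses (ltmN : m < N) (n_gt0 : 0 < n).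
Local Notation la := (hook N m).
Implicit Types (T : SST n la).
Local Open Scope group_scope.

Lemma coxeterE : coxeter n la =1 @cox n N m.
Proof.
apply: perm_of_funE => T T' e; apply: (code_inj ltmN).
  have [h _] := cox_code ltmN n_gt0 T; have [h' _] := cox_code ltmN n_gt0 T'.
  by apply: (@rotr_inj 1); rewrite -h -h' /cox e.
have [_ h] := cox_code ltmN n_gt0 T; have [_ h'] := cox_code ltmN n_gt0 T'.
by rewrite -h -h' /cox e.
Qed.

Lemma promotionE : promotion n la =1 @prom n N m.
Proof.
apply: perm_of_funE => T T' e.
have [h1 h2] := prom_code ltmN n_gt0 T; have [h1' h2'] := prom_code ltmN n_gt0 T'.
have ec : cont T = cont T' by apply: (@rotr_inj 1); rewrite -h1 -h1' /prom e.
apply: (code_inj ltmN) => //.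
have en : content T n = content T' n.
  have := congr1 (fun s => nth 0 s n.-1) ec.
  by rewrite !nth_cont ?leqnn ?n_gt0.
have : bits (prom T) = bits (prom T') by rewrite /prom e.
rewrite h2 h2' en; case: ifP => // _; exact: rotr_inj.
Qed.

Lemma coxeterX_code j T :
  cont ((coxeter n la ^+ j) T) = iter j (rotr 1) (cont T) /\
  bits ((coxeter n la ^+ j) T) = bits T.
Proof.
elim: j => [|j [IHc IHb]]; first by rewrite perm1.
rewrite expgSr permM coxeterE.
have [-> ->] := cox_code ltmN n_gt0 ((coxeter n la ^+ j) T).
by rewrite IHc IHb.
Qed.

(** The j-th step sees as multiplicity of [n] the original entry n - j of the content (numbered from
    0), so the bits turn once for each nonzero entry among the last [j]. *)
Lemma promotionX_code j T : j <= n ->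
  let T' := (promotion n la ^+ j) T in
  cont T' = iter j (rotr 1) (cont T) /\
  bits T' = iter (count (ltn 0) (drop (n - j) (cont T))) (rotr 1) (bits T).
Proof.
elim: j => [|j IHj] hj.
  by rewrite perm1 subn0 drop_oversize ?size_cont.
have /= [IHc IHb] := IHj (ltnW hj).
rewrite expgSr permM promotionE /=.
have [-> ->] := prom_code ltmN n_gt0 ((promotion n la ^+ j) T).
rewrite IHc IHb; split=> //.
set a := cont T in IHc IHb *.
have sa : size a = n by exact: size_cont.
have -> : drop (n - j.+1) a = nth 0 a (n - j.+1) :: drop (n - j) a.
  rewrite (drop_nth 0) ?sa; last by lia.
  by congr (_ :: drop _ _); lia.
have -> : content ((promotion n la ^+ j) T) n = nth 0 a (n - j.+1).
  rewrite -nth_cont ?leqnn ?n_gt0 // IHc nth_iter_rotr ?sa; try lia.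
  congr nth; lia.
by rewrite /=; case: (0 < _).
Qed.

Definition prn := promotion n la ^+ n.

Lemma prn_code T : cont (prn T) = cont T /\ bits (prn T) = rotr 1 (bits T).
Proof.
have /= [-> ->] := promotionX_code T (leqnn n).
rewrite subnn drop0 -{1}(size_cont T) iter_rotr_size; split=> //.
have [s [es _]] := supp_cont ltmN T.
have := size_supp (cont T); rewrite es /= => e.
rewrite -e iterS; congr (rotr 1 _).
by rewrite -[size s]/((size s).+1.-1) e -size_bits iter_rotr_size.
Qed.

Lemma prnX_code l T :
  cont ((prn ^+ l) T) = cont T /\ bits ((prn ^+ l) T) = iter l (rotr 1) (bits T).
Proof.
elim: l => [|l [IHc IHb]]; first by rewrite perm1.
rewrite expgSr permM; have [-> ->] := prn_code ((prn ^+ l) T).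
by rewrite IHc IHb.
Qed.

Lemma prnX_fix l T : ((prn ^+ l) T == T) = (iter l (rot 1) (bits T) == bits T).
Proof.
have [hc hb] := prnX_code l T; rewrite -iter_rotr_fix -hb.
by apply/eqP/eqP => [-> //|]; apply: (code_inj ltmN).
Qed.

Lemma coxeter_prn_comm j l T :
  (coxeter n la ^+ j) ((prn ^+ l) T) = (prn ^+ l) ((coxeter n la ^+ j) T).
Proof.
have [c1 b1] := prnX_code l T; have [c2 b2] := coxeterX_code j ((prn ^+ l) T).
have [c3 b3] := coxeterX_code j T.
have [c4 b4] := prnX_code l ((coxeter n la ^+ j) T).
by apply: (code_inj ltmN); rewrite ?c2 ?c4 ?c1 ?c3 ?b2 ?b4 ?b1 ?b3.
Qed.

Lemma SST_nonempty : m < n -> exists T : SST n la, True.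
Proof.
move=> ltmn.
pose a := (N - m :: nseq m 1 ++ nseq (n - m.+1) 0)%N.
have : exists T : SST n la, cont T = a /\ bits T = nseq m true.
  have ca : count (ltn 0) a = m.+1.
    rewrite /a /= count_cat !count_nseq /= mul1n mul0n addn0 subn_gt0 ltmN.
    by rewrite add1n.
  apply: code_surj => //.
  - by rewrite /= size_cat !size_nseq; lia.
  - by rewrite /= sumn_cat !sumn_nseq mul1n mul0n addn0 subnK // ltnW.
  - by rewrite size_nseq ca.
  - by rewrite count_nseq mul1n.
by case=> T _; exists T.
Qed.

(** The content would repeat a block; the number of repetitions divides both the length [n] and the
    sum [N], hence is 1. *)
Lemma rot_free (a : seq nat) j : size a = n -> sumn a = N -> coprime n N ->
  iter j (rot 1) a = a -> n %| j.
Proof.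
move=> sa suma cop /eqP; have s0 : 0 < size a by rewrite sa.
move/(iter_rot_fixP _ s0) => e.
set g := gcdn j (size a) in e.
have gs : g %| size a by exact: dvdn_gcdr.
have dN : (size a %/ g) %| N.
  have := congr1 sumn e; rewrite suma sumn_flatten map_nseq sumn_nseq => ->.
  exact: dvdn_mull.
have dn : (size a %/ g) %| n by rewrite -sa -{2}(divnK gs) dvdn_mulr.
have : (size a %/ g) %| gcdn n N by rewrite dvdn_gcd dn dN.
rewrite (eqP cop) dvdn1 => /eqP e1.
have : size a = g by rewrite -(divnK gs) e1 mul1n.
by rewrite -sa => ->; exact: dvdn_gcdl.
Qed.

Lemma coxeterX_fix j T : coprime n N -> (coxeter n la ^+ j) T = T -> n %| j.
Proof.
move=> cop e; have [hc _] := coxeterX_code j T.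
apply: (@rot_free (cont T)) => //; first exact: size_cont.
  exact: sumn_cont.
by apply/eqP; rewrite -iter_rotr_fix -hc e.
Qed.

(** Freeness excludes proper divisors of [n] once some tableau exists, which [m < n] provides. *)
Lemma order_coxeter : m < n -> coprime n N -> #[coxeter n la] = n.
Proof.
move=> ltmn cop; apply/eqP; rewrite eqn_dvd; apply/andP; split.
  rewrite order_dvdn; apply/eqP/permP => T; rewrite perm1.
  have [hc hb] := coxeterX_code n T; apply: (code_inj ltmN) => //.
  by rewrite hc -{1}(size_cont T) iter_rotr_size.
have [T _] := SST_nonempty ltmn.
by apply: (@coxeterX_fix _ T) => //; rewrite expg_order perm1.
Qed.

Definition rotfix r l : {set r.-tuple bool} :=
  [set b : r.-tuple bool | (count id b == m) && (iter l (rot 1) (tval b) == b)].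

Lemma card_prnX_fix l (a : seq nat) : size a = n -> sumn a = N ->
  #|[set T : SST n la | (cont T == a) && ((prn ^+ l) T == T)]| =
  #|rotfix (count (ltn 0) a).-1 l|.
Proof.
move=> sa suma; set r := _.-1.
pose f (T : SST n la) : r.-tuple bool := insubd [tuple of nseq r false] (bits T).
have fE T : cont T = a -> tval (f T) = bits T.
  move=> e; rewrite /f val_insubd ifT //.
  by rewrite size_bits // e.
rewrite -(card_in_imset (f := f)).
  apply: eq_card => b; rewrite !inE; apply/imsetP/andP => [[T]|[cb fb]].
    rewrite inE => /andP[/eqP ea]; rewrite prnX_fix => fx ->.
    by rewrite fE // count_bits // eqxx.
  have [|T [ea eb]] := code_surj ltmN sa suma _ (eqP cb); first exact: size_tuple.
  exists T; last by apply: val_inj; rewrite /= fE.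
  by rewrite inE ea eqxx prnX_fix eb.
move=> T T'; rewrite !inE => /andP[/eqP e _] /andP[/eqP e' _] /(congr1 val) /=.
by rewrite !fE // => eb; apply: (code_inj ltmN) => //; rewrite e e'.
Qed.

End Perms.

Local Open Scope ring_scope.

(** * Gaussian binomials and cyclic sieving of subsets *)

(** Gaussian binomials by the q-Pascal rule: without division they make sense over every commutative
    ring and at roots of unity. *)
Fixpoint gaussq (R : comNzRingType) (q : R) (r m : nat) : R :=
  match m, r with
  | 0, _ => 1
  | m'.+1, 0 => 0
  | m'.+1, r'.+1 => gaussq q r' m' + q ^+ m * gaussq q r' m
  end.

Lemma gaussq0 (R : comNzRingType) (q : R) r : gaussq q r 0 = 1.
Proof. by case: r. Qed.

Lemma gaussq_gt (R : comNzRingType) (q : R) r m : (r < m)%N -> gaussq q r m = 0.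
Proof.
elim: r m => [|r IHr] [|m] //= lt; rewrite !IHr ?mulr0 ?addr0 //; exact: ltnW.
Qed.

Lemma gaussq_diag (R : comNzRingType) (q : R) r : gaussq q r r = 1.
Proof. by elim: r => //= r ->; rewrite gaussq_gt // mulr0 addr0. Qed.

Lemma rmorph_gaussq (R S : comNzRingType) (f : {rmorphism R -> S}) (q : R) r m :
  f (gaussq q r m) = gaussq (f q) r m.
Proof.
elim: r m => [|r IHr] [|m] /=; rewrite ?rmorph1 ?rmorph0 //.
by rewrite rmorphD rmorphM rmorphXn !IHr.
Qed.

Lemma gaussq_Xn_ge0 e r m i : (0 <= (gaussq ('X^e : {poly int}) r m)`_i)%R.
Proof.
elim: r m i => [|r IHr] [|m] i /=; rewrite ?coef1 ?coef0 ?ler0n //.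
rewrite coefD -exprM mulrC coefMXn; case: ifP => _; rewrite Num.Theory.addr_ge0 //.
Qed.

(** The q-binomial theorem, with a free [c] because splitting off the first factor turns [c] into
    [c * q]. *)
Lemma qbinom_prod (R : comNzRingType) (c q : R) r m :
  (\prod_(i < r) (1 + (c * q ^+ i) *: 'X))`_m =
  c ^+ m * q ^+ 'C(m, 2) * gaussq q r m.
Proof.
elim: r c m => [|r IHr] c m.
  by rewrite big_ord0 coef1; case: m => [|m] /=; rewrite ?mulr1 ?mulr0.
rewrite big_ord_recl expr0 mulr1.
have -> : \prod_(i < r) (1 + (c * q ^+ (lift ord0 i)) *: 'X) =
          \prod_(i < r) (1 + (c * q * q ^+ i) *: 'X) :> {poly R}.
  by apply: eq_bigr => i _; rewrite lift0 exprS mulrA.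
rewrite mulrDl mul1r coefD -scalerAl coefZ coefXM !IHr.
case: m => [|m] /=; first by rewrite mulr0 addr0 !gaussq0.
rewrite binS bin1 !exprD !exprMn !exprS; ring.
Qed.

(** The q-binomial theorem for roots in geometric progression. This form serves to extract
    coefficients from the Hall-Littlewood expansion and, for c = 1, to find the zeros of Gaussian
    binomials at roots of unity. *)
Lemma qbinom_prod_sub (R : comNzRingType) (c t : R) r m :
  (\prod_(i < r) ((c * t ^+ i)%:P - 'X))`_m =
  (-1) ^+ m * c ^+ (r - m) * t ^+ 'C(r - m, 2) * gaussq t r m.
Proof.
elim: r m => [|r IHr] m.
  by rewrite big_ord0 coef1; case: m => [|m] /=; rewrite ?mulr1 ?mulr0.
rewrite big_ord_recr /= mulrC mulrBl coefB coefCM coefXM.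
case: m => [|m] /=.
  rewrite IHr subr0 !gaussq0 !subn0 binS bin1 !exprD !exprS; ring.
rewrite subSS !IHr; case: (ltnP m r) => lt; last first.
  rewrite (@gaussq_gt _ _ r m.+1) // !exprS; ring.
rewrite subnS; have -> : (r - m = (r - m).-1.+1)%N by lia.
rewrite binS bin1 !exprD.
have -> : t ^+ r = t ^+ (r - m).-1 * t ^+ m * t.
  by rewrite -exprD -exprSr; congr (_ ^+ _); lia.
rewrite [(r - m).-1.+1.-1]/= !exprS; ring.
Qed.

Lemma bin2D a b : 'C(a + b, 2) = ('C(a, 2) + 'C(b, 2) + a * b)%N.
Proof.
by elim: b => [|b IHb]; rewrite ?addn0 ?muln0 ?addn0 // addnS !binS !bin1 IHb; lia.
Qed.

Lemma bin2M e s : 'C(s * e, 2) = ('C(e, 2) * s + e * (e * 'C(s, 2)))%N.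
Proof.
elim: s => [|s IHs]; first by rewrite mul0n !muln0.
by rewrite mulSn bin2D IHs binS bin1; lia.
Qed.

Section RootOfUnity.
Variables (F : fieldType) (e : nat) (z : F).
Hypothesis prim_z : e.-primitive_root z.

Let e_gt0 : (0 < e)%N. Proof. exact: prim_order_gt0 prim_z. Qed.
Let z_neq0 : z != 0.
Proof.
apply/eqP => z0; have /eqP := prim_expr_order prim_z.
by rewrite z0 expr0n gtn_eqF // eq_sym oner_eq0.
Qed.

(** At a primitive root the product of all z^i - X is X^e - 1 up to sign, which has no intermediate
    coefficients. *)
Lemma gaussq_prim_small m : (0 < m < e)%N -> gaussq z e m = 0.
Proof.
move=> /andP[m0 me].
have := qbinom_prod_sub 1 z e m.
have -> : \prod_(i < e) ((1 * z ^+ i)%:P - 'X) =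
          (-1) ^+ e * ('X^e - 1) :> {poly F}.
  rewrite -(factor_Xn_sub_1 prim_z) big_mkord.
  have -> : (-1) ^+ e = \prod_(i < e) (-1) :> {poly F} by rewrite prodr_const card_ord.
  rewrite -big_split /=; apply: eq_bigr => i _; rewrite mul1r; ring.
rewrite -signr_odd mulr_sign (fun_if (fun p : {poly F} => p`_m)) coefN.
rewrite coefB coefXn coef1 (ltn_eqF me) (gtn_eqF m0) subrr oppr0 if_same.
move/esym/eqP; rewrite expr1n mulr1 !mulf_eq0 !expf_eq0 oppr_eq0 oner_eq0.
by rewrite (negbTE z_neq0) !andbF /= => /eqP.
Qed.

Lemma prod_prim_root :
  \prod_(i < e) (1 + (1 * z ^+ i) *: 'X) = 1 + (z ^+ 'C(e, 2)) *: 'X^e :> {poly F}.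
Proof.
apply/polyP => m; rewrite qbinom_prod expr1n mul1r coefD coef1 coefZ coefXn.
case: m => [|m] /=; first by rewrite gaussq0 (ltn_eqF e_gt0) mulr0 addr0 mulr1.
rewrite add0r; case: (ltngtP m.+1 e) => h; last by rewrite -h gaussq_diag.
  by rewrite gaussq_prim_small ?h // !mulr0.
by rewrite gaussq_gt // !mulr0.
Qed.

(** Comparison of coefficients in the product of e g factors, which is the g-th power of 1 +
    z^C(e,2) X^e by periodicity of the powers of [z]. *)
Lemma gaussq_prim g m :
  gaussq z (e * g) m = if (e %| m)%N then 'C(g, m %/ e)%:R else 0.
Proof.
have zX k : z ^+ k != 0 by rewrite expf_neq0.
have P : \prod_(i < e * g) (1 + (1 * z ^+ i) *: 'X) =
   (1 + (z ^+ 'C(e, 2)) *: 'X^e) ^+ g :> {poly F}.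
  elim: g => [|g IHg]; first by rewrite muln0 big_ord0.
  rewrite mulnS addnC big_split_ord /= IHg exprSr -prod_prim_root; congr (_ * _).
  apply: eq_bigr => i _; rewrite !mul1r exprD exprM (prim_expr_order prim_z).
  by rewrite expr1n mul1r.
apply: (mulfI (zX 'C(m, 2))).
have := qbinom_prod 1 z (e * g) m; rewrite P expr1n mul1r => <-.
rewrite addrC exprDn coef_sum.
have E (i : 'I_g.+1) : (((z ^+ 'C(e, 2) *: 'X^e) ^+ (g - i) * 1 ^+ i *+ 'C(g, i)) :
    {poly F})`_m
    = z ^+ ('C(e, 2) * (g - i)) * (m == e * (g - i))%N%:R *+ 'C(g, i).
  by rewrite expr1n mulr1 exprZn -exprM -exprM coefMn coefZ coefXn.
rewrite (eq_bigr _ (fun i _ => E i)); case: ifP => [/dvdnP[s ->]|nd]; last first.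
  rewrite mulr0 big1 // => i _.
  case: eqP => [h|_]; last by rewrite mulr0 mul0rn.
  by move: nd; rewrite h dvdn_mulr.
rewrite mulnK //; case: (leqP s g) => hs; last first.
  rewrite (bin_small hs) mulr0n mulr0 big1 // => i _.
  rewrite [(s * e)%N]mulnC eqn_pmul2l // gtn_eqF ?mulr0 ?mul0rn //.
  by apply: leq_ltn_trans hs; exact: leq_subr.
have lt : (g - s < g.+1)%N by rewrite ltnS leq_subr.
rewrite (bigD1 (Ordinal lt)) //= big1 ?addr0.
  rewrite subKn // [(e * s)%N]mulnC eqxx mulr1 bin_sub // -mulr_natr; congr (_ * _).
  (* C(s e, 2) is congruent to s C(e, 2) modulo e. *)
  by rewrite bin2M exprD [z ^+ (e * _)]exprM (prim_expr_order prim_z) expr1n mulr1.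
move=> i ne; rewrite [(s * e)%N]mulnC eqn_pmul2l //; case: eqP => [h|_];
    last by rewrite mulr0 mul0rn.
case/eqP: ne; apply: val_inj => /=; rewrite h subKn //; by rewrite -ltnS.
Qed.
End RootOfUnity.

Local Open Scope nat_scope.

Lemma card_count_tuple g s :
  #|[set t : g.-tuple bool | count id t == s]| = 'C(g, s).
Proof.
pose f (t : g.-tuple bool) := [set i | tnth t i].
have fi : injective f.
  by move=> t t' /setP e; apply: eq_from_tnth => i; have := e i; rewrite !inE.
have fc t : #|f t| = count id t.
  by rewrite cardsE -sum1_card -sum1_count big_tuple.
rewrite -[in RHS](card_ord g) -card_draws -(card_imset _ fi).
apply: eq_card => A; rewrite !inE; apply/imsetP/idP => [[t]|h].
  by rewrite inE => ht ->; rewrite fc.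
have fA : f [tuple i \in A | i < g] = A.
  by apply/setP => i; rewrite inE tnth_mktuple.
exists [tuple i \in A | i < g]; last by rewrite fA.
by rewrite inE -fc fA.
Qed.

(** With e = r / g, a fixed vector is an e-fold repetition of an arbitrary block of length g, so e
    divides its number of ones. *)
Lemma card_rotfix m r l : 0 < r ->
  let g := gcdn l r in
  #|rotfix m r l| = if (r %/ g) %| m then 'C(g, m %/ (r %/ g)) else 0.
Proof.
move=> r0 g; set e := r %/ g.
have gr : g %| r by exact: dvdn_gcdr.
have g0 : 0 < g by rewrite gcdn_gt0 r0 orbT.
have e0 : 0 < e by rewrite divn_gt0 // dvdn_leq.
have eg : e * g = r by exact: divnK.
have cnt k (s : bitseq) : count id (flatten (nseq k s)) = k * count id s.
  by elim: k => //= k IHk; rewrite count_cat IHk mulSn.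
have fixP (b : r.-tuple bool) : (iter l (rot 1) (tval b) == b) =
   (tval b == flatten (nseq e (take g b))).
  have sb : 0 < size b by rewrite size_tuple.
  apply/(sameP (iter_rot_fixP l sb)).
  by rewrite size_tuple; apply: eqP.
pose f (t : g.-tuple bool) :
    r.-tuple bool := insubd [tuple of nseq r false] (flatten (nseq e (tval t))).
have fE t : tval (f t) = flatten (nseq e (tval t)).
  rewrite /f val_insubd ifT // size_flatten /shape map_nseq sumn_nseq size_tuple.
  by rewrite mulnC eg.
have tk (t : g.-tuple bool) : take g (flatten (nseq e (tval t))) = t.
  by case: (e) e0 => // k _ /=; rewrite take_cat size_tuple ltnn subnn take0 cats0.
have fi : injective f.
  by move=> t t' /(congr1 (fun b => take g (tval b))); rewrite !fE !tk => /val_inj.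
have -> : #|rotfix m r l| = #|[set t : g.-tuple bool | e * count id t == m]|.
  rewrite -(card_imset _ fi); apply: eq_card => b; rewrite !inE fixP.
  apply/andP/imsetP => [[cb /eqP eb]|[t]].
    have st : size (take g b) == g by rewrite size_takel // size_tuple dvdn_leq.
    exists (Tuple st); last by apply: val_inj; rewrite /= fE.
    by rewrite inE /= -cnt -eb.
  by rewrite inE => ht ->; rewrite fE cnt ht tk.
case: ifP => [/dvdnP[s ->]|nd].
  rewrite mulnK // -card_count_tuple; apply: eq_card => t; rewrite !inE.
  by rewrite mulnC eqn_pmul2r.
apply/eqP; rewrite cards_eq0 -subset0; apply/subsetP => t; rewrite !inE => /eqP h.
by move: nd; rewrite -h dvdn_mulr.
Qed.

(** The hypothesis on [z] says that its order is r / gcd(l, r), the order of the rotation by [l]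
    places. *)
Lemma csp_rotfix (F : fieldType) (z : F) m r l : 0 < r ->
  (forall j, (z ^+ j == 1)%R = (r %| l * j)) ->
  (#|rotfix m r l|%:R = gaussq z r m)%R.
Proof.
move=> r0 hz; set g := gcdn l r; set e := r %/ g.
have gr : g %| r by exact: dvdn_gcdr.
have gl : g %| l by exact: dvdn_gcdl.
have g0 : 0 < g by rewrite gcdn_gt0 r0 orbT.
have e0 : 0 < e by rewrite divn_gt0 // dvdn_leq.
have eg : e * g = r by exact: divnK.
have cop : coprime e (l %/ g).
  rewrite /coprime -(eqn_pmul2r g0) mul1n muln_gcdl !divnK //.
  by rewrite gcdnC.
have hz' j : (z ^+ j == 1)%R = (e %| j).
  rewrite hz -eg -[in l * j](divnK gl) mulnAC dvdn_pmul2r //.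
  by rewrite Gauss_dvdr.
have ze : (z ^+ e = 1)%R by apply/eqP; rewrite hz'.
have [e' prim e'e] := prim_order_exists e0 ze.
have ee' : e = e'.
  apply/eqP; rewrite eqn_dvd e'e andbT -hz'.
  by rewrite (prim_expr_order prim).
rewrite -ee' in prim.
by rewrite card_rotfix // -/g -/e -[in RHS]eg (gaussq_prim prim); case: ifP.
Qed.

Local Open Scope ring_scope.

(** * Hall-Littlewood polynomials: expansion of hook Schur polynomials *)

Lemma lin_prod (R : comNzRingType) (I : Type) (a b : I -> R) (s : seq I) :
  let P := \prod_(i <- s) ((a i)%:P + b i *: 'X) in
  (size P <= (size s).+1)%N /\ P`_(size s) = \prod_(i <- s) b i.
Proof.
elim: s => [|i s [IH1 IH2]] /=.
  by rewrite !big_nil size_polyC oner_eq0 coef1.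
rewrite !big_cons /=; set P := \prod_(j <- s) _ in IH1 IH2 *; split.
  rewrite mulrDl -scalerAl (leq_trans (size_polyD _ _)) // geq_max mul_polyC.
  rewrite !(leq_trans (size_scale_leq _ _)) //.
    by rewrite (leq_trans (size_polyMleq _ _)) // size_polyX.
  exact: ltnW.
rewrite mulrDl -scalerAl coefD coefCM coefZ coefXM /= -IH2.
by rewrite nth_default // mulr0 add0r.
Qed.

Lemma size_lin_prod (R : comNzRingType) (I : finType) (S : {set I}) (a b : I -> R) :
  (size (\prod_(i in S) ((a i)%:P + b i *: 'X)%R)%R <= #|S|.+1)%N.
Proof. by rewrite -big_enum cardE; case: (lin_prod a b (enum S)). Qed.

Lemma coef_lin_prod (R : comNzRingType) (I : finType) (S : {set I}) (a b : I -> R) :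
  (\prod_(i in S) ((a i)%:P + b i *: 'X))`_#|S| = \prod_(i in S) b i.
Proof. by rewrite -!big_enum cardE; case: (lin_prod a b (enum S)). Qed.

(** A subset with a marked element is an element together with a subset of the rest. *)
Lemma exchange_subset (V : nmodType) (I : finType) (S : {set I})
    (f : I -> {set I} -> V) :
  \sum_(J : {set I} | J \subset S) \sum_(i in J) f i (J :\ i) =
  \sum_(i in S) \sum_(J : {set I} | J \subset S :\ i) f i J.
Proof.
rewrite (exchange_big_dep (mem S)) /=; last by move=> J i /subsetP h /h.
apply: eq_bigr => i iS.
rewrite (reindex_onto (fun J => i |: J) (fun J => J :\ i)) /=; last first.
  by move=> J /andP[_ iJ]; rewrite setD1K.
apply: eq_big => [J|J /andP[/andP[h _] /eqP ->]] //.
rewrite setU11 andbT subUset sub1set iS /= subsetD1; congr (_ && _).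
by apply/eqP/idP => [<-|h]; [rewrite setD11 | rewrite setU1K].
Qed.

Section BracketProduct.
Variables (F : fieldType) (I : finType) (x : I -> F) (t : F).
Hypotheses (x_inj : injective x) (x_neq0 : forall i, x i != 0).
Hypothesis t_nroot : forall j, (0 < j)%N -> t ^+ j != 1.

(** Factors of the Hall-Littlewood symmetrization: [br] for a pair, [brW] for choosing [i] first
    among [S], [brA] for placing the block [J] before the block [K]. *)
Definition br i j := (x i - t * x j) / (x i - x j).
Definition brW (i : I) (S : {set I}) := \prod_(j in S :\ i) br i j.
Definition brA (J K : {set I}) := \prod_(i in J) \prod_(j in K) br i j.

Let t1 : 1 - t != 0.
Proof. by rewrite subr_eq0 eq_sym -[t]expr1 t_nroot. Qed.

Lemma brA0 K : brA set0 K = 1.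
Proof. by rewrite /brA big_set0. Qed.

Lemma brD i j : i != j -> x i - x j != 0.
Proof. by move=> h; rewrite subr_eq0 (inj_eq x_inj). Qed.

(** Lagrange interpolation: both sides have degree at most |S| and agree at 0 and at the |S| points
    1 / x_i. *)
Lemma br_lagrange_poly (S : {set I}) :
  \prod_(j in S) (1 - x j *: 'X) - \prod_(j in S) (1 - (t * x j) *: 'X) =
  - ((1 - t) *: 'X * \sum_(i in S) (x i * brW i S) *: \prod_(j in S :\ i) (1 - x j *: 'X))
  :> {poly F}.
Proof.
apply/eqP; rewrite -subr_eq0 opprK; set D := _ + _.
pose rs := 0 :: [seq (x i)^-1 | i <- enum S].
have ev c y : (1 - c *: 'X : {poly F}).[y] = 1 - c * y by rewrite !hornerE.
apply/eqP; apply: (@roots_geq_poly_eq0 _ _ rs).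
- rewrite /= all_map; apply/andP; split.
    rewrite /D rootE hornerD hornerD hornerN hornerM hornerZ hornerX mulr0 mul0r addr0.
    rewrite !horner_prod !big1 ?subrr // => i _; by rewrite ev mulr0 subr0.
  apply/allP => i; rewrite mem_enum => iS /=.
  rewrite /D rootE hornerD hornerD hornerN hornerM hornerZ hornerX horner_sum
      !horner_prod.
  rewrite (bigD1 i) //= ev mulfV // subrr mul0r sub0r.
  have -> : \sum_(k in S) ((x k * brW k S) *: \prod_(j in S :\ k) (1 - x j *: 'X) :
      {poly F}).[(x i)^-1]
      = x i * brW i S * \prod_(j in S :\ i) (1 - x j * (x i)^-1).
    rewrite (bigD1 i iS) /= [X in _ + X]big1 ?addr0.
      rewrite hornerZ horner_prod; congr (_ * _); apply: eq_bigr => j _; exact: ev.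
    move=> k /andP[kS ki]; rewrite hornerZ horner_prod (bigD1 i) /=; last first.
      by rewrite !inE iS eq_sym ki.
    by rewrite ev mulfV // subrr mul0r mulr0.
  rewrite (bigD1 i iS) /= ev mulfK // addrC subr_eq0; apply/eqP.
  rewrite /brW -!mulrA mulKf //; congr (_ * _); rewrite -big_split /=.
  apply: eq_big => [j|j]; first by rewrite !inE andbC.
  rewrite !inE => /andP[ji jS]; rewrite !ev /br.
  have h := brD (i := i) (j := j); rewrite eq_sym ji in h.
  by field; rewrite x_neq0 h.
- rewrite /= map_inj_uniq ?enum_uniq ?andbT; last first.
    by move=> i j /invr_inj /x_inj.
  by apply/mapP => -[i _ /esym/eqP]; rewrite invr_eq0 (negbTE (x_neq0 i)).
- have szl (K : {set I}) c : (size (\prod_(j in K) (1 - c j *: 'X)%R :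
    {poly F})%R <= #|K|.+1)%N.
    have := size_lin_prod K (fun=> 1) (fun j => - c j).
    by under eq_bigr => j _ do rewrite scaleNr.
  rewrite /= size_map -cardE /D (leq_trans (size_polyD _ _)) // geq_max; apply/andP;
      split.
    by rewrite (leq_trans (size_polyD _ _)) // size_polyN geq_max !szl.
  rewrite -scalerAl (leq_trans (size_scale_leq _ _)) //.
  case: (set_0Vmem S) => [->|[i0 i0S]]; first by rewrite big_set0 mulr0 size_poly0.
  rewrite (leq_trans (size_polyMleq _ _)) // size_polyX /= ltnS.
  apply: (leq_trans (size_sum _ _ _)); apply/bigmax_leqP => i iS.
  rewrite (leq_trans (size_scale_leq _ _)) // (leq_trans (szl _ _)) //.
  by rewrite [X in (_ <= X)%N](cardsD1 i) iS.
Qed.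

Lemma br_lagrange (S : {set I}) y :
  \prod_(j in S) (1 - x j * y) - \prod_(j in S) (1 - t * x j * y) =
  - ((1 - t) * y * \sum_(i in S) x i * brW i S * \prod_(j in S :\ i) (1 - x j * y)).
Proof.
have := congr1 (fun p : {poly F} => p.[y]) (br_lagrange_poly S).
have ev c : (1 - c *: 'X : {poly F}).[y] = 1 - c * y by rewrite !hornerE.
rewrite hornerD !hornerN !horner_prod hornerM hornerZ hornerX horner_sum.
under eq_bigr do rewrite ev.
under [X in _ - X]eq_bigr do rewrite ev.
move=> ->; congr (- (_ * _)); apply: eq_bigr => i _.
by rewrite hornerZ horner_prod; congr (_ * _); apply: eq_bigr => j _; rewrite ev.
Qed.

(** Coefficients of X^|S| in [br_lagrange_poly]. This is the source of the factors (1 - t^j) / (1 -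
    t) of v_mu. *)
Lemma sum_brW (S : {set I}) : (1 - t) * \sum_(i in S) brW i S = 1 - t ^+ #|S|.
Proof.
case: (set_0Vmem S) => [->|[i0 i0S]].
  by rewrite big_set0 mulr0 cards0 expr0 subrr.
have := congr1 (fun p : {poly F} => p`_#|S|) (br_lagrange_poly S).
have cf (K : {set I}) c : (\prod_(j in K) (1 - c j *: 'X) : {poly F})`_#|K| =
    \prod_(j in K) (- c j).
  have := coef_lin_prod K (fun=> 1) (fun j => - c j).
  by under eq_bigr => j _ do rewrite scaleNr.
rewrite coefB !cf coefN -scalerAl coefZ coefXM cards_eq0.
have /negbTE-> : S != set0 by apply/set0Pn; exists i0.
rewrite coef_sum.
have E i : i \in S -> ((x i * brW i S) *: \prod_(j in S :\ i) (1 - x j *: 'X) :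
    {poly F})`_#|S|.-1
   = - (brW i S * \prod_(j in S) - x j).
  move=> iS; rewrite coefZ.
  have -> : #|S|.-1 = #|S :\ i| by rewrite (cardsD1 i) iS.
  rewrite cf [in RHS](bigD1 i iS) /=; set Q := (X in - (_ * (_ * X))).
  have -> : \prod_(j in S :\ i) - x j = Q by apply: eq_bigl => j; rewrite !inE andbC.
  ring.
rewrite (eq_bigr _ E) sumrN -mulr_suml mulrN opprK.
have -> : \prod_(j in S) - (t * x j) = t ^+ #|S| * \prod_(j in S) - x j.
  by rewrite -prodr_const -big_split /=; apply: eq_bigr => j _; rewrite mulrN.
move=> h; apply: (@mulIf _ (\prod_(j in S) - x j)).
  by apply/prodf_neq0 => j _; rewrite oppr_eq0.
by rewrite -mulrA -h; ring.
Qed.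

(** For [i] in [J], the factors of [i] against S - J and against J - i make up [brW i S]; what is
    left is the block factor of J - i. *)
Lemma brA_exchange (S : {set I}) (u : I -> {set I} -> F) :
  \sum_(J : {set I} | J \subset S) brA J (S :\:
      J) * \sum_(i in J) brW i J * u i (J :\ i) =
  \sum_(i in S) brW i S * \sum_(J : {set I} | J \subset S :\ i) brA J ((S :\ i) :\:
      J) * u i J.
Proof.
transitivity (\sum_(J : {set I} | J \subset S) \sum_(i in J)
    brW i S * (brA (J :\ i) ((S :\ i) :\: (J :\ i)) * u i (J :\ i))).
  apply: eq_bigr => J /subsetP JS; rewrite big_distrr /=; apply: eq_bigr => i iJ.
  have e : (S :\ i) :\: (J :\ i) = S :\: J.
    by apply/setP => j; rewrite !inE; case: (eqVneq j i) => // ->; rewrite iJ.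
  rewrite e !mulrA; congr (_ * _).
  rewrite /brA (big_setD1 i iJ) /= mulrAC; congr (_ * _).
  rewrite /brW [RHS](big_setID J) mulrC /=; congr (_ * _).
    apply: eq_bigl => j; rewrite !inE; case: (eqVneq j i) => //= _.
    by case: (boolP (j \in J)) => [/JS ->|]; rewrite ?andbF.
  apply: eq_bigl => j; rewrite !inE; case: (eqVneq j i) => [->|_] //=.
  by rewrite iJ.
rewrite (exchange_subset S (fun i J => brW i S * (brA J ((S :\ i) :\: J) * u i J))).
by apply: eq_bigr => i _; rewrite big_distrr.
Qed.

(* At [y = t^s] this satisfies a recursion in [s]; polynomials in [y] that agree
   at all [t^s] are equal. *)
Definition gfac r (y : F) := \prod_(j < r) (t ^+ j - y).

(** Here [J] is the set of variables that meet the first column. Divided by all the 1 - x_i z with i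
    in [S], the closed form of this sum becomes the recursion that removes this column. *)
Definition brPhi (S : {set I}) (y z : F) :=
  \sum_(J : {set I} | J \subset S) brA J (S :\: J) *
    (\prod_(i in J) (x i * z) * \prod_(i in S :\: J) (1 - x i * z) * gfac #|J| y).

(** The factor 1 - t^r equals (1 - t) times the sum of [brW] over a set of [r] variables; in the
    recursion this marks an element of [J]. *)
Lemma gfac_step r s :
  gfac r (t ^+ s) - gfac r (t ^+ s.+1) = - t ^+ s * (1 - t ^+ r) * gfac r.-1 (t ^+ s).
Proof.
case: r => [|r]; first by rewrite /gfac !big_ord0 expr0 !subrr mulr0 mul0r.
have -> : gfac r.+1 (t ^+ s.+1) = t ^+ r * (1 - t ^+ s.+1) * gfac r (t ^+ s).
  rewrite /gfac big_ord_recl expr0 [t ^+ r * _]mulrC -[RHS]mulrA; congr (_ * _).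
  have -> : t ^+ r = \prod_(i < r) t by rewrite prodr_const card_ord.
  rewrite -big_split; apply: eq_bigr => i _; rewrite lift0 /= !exprS; ring.
rewrite {1}/gfac big_ord_recr /= -/(gfac r _) !exprS; ring.
Qed.

(** Induction on |S| and on [s]. For s = 0 only the empty [J] survives. The difference of the values
    at s and s + 1 marks an element of [J]; exchanging sums turns it into values for S - i at the
    same [s], and [br_lagrange] identifies the outcome with the difference of the products. *)
Lemma brPhi_root (S : {set I}) s z :
  brPhi S (t ^+ s) z = \prod_(i in S) (1 - x i * t ^+ s * z).
Proof.
move eqk : #|S| => k; elim: k S eqk s => [|k IHk] S hk s.
  move/eqP: hk; rewrite cards_eq0 => /eqP->; rewrite big_set0 /brPhi.
  rewrite (big_pred1 set0); last by move=> J; rewrite /= subset0.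
  by rewrite /brA set0D cards0 /gfac !big_set0 big_ord0 !mulr1.
elim: s => [|s IHs].
  rewrite /brPhi expr0 (bigD1 set0) ?sub0set //= [X in _ + X]big1 ?addr0.
    rewrite /brA /gfac cards0 !big_set0 big_ord0 setD0 !mul1r mulr1.
    by apply: eq_bigr => i _; rewrite mulr1.
  move=> J /andP[_]; rewrite -card_gt0 /gfac; case: #|J| => // j _.
  by rewrite big_ord_recl expr0 subrr mul0r !mulr0.
have key : brPhi S (t ^+ s) z - brPhi S (t ^+ s.+1) z =
    - ((1 - t) * (t ^+ s * z) *
      \sum_(i in S) x i * brW i S * \prod_(j in S :\ i) (1 - x j * (t ^+ s * z))).
  rewrite /brPhi -sumrB.
  transitivity (\sum_(J : {set I} | J \subset S) brA J (S :\: J) * \sum_(i in J) brW i J *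
    (- ((1 - t) * (t ^+ s * z)) * (x i * (\prod_(j in J :\ i) (x j * z) *
      \prod_(j in (S :\ i) :\: (J :\ i)) (1 - x j * z) * gfac #|J :\ i| (t ^+ s))))).
    apply: eq_bigr => J _; rewrite -mulrBr -mulrBr gfac_step; congr (_ * _).
    rewrite -sum_brW mulrCA -!mulrA big_distrl /= !big_distrr /=; apply: eq_bigr => i iJ.
    rewrite (big_setD1 i iJ) /= [#|J|](cardsD1 i) iJ /=.
    have -> : (S :\ i) :\: (J :\ i) = S :\: J.
      by apply/setP => j; rewrite !inE; case: (eqVneq j i) => // ->; rewrite iJ.
    ring.
  rewrite (brA_exchange S (fun i J => - ((1 - t) * (t ^+ s * z)) * (x i *
     (\prod_(j in J) (x j * z) * \prod_(j in (S :\ i) :\: J) (1 - x j * z) *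
       gfac #|J| (t ^+ s))))).
  rewrite big_distrr -sumrN /=; apply: eq_bigr => i iS.
  have := IHk (S :\ i) _ s; rewrite -/(brPhi _ _ _).
  have -> : #|S :\ i| = k by move: hk; rewrite (cardsD1 i) iS => -[].
  move=> /(_ erefl); rewrite /brPhi => e.
  under eq_bigr => J _ do rewrite mulrCA [X in _ * X]mulrCA.
  rewrite -!big_distrr /= e.
  under [in RHS]eq_bigr => j _ do rewrite mulrA.
  ring.
have := br_lagrange S (t ^+ s * z); rewrite -key IHs.
have -> : \prod_(j in S) (1 - x j * (t ^+ s * z)) = \prod_(i in S) (1 - x i * t ^+ s * z).
  by apply: eq_bigr => j _; rewrite mulrA.
have -> : \prod_(j in S) (1 - t * x j * (t ^+ s * z)) = \prod_(i in S) (1 - x i * t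
    ^+ s.+1 * z).
  by apply: eq_bigr => j _; rewrite exprS; ring.
by move=> /addrI /oppr_inj ->.
Qed.

Lemma exp_nroot_inj : t != 0 -> forall s s', t ^+ s = t ^+ s' -> s = s'.
Proof.
move=> t0 s s'; wlog le : s s' / (s <= s')%N.
  by move=> H; case/orP: (leq_total s s') => h e; [|apply/esym]; apply: H.
rewrite -(subnKC le) exprD -[X in X = _]mulr1 => /(mulfI (expf_neq0 s t0))/esym/eqP e.
have [|h] := posnP (s' - s); first by move=> ->; rewrite addn0.
by move: e; rewrite (negbTE (t_nroot h)).
Qed.

Lemma poly_eq_on_powers (t0 : t != 0) (p q : {poly F}) :
  (forall s, p.[t ^+ s] = q.[t ^+ s]) -> p = q.
Proof.
move=> e; apply/eqP; rewrite -subr_eq0; apply/eqP.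
apply: (@roots_geq_poly_eq0 _ _ [seq t ^+ s | s <- iota 0 (size (p - q))]).
- by apply/allP => _ /mapP[s _ ->]; rewrite rootE hornerD hornerN e subrr.
- by rewrite map_inj_uniq ?iota_uniq //; exact: exp_nroot_inj.
- by rewrite size_map size_iota.
Qed.

End BracketProduct.

(* Truncated power series are handled by polynomials modulo [X^(B + 1)]. *)
Definition eqmodX (R : nzRingType) (B : nat) (p q : {poly R}) :=
  forall M, (M <= B)%N -> p`_M = q`_M.

Lemma eqmodXM (R : nzRingType) B (p q p' q' : {poly R}) :
  eqmodX B p q -> eqmodX B p' q' -> eqmodX B (p * p') (q * q').
Proof.
move=> h h' M hM; rewrite !coefM; apply: eq_bigr => i _.
have hi : (i <= M)%N by rewrite -ltnS.
by rewrite h ?h' // (leq_trans _ hM) // leq_subr.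
Qed.

Lemma eqmodX_prod (R : comNzRingType) B (I : finType) (P : pred I) (f g : I -> {poly R}) :
  (forall i, P i -> eqmodX B (f i) (g i)) ->
  eqmodX B (\prod_(i | P i) f i) (\prod_(i | P i) g i).
Proof.
move=> h; apply: (big_ind2 (eqmodX B)) => //.
by move=> *; apply: eqmodXM.
Qed.

Section Column.
Variables (F : fieldType) (I : finType) (x : I -> F) (t : F).
Hypotheses (x_inj : injective x) (x_neq0 : forall i, x i != 0).
Hypothesis t_nroot : forall j, (0 < j)%N -> t ^+ j != 1.
Hypothesis t_neq0 : t != 0.

Local Notation brA := (brA x t).
Local Notation brW := (brW x t).
Local Notation gfac := (gfac t).

Lemma brPhiE (S : {set I}) y z :
  brPhi x t S y z = \prod_(i in S) (1 - x i * y * z).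
Proof.
pose p : {poly F} := \sum_(J : {set I} | J \subset S) (brA J (S :\: J) *
    (\prod_(i in J) (x i * z) * \prod_(i in S :\: J) (1 - x i * z))) *:
      \prod_(j < #|J|) ((t ^+ j)%:P - 'X).
pose q : {poly F} := \prod_(i in S) (1 - (x i * z) *: 'X).
have pE c : p.[c] = brPhi x t S c z.
  rewrite /p horner_sum; apply: eq_bigr => J _; rewrite hornerZ -!mulrA;
      congr (_ * (_ * (_ * _))).
  by rewrite horner_prod; apply: eq_bigr => j _; rewrite !hornerE.
have qE c : q.[c] = \prod_(i in S) (1 - x i * c * z).
  by rewrite /q horner_prod; apply: eq_bigr => i _; rewrite !hornerE mulrAC.
rewrite -pE -qE; congr (_.[_]); apply: (poly_eq_on_powers t_nroot t_neq0) => s.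
by rewrite pE qE (brPhi_root t x_inj x_neq0).
Qed.

(** The closed form of [brPhi] with [z] as the indeterminate: it holds for all values of [z], in
    particular at all powers of [t]. *)
Lemma brPhi_poly (S : {set I}) y :
  \sum_(J : {set I} | J \subset S) (brA J (S :\: J) * \prod_(i in J) x i * gfac #|J| y) *:
    ('X^#|J| * \prod_(i in S :\: J) (1 - x i *: 'X)) =
  \prod_(i in S) (1 - (x i * y) *: 'X).
Proof.
apply: (poly_eq_on_powers t_nroot t_neq0) => s; set z := t ^+ s.
have ev c : (1 - c *: 'X : {poly F}).[z] = 1 - c * z by rewrite !hornerE.
rewrite [in RHS]horner_prod (eq_bigr _ (fun i _ => ev _)) -brPhiE horner_sum.
apply: eq_bigr => J _;
    rewrite hornerZ hornerM hornerXn horner_prod big_split /= prodr_const.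
rewrite (eq_bigr _ (fun i _ => ev _)); ring.
Qed.

Section Truncate.
Variable B : nat.

(** Truncation of the series of 1 / (1 - x_i X); [geomq] truncates (1 - x_i y X) / (1 - x_i X),
    whose coefficients are (1 - y) x_i^a for a > 0. *)
Definition geom i : {poly F} := \poly_(a < B.+1) x i ^+ a.
Definition geomq y i : {poly F} :=
  \poly_(a < B.+1) ((if a == 0%N then 1 else 1 - y) * x i ^+ a).

Lemma coef_mul_lin c (p : {poly F}) M : ((1 - c *: 'X) * p)`_M =
  p`_M - c * (if M is M'.+1 then p`_M' else 0).
Proof.
rewrite mulrBl mul1r coefB -scalerAl coefZ coefXM; case: M => //=.
Qed.

Lemma geom_lin y i : eqmodX B ((1 - (x i * y) *: 'X) * geom i) (geomq y i).
Proof.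
move=> M hM; rewrite coef_mul_lin !coef_poly ltnS hM.
case: M hM => [|M] hM; first by rewrite /= mulr0 subr0 mul1r.
by rewrite coef_poly ltnS (ltnW hM) /= exprS; ring.
Qed.

Lemma geom_inv i : eqmodX B ((1 - x i *: 'X) * geom i) 1.
Proof.
move=> M hM; have := @geom_lin 1 i M hM; rewrite mulr1 => ->.
rewrite coef_poly ltnS hM coef1; case: M {hM} => [|M] /=; first by rewrite mulr1.
by rewrite subrr mul0r.
Qed.

(** Up to degree [B], the complete homogeneous polynomials in the variables of [S]; [qsym] is their
    deformation by [y]. *)
Definition hsym (S : {set I}) M := (\prod_(i in S) geom i)`_M.
Definition qsym (S : {set I}) y M := (\prod_(i in S) geomq y i)`_M.

Lemma qsym0 S M : qsym S 0 M = hsym S M.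
Proof.
rewrite /qsym (eq_bigr geom) // => i _; apply/polyP => a; rewrite !coef_poly.
by rewrite subr0 if_same mul1r.
Qed.

(** Multiplication of [brPhi_poly] by all the geometric series: those outside [J] cancel the factors
    1 - x_i X. *)
Lemma qsym_rec (S : {set I}) y M : (M <= B)%N ->
  qsym S y M = \sum_(J : {set I} | (J \subset S) && (#|J| <= M)%N)
    brA J (S :\: J) * \prod_(i in J) x i * gfac #|J| y * hsym J (M - #|J|).
Proof.
move=> hM.
have h1 : eqmodX B (\prod_(i in S) (1 - (x i * y) *: 'X) * \prod_(i in S) geom i)
             (\prod_(i in S) geomq y i).
  by rewrite -big_split /=; apply: eqmodX_prod => i _; exact: geom_lin.
rewrite /qsym -h1 // -brPhi_poly mulr_suml coef_sum big_mkcondr /=.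
apply: eq_bigr => J /setIidPr JS; rewrite -scalerAl coefZ.
have -> : \prod_(i in S) geom i = \prod_(i in J) geom i * \prod_(i in S :\: J) geom i.
  by rewrite (big_setID J) /= JS.
have -> : 'X^#|J| * \prod_(i in S :\: J) (1 - x i *: 'X) *
    (\prod_(i in J) geom i * \prod_(i in S :\: J) geom i) =
   'X^#|J| * \prod_(i in J) geom i *
     \prod_(i in S :\: J) ((1 - x i *: 'X) * geom i) :> {poly F}.
  rewrite big_split /=; ring.
have h2 : eqmodX B ('X^#|J| * \prod_(i in J) geom i *
     \prod_(i in S :\: J) ((1 - x i *: 'X) * geom i)) ('X^#|J| * \prod_(i in J) geom i).
  rewrite -[X in eqmodX _ _ X]mulr1; apply: eqmodXM => //.
  have := @eqmodX_prod _ B _ (mem (S :\: J)) _ (fun=> 1) (fun i _ => @geom_inv i).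
  by rewrite [X in eqmodX _ _ X]big1.
rewrite h2 // coefXnM ltnNge; case: leqP => //= _; by rewrite mulr0.
Qed.

End Truncate.

(* The Hall-Littlewood symmetrization, by recursion on the first exponent. *)
Fixpoint hlR (S : {set I}) (s : seq nat) : F :=
  if s is a :: s' then \sum_(i in S) x i ^+ a * brW i S * hlR (S :\ i) s' else 1.

(** [J] collects the variables that receive the exponents of [s1]. *)
Lemma hlR_cat (S : {set I}) s1 s2 :
  hlR S (s1 ++ s2) = \sum_(J : {set I} | (J \subset S) && (#|J| == size s1))
     brA J (S :\: J) * hlR J s1 * hlR (S :\: J) s2.
Proof.
elim: s1 S => [|a s1 IHs] S.
  rewrite (big_pred1 set0) /=.
    by rewrite brA0 setD0 !mul1r.
  move=> J; rewrite cards_eq0 andb_idl // => /eqP->; exact: sub0set.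
rewrite /= big_mkcondr /=.
transitivity (\sum_(J : {set I} | J \subset S) brA J (S :\: J) * \sum_(i in J) brW i J *
    (if #|J :\ i| == size s1 then x i ^+ a * hlR (J :\ i) s1 * hlR ((S :\ i) :\:
        (J :\ i)) s2 else 0)).
  rewrite (brA_exchange x t S (fun i J => if #|J| == size s1 then
     x i ^+ a * hlR J s1 * hlR ((S :\ i) :\: J) s2 else 0)).
  apply: eq_bigr => i iS; rewrite IHs big_mkcondr /= !big_distrr /=.
  by apply: eq_bigr => J _; case: ifP => _; rewrite ?mulr0 //; ring.
apply: eq_bigr => J _; case: ifP => h; last first.
  rewrite big1 ?mulr0 // => i iJ.
  by move: h; rewrite (cardsD1 i) iJ add1n eqSS => ->; rewrite mulr0.
rewrite -mulrA; congr (_ * _); rewrite mulr_suml; apply: eq_bigr => i iJ.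
move: h; rewrite (cardsD1 i) iJ add1n eqSS => ->.
have -> : (S :\ i) :\: (J :\ i) = S :\: J.
  by apply/setP => j; rewrite !inE; case: (eqVneq j i) => // ->; rewrite iJ.
ring.
Qed.

Lemma hlR_map_succ (S : {set I}) s : #|S| = size s ->
  hlR S (map succn s) = \prod_(i in S) x i * hlR S s.
Proof.
elim: s S => [|a s IHs] S /=.
  by move/eqP; rewrite cards_eq0 => /eqP->; rewrite big_set0 mulr1.
move=> h; rewrite big_distrr /=; apply: eq_bigr => i iS.
rewrite IHs; last by move: h; rewrite (cardsD1 i) iS => -[].
rewrite [in RHS](big_setD1 i iS) /= exprS; ring.
Qed.

Definition vfac k := \prod_(1 <= j < k.+1) ((1 - t ^+ j) / (1 - t)).
Definition vseq (s : seq nat) := \prod_(i <- undup s) vfac (count_mem i s).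

Lemma hlR_nseq0 (S : {set I}) k : #|S| = k -> hlR S (nseq k 0%N) = vfac k.
Proof.
elim: k S => [|k IHk] S h /=; first by rewrite /vfac big_nil.
have t1 : 1 - t != 0 by rewrite subr_eq0 eq_sym -[t]expr1 t_nroot.
rewrite /vfac big_nat_recr //= -/(vfac k) -[in RHS]h -(sum_brW t x_inj x_neq0).
rewrite [(1 - t) * _]mulrC mulfK // big_distrr /=; apply: eq_bigr => i iS.
rewrite expr0 mul1r IHk; first by rewrite mulrC.
by move: h; rewrite (cardsD1 i) iS => -[].
Qed.

Lemma vfac_neq0 k : vfac k != 0.
Proof.
rewrite /vfac prodf_seq_neq0; apply/allP => j; rewrite mem_index_iota => /andP[j0 _].
rewrite /= mulf_neq0 ?invr_eq0 ?subr_eq0 1?eq_sym ?t_nroot //.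
by rewrite -[t]expr1 t_nroot.
Qed.

Lemma vseq_neq0 s : vseq s != 0.
Proof. by rewrite /vseq prodf_seq_neq0; apply/allP => i _; exact: vfac_neq0. Qed.

Lemma vseqE s B : all (gtn B) s -> vseq s = \prod_(i <- iota 0 B) vfac (count_mem i s).
Proof.
move=> hs; rewrite [RHS](bigID (mem s)) /= [X in _ * X]big1 ?mulr1; last first.
  by move=> i /count_memPn ->; rewrite /vfac big_geq.
rewrite -big_filter /vseq; apply/perm_big/uniq_perm;
    rewrite ?undup_uniq ?filter_uniq ?iota_uniq //.
move=> i; rewrite mem_undup mem_filter mem_iota add0n /=; apply/esym/andb_idr.
by move/(allP hs).
Qed.

Lemma vseq_map_succ s : vseq (map succn s) = vseq s.
Proof.
pose B := (\max_(i <- s) i).+1.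
have hs : all (gtn B) s.
  by apply/allP => i hi /=; rewrite ltnS; apply: leq_bigmax_seq.
rewrite (vseqE hs) (@vseqE _ B.+1); last by rewrite all_map; apply: sub_all hs.
rewrite -[iota 0 B.+1]/(0%N ::
    iota 1 B) big_cons (iotaDl 1 0) big_map (count_memPn _); last first.
  by apply/mapP => -[].
rewrite {1}/vfac big_geq // mul1r; apply: eq_bigr => i _.
by rewrite add1n count_map; congr vfac; apply: eq_count.
Qed.

Lemma vseq_cat0 s k : 0%N \notin s -> vseq (s ++ nseq k 0%N) = vseq s * vfac k.
Proof.
move=> s0; pose B := (\max_(i <- s) i).
have hs : all (gtn B.+1) s.
  by apply/allP => i hi /=; rewrite ltnS; apply: leq_bigmax_seq.
rewrite (vseqE hs) (@vseqE _ B.+1); last first.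
  by rewrite all_cat hs all_nseq /= orbT.
rewrite [iota 0 _]/= !big_cons count_cat (count_memPn s0) count_nseq /= mul1n.
have v0 : vfac 0 = 1 by rewrite /vfac big_geq.
rewrite add0n v0 mul1r mulrC; congr (_ * _).
apply: eq_big_seq => i; rewrite mem_iota => /andP[i0 _].
by rewrite count_cat count_nseq /= (ltn_eqF i0) mul0n addn0.
Qed.

(** P_mu in the variables indexed by [S]. General subsets are needed because removing a column
    restricts the variables. *)
Definition hlP (S : {set I}) (mu : seq nat) := hlR S (pad #|S| mu) / vseq (pad #|S| mu).

(* This removes the first column of the diagram. *)
Lemma hlP_column (S : {set I}) l (nu : seq nat) : (l <= #|S|)%N -> (size nu <= l)%N ->
  hlP S (map succn (pad l nu)) = \sum_(J : {set I} | (J \subset S) && (#|J| == l))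
     brA J (S :\: J) * \prod_(i in J) x i * hlP J nu.
Proof.
move=> lS nul; have sp : size (pad l nu) = l by rewrite size_cat size_nseq subnKC.
rewrite /hlP {1 2}/pad size_map sp vseq_cat0; last by apply/mapP => -[].
rewrite hlR_cat size_map sp mulr_suml; apply: eq_bigr => J /andP[JS /eqP cJ].
(* The variables of [J] yield one factor x_i each, and the zero parts contribute [vfac] of their
   number, which cancels against the denominator. *)
rewrite hlR_map_succ ?sp // hlR_nseq0; last by rewrite cardsD (setIidPr JS) cJ.
rewrite vseq_map_succ cJ; have h1 := vseq_neq0 (pad l nu);
    have h2 := vfac_neq0 (#|S| - l).
by field; rewrite h1 h2.
Qed.

End Column.

(** * Removing the first column of a partition *)

Lemma kappa_succ l nu : (size nu <= l)%N ->
  kappa (map succn (pad l nu)) = ('C(l, 2) + kappa nu)%N.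
Proof.
move=> h; have sp : size (pad l nu) = l by rewrite size_cat size_nseq subnKC.
rewrite /kappa size_map sp.
have -> : (\sum_(k < size nu) k * nth 0 nu k = \sum_(k < l) k * nth 0 (pad l nu) k)%N.
  rewrite -(big_mkord xpredT (fun k => k * nth 0 nu k)%N).
  rewrite -(big_mkord xpredT (fun k => k * nth 0 (pad l nu) k)%N).
  rewrite (big_cat_nat _ h) //= [X in (_ = _ + X)%N]big1_seq ?addn0.
    apply: eq_big_nat => k /andP[_ hk]; by rewrite nth_cat hk.
  move=> k /andP[_]; rewrite mem_index_iota => /andP[hk hl].
  by rewrite nth_cat ltnNge hk /= nth_nseq if_same muln0.
rewrite -bin2_sum big_mkord -big_split /=; apply: eq_bigr => k _.
by rewrite (nth_map 0%N) ?sp // mulnS.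
Qed.

Lemma partition_size_le M mu : is_partition_of M mu -> (size mu <= M)%N.
Proof.
case/and3P => _ mu0 /eqP <-; elim: mu mu0 => //= v s IHs.
by rewrite inE negb_or => /andP[v0 /IHs h]; rewrite -add1n leq_add // lt0n eq_sym.
Qed.

Lemma sumn_map_succ s : sumn (map succn s) = (size s + sumn s)%N.
Proof. by elim: s => //= v s ->; lia. Qed.

Lemma sumn_pad l nu : sumn (pad l nu) = sumn nu.
Proof. by rewrite sumn_cat sumn_nseq mul0n addn0. Qed.

Lemma filter_pad l nu : 0%N \notin nu -> filter (ltn 0) (pad l nu) = nu.
Proof.
move=> h; rewrite filter_cat filter_nseq /= cats0.
by apply/all_filterP/allP => v hv /=; rewrite lt0n; apply: contraNneq h => <-.
Qed.

Lemma pad_filter l s : sorted geq s -> size s = l -> pad l (filter (ltn 0) s) = s.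
Proof.
move=> so <- {l}; elim: s so => //= v s IHs so.
case: (ltnP 0 v) => hv /=;
    first by rewrite /pad /= subSS -/(pad _ _) IHs // (path_sorted so).
have z w : w \in s -> w = 0%N.
  by move=> hw; have /allP /(_ _ hw) := order_path_min (rev_trans leq_trans) so =>
      /=; lia.
have -> : filter (ltn 0) s = [::].
  by apply/eqP; rewrite -[_ == _]negbK -has_filter; apply/hasP => -[w /z ->].
rewrite /pad /=; have -> : v = 0%N by lia.
congr (_ :: _); apply/esym/all_pred1P/allP => w /z -> /=; exact: eqxx.
Qed.

Lemma sorted_pad l nu : sorted geq nu -> sorted geq (pad l nu).
Proof.
move=> so; rewrite (sorted_pairwise (rev_trans leq_trans)) pairwise_cat.
rewrite -!(sorted_pairwise (rev_trans leq_trans)) so /=; apply/andP; split.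
  by apply/allrelP => u v _; rewrite mem_nseq => /andP[_ /eqP->].
by case: (_ - _)%N => //= k; elim: k => //= k ->.
Qed.

Lemma partitions_column l M : (l <= M)%N ->
  perm_eq [seq mu <- partitions M | size mu == l]
    [seq map succn (pad l nu) | nu <- partitions (M - l) & (size nu <= l)%N].
Proof.
move=> lM; apply: uniq_perm.
- by apply/filter_uniq/partitions_uniq.
- rewrite map_inj_in_uniq; first by apply/filter_uniq/partitions_uniq.
  move=> nu nu'; rewrite mem_filter mem_partitions => /andP[_ /and3P[_ h _]].
  rewrite mem_filter mem_partitions => /andP[_ /and3P[_ h' _]].
  move/(inj_map succn_inj) => e.
  by rewrite -(filter_pad l h) -(filter_pad l h') e.
move=> mu; rewrite mem_filter mem_partitions; apply/andP/mapP.
  move=> [/eqP sz /and3P[so h0 /eqP sm]].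
  have e : map succn (map predn mu) = mu.
    rewrite -map_comp -[RHS]map_id; apply/eq_in_map => v hv /=; rewrite prednK //.
    by rewrite lt0n; apply: contraNneq h0 => <-.
  pose nu := filter (ltn 0) (map predn mu).
  have sop : sorted geq (map predn mu).
    by rewrite sorted_map; apply: sub_sorted so => u v /=; lia.
  have ep : pad l nu = map predn mu by rewrite pad_filter // size_map.
  exists nu; last by rewrite ep e.
  rewrite mem_filter mem_partitions; apply/andP; split.
    by rewrite size_filter (leq_trans (count_size _ _)) // size_map sz.
  apply/and3P; split.
  - exact: (sorted_filter (rev_trans leq_trans)).
  - by rewrite mem_filter.
  - have h : sumn mu = (l + sumn (map predn mu))%N.
      by rewrite -{1}e sumn_map_succ size_map sz.
    by rewrite -(sumn_pad l) ep -sm h addKn.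
move=> [nu]; rewrite mem_filter mem_partitions => /andP[snu /and3P[so h0 /eqP sm]] ->.
have sp : size (pad l nu) = l by rewrite size_cat size_nseq subnKC.
rewrite size_map sp eqxx; split=> //; apply/and3P; split.
- by rewrite sorted_map; apply: sub_sorted (sorted_pad l so) => u v /=; lia.
- by apply/mapP => -[].
- by rewrite sumn_map_succ sp sumn_pad sm subnKC.
Qed.

Lemma bin2_le_kappa mu : 0%N \notin mu -> ('C(size mu, 2) <= kappa mu)%N.
Proof.
move=> h; rewrite -bin2_sum big_mkord; apply: leq_sum => k _.
rewrite -{1}[val k]muln1 leq_mul2l lt0n; apply/orP; right.
by apply: contraNneq h => <-; exact: mem_nth.
Qed.

(** * The generating identity for Hall-Littlewood polynomials *)

Section Generating.
Variables (F : fieldType) (I : finType) (x : I -> F) (t : F).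
Hypotheses (x_inj : injective x) (x_neq0 : forall i, x i != 0).
Hypothesis t_nroot : forall j, (0 < j)%N -> t ^+ j != 1.
Hypothesis t_neq0 : t != 0.
Variable B : nat.

(** The product of the 1 - t^(-j) y for j < l is t^(-C(l,2)) [gfac t l y], whence the exponent, a
    true difference for partitions. *)
Definition hlsum (S : {set I}) y M :=
  \sum_(mu <- partitions M | (size mu <= #|S|)%N)
    t ^+ (kappa mu - 'C(size mu, 2)) * gfac t (size mu) y * hlP x t S mu.

Lemma gfac0 r : gfac t r 0 = t ^+ 'C(r, 2).
Proof.
rewrite /gfac -bin2_sum big_mkord expr_sum.
by apply: eq_bigr => i _; rewrite subr0.
Qed.

Lemma hlsum0 (J : {set I}) M : hlsum J 0 M =
  \sum_(nu <- partitions M | (size nu <= #|J|)%N) t ^+ kappa nu * hlP x t J nu.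
Proof.
rewrite /hlsum big_seq_cond [RHS]big_seq_cond; apply: eq_bigr => nu.
rewrite mem_partitions => /andP[/and3P[_ h _] _].
by rewrite gfac0 -exprD subnK // bin2_le_kappa.
Qed.

(** Partitions are sorted by length [l] and lose a column of length [l]. That column carries C(l,2)
    of [kappa], so the remaining sum has the full weight t^kappa, which is the value at y = 0. *)
Lemma hlsum_rec (S : {set I}) y M :
  hlsum S y M = \sum_(J : {set I} | (J \subset S) && (#|J| <= M)%N)
    brA x t J (S :\: J) * \prod_(i in J) x i * gfac t #|J| y *
      hlsum J 0 (M - #|J|).
Proof.
rewrite [LHS]/hlsum.
pose k := #|S|.
transitivity (\sum_(l < k.+1 | (l <= M)%N) \sum_(mu <- [seq mu <- partitions M | size
    mu == l])
    t ^+ (kappa mu - 'C(size mu, 2)) * gfac t (size mu) y * hlP x t S mu).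
  rewrite (eq_bigr (fun l : 'I_k.+1 => \sum_(mu <- partitions M | size mu == l)
    t ^+ (kappa mu - 'C(size mu, 2)) * gfac t (size mu) y * hlP x t S mu)); last first.
    by move=> l _; rewrite big_filter.
  rewrite [LHS]big_seq_cond.
  rewrite (partition_big (fun mu => inord (size mu) : 'I_k.+1) (fun l : 'I_k.+1 =>
      (l <= M)%N)) /=.
    apply: eq_bigr => l hl; rewrite [RHS]big_seq_cond; apply: eq_bigl => mu.
    rewrite -andbA; congr (_ && _); apply/andP/eqP => [[h1 /eqP <-]|e].
      by rewrite inordK.
    have hmu : (size mu <= k)%N by rewrite e -ltnS.
    split=> //; apply/eqP/val_inj; by rewrite /= inordK.
  move=> mu; rewrite mem_partitions => /andP[/partition_size_le h1 h2].
  by rewrite inordK.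
rewrite (partition_big (fun J : {set I} => inord #|J| : 'I_k.+1) (fun l : 'I_k.+1 =>
    (l <= M)%N)) /=;
  last by move=> J /andP[/subset_leq_card h1 h2]; rewrite inordK // ltnS.
apply: eq_bigr => l hl; rewrite (perm_big _ (partitions_column hl)) /= big_map big_filter.
have lk : (l <= #|S|)%N by rewrite -ltnS.
transitivity (\sum_(nu <- partitions (M - l) | (size nu <= l)%N)
   \sum_(J : {set I} | (J \subset S) && (#|J| == l))
     t ^+ kappa nu * gfac t l y * (brA x t J (S :\:
         J) * \prod_(i in J) x i * hlP x t J nu)).
  apply: eq_bigr => nu hnu; rewrite kappa_succ // size_map.
  have -> : size (pad l nu) = l by rewrite size_cat size_nseq subnKC.
  by rewrite addKn (hlP_column x_inj x_neq0 t_nroot) // big_distrr.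
rewrite exchange_big /=; apply: eq_big => [J|J /andP[JS /eqP cJ]].
  apply/andP/andP => [[h /eqP e]|[/andP[h1 h2] /eqP e]].
    by rewrite h e hl; split=> //; apply/eqP/val_inj; rewrite /= inordK ?e ?ltnS.
  by rewrite h1 -e inordK // ltnS subset_leq_card.
rewrite cJ hlsum0 cJ big_distrr /=; apply: eq_bigr => nu _; ring.
Qed.

Lemma hlsum_set0 M : hlsum set0 0 M = hsym x B set0 M.
Proof.
rewrite hlsum0 /hsym big_set0 coef1 cards0; case: (posnP M) => [->|M0]; last first.
  rewrite big_seq_cond big1 ?gtn_eqF // => -[|v nu].
    by rewrite mem_partitions /is_partition_of /= (ltn_eqF M0).
  by rewrite andbF.
rewrite big_mkcond (bigD1_seq [::]) ?partitions_uniq ?mem_partitions //= big1 ?addr0;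
    last by case.
by rewrite /hlP cards0 /= /vseq big_nil /kappa big_ord0 divr1 mulr1.
Qed.

(** [hlsum] and [qsym] obey the same recursion. It leads to smaller degrees except for the empty
    [J], where both sums are computed directly. *)
Lemma hlsumE (S : {set I}) y M : (M <= B)%N -> hlsum S y M = qsym x B S y M.
Proof.
have [k] := ubnP M; elim: k M S y => // k IHk M S y /ltnSE hk hM.
rewrite hlsum_rec (qsym_rec x_inj x_neq0 t_nroot t_neq0) //.
apply: eq_bigr => J /andP[_ cJ]; congr (_ * _).
have [->|J0] := eqVneq J set0; first by rewrite cards0 subn0 hlsum_set0.
have J1 : (0 < #|J|)%N by rewrite card_gt0.
by rewrite IHk ?qsym0 //; clear -hk cJ J1 hM; lia.
Qed.

End Generating.

Lemma hlR_imset (F : fieldType) (I I' : finType) (f : I' -> I) (x : I -> F) (t : F)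
    (S : {set I'}) s : injective f ->
  hlR x t (f @: S) s = hlR (x \o f) t S s.
Proof.
move=> f_inj; elim: s S => [|a s IHs] S //=.
have D1 i : (f @: S) :\ f i = f @: (S :\ i).
  apply/setP => j; rewrite !inE; apply/andP/imsetP => [[ne /imsetP[k kS e]]|[k]].
    by exists k; rewrite // !inE kS andbT; apply: contraNneq ne => <-; rewrite e.
  by rewrite !inE => /andP[ki kS] ->; rewrite imset_f // (inj_eq f_inj) ki.
rewrite big_imset /=; last by move=> ? ? _ _ /f_inj.
apply: eq_bigr => i iS; rewrite D1 IHs; congr (_ * _ * _).
by rewrite /brW D1 big_imset //= => ? ? _ _ /f_inj.
Qed.

(** A permutation is the choice of its first value [i] together with a permutation of the rest,
    transported by [lift]; the factors that involve the first position form [brW]. *)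
Lemma hlR_perm (F : fieldType) (k : nat) (x : 'I_k -> F) (t : F) (s : seq nat) :
  size s = k ->
  hlR x t [set: 'I_k] s =
  \sum_(w : 'S_k) (\prod_(i < k) x (w i) ^+ nth 0%N s i) *
    \prod_(i < k) \prod_(j < k | (i < j)%N) br x t (w i) (w j).
Proof.
elim: k x s => [|k IHk] x [|a s] //= h.
  rewrite (big_pred1 1%g) => [|w]; first by rewrite !big_ord0 mulr1.
  by apply/esym/eqP/permP => -[].
case: h => sk.
pose f (p : 'I_k.+1 * 'S_k) := lift_perm ord0 p.1 p.2.
have fi : injective f.
  move=> [i w] [j v] e; have /= e0 := congr1 (fun u : 'S_k.+1 => u ord0) e.
  rewrite /f !lift_perm_id /= in e0; subst j; congr (_, _); apply/permP => l.
  have /= := congr1 (fun u : 'S_k.+1 => u (lift ord0 l)) e.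
  by rewrite /f !lift_perm_lift => /lift_inj.
have fb : bijective f.
  apply: inj_card_bij fi _; rewrite card_prod card_ord !card_Sn factS.
  exact: leqnn.
rewrite [RHS](reindex f); last exact: onW_bij.
rewrite -(pair_bigA _ (fun i w => (\prod_(l < k.+1) x (f (i, w) l) ^+ nth 0%N (a ::
    s) l) *
    \prod_(l < k.+1) \prod_(j < k.+1 | (l < j)%N) br x t (f (i, w) l) (f (i, w) j))) /=.
rewrite big_mkcond /=; apply: eq_bigr => i _; rewrite inE.
have -> : [set: 'I_k.+1] :\ i = lift i @: [set: 'I_k].
  apply/setP => j; rewrite !inE andbT; apply/idP/imsetP => [ji|[l _ ->]].
    by case: (unliftP i j) ji => [l ->|->]; [exists l | rewrite eqxx].
  by rewrite eq_sym neq_lift.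
rewrite hlR_imset; last exact: lift_inj.
rewrite IHk // big_distrr /=; apply: eq_bigr => w _.
rewrite !big_ord_recl /f lift_perm_id /=.
rewrite -!mulrA; congr (_ * _).
have -> : brW x t i [set: 'I_k.+1] = \prod_(j < k) br x t i (lift i (w j)).
  rewrite /brW.
  have -> : [set: 'I_k.+1] :\ i = lift i @: [set: 'I_k].
    apply/setP => j; rewrite !inE andbT; apply/idP/imsetP => [ji|[l _ ->]].
      by case: (unliftP i j) ji => [l ->|->]; [exists l | rewrite eqxx].
    by rewrite eq_sym neq_lift.
  rewrite big_imset /=; last by move=> ? ? _ _ /lift_inj.
  rewrite (reindex_inj (@perm_inj _ w)) /=; apply: eq_bigl => j; by rewrite inE.
rewrite mulrCA; congr (_ * (_ * _)).
- by apply: eq_bigr => l _; rewrite lift_perm_lift.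
- rewrite [RHS]big_mkcond big_ord_recl /= mul1r; apply: eq_bigr => j _.
  by rewrite lift_perm_lift.
- apply: eq_bigr => l _; rewrite [RHS]big_mkcond big_ord_recl /= mul1r big_mkcond /=.
  apply: eq_bigr => j _; rewrite !lift_perm_lift.
  by rewrite /bump /= ltnS.
Qed.

Lemma hall_littlewoodE (F : fieldType) (k : nat) (x : 'I_k -> F) (t : F) mu :
  (size mu <= k)%N -> hall_littlewood mu x t = hlP x t [set: 'I_k] mu.
Proof.
move=> h; rewrite /hlP cardsT card_ord hlR_perm;
    last by rewrite size_cat size_nseq subnKC.
rewrite /hall_littlewood mulrC; congr (_ / _).
apply: eq_bigr => w _; congr (_ * _); apply: eq_bigr => i _; congr (_ ^+ _).
rewrite nth_cat; case: ltnP => // hi.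
by rewrite nth_nseq if_same nth_default.
Qed.

(** * Hook Schur polynomials as sums over compositions *)

Lemma card_content n N m (a : seq nat) : (m < N)%N -> (0 < n)%N ->
  size a = n -> sumn a = N ->
  #|[set T : SST n (hook N m) | cont T == a]| = 'C((count (ltn 0%N) a).-1, m).
Proof.
move=> ltmN n0 sa suma.
have := card_prnX_fix ltmN n0 0 sa suma.
have -> : [set T : SST n (hook N m) | (cont T == a) && (((prn n N m ^+ 0)%g T) == T)] =
   [set T : SST n (hook N m) | cont T == a].
  by apply/setP => T; rewrite !inE perm1 eqxx andbT.
move=> ->; rewrite -card_count_tuple; apply: eq_card => b.
by rewrite !inE eqxx andbT.
Qed.

Section Compositions.
Variables (n N : nat).
Implicit Types (al : {ffun 'I_n -> 'I_N.+1}).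

(** Functions into ['I_N.+1] form a finite type that contains all contents of size [N]. *)
Definition aseq al : seq nat := [seq val (al i) | i <- enum 'I_n].
Definition asize al := (\sum_i val (al i))%N.
Definition anz al := #|[set i | (0 < al i)%N]|.

Lemma size_aseq al : size (aseq al) = n.
Proof. by rewrite size_map size_enum_ord. Qed.

Lemma nth_aseq al (i : 'I_n) : nth 0%N (aseq al) i = al i.
Proof. by rewrite (nth_map i) ?size_enum_ord // nth_ord_enum. Qed.

Lemma sumn_aseq al : sumn (aseq al) = asize al.
Proof. by rewrite sumnE big_map /asize big_enum. Qed.

Lemma count_aseq al : count (ltn 0%N) (aseq al) = anz al.
Proof.
rewrite count_map /anz cardE -size_filter; congr size.
by rewrite enumT /enum_mem; apply: eq_filter => i /=; rewrite inE.
Qed.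

Lemma anz_gt0 al : (0 < asize al)%N -> (0 < anz al)%N.
Proof.
rewrite card_gt0 !lt0n => h; apply: contraNneq h => e.
apply/eqP/big1 => i _; apply/eqP; rewrite -leqn0 leqNgt.
by move/setP: e => /(_ i); rewrite !inE => ->.
Qed.

Lemma anz_le al : (anz al <= asize al)%N.
Proof.
rewrite /anz -sum1_card big_mkcond /=; apply: leq_sum => i _.
by rewrite inE; case: ltnP.
Qed.

Lemma aseq_inj : injective aseq.
Proof.
by move=> al al' e; apply/ffunP => i; apply: val_inj; rewrite /= -!nth_aseq e.
Qed.

End Compositions.

Section SchurHook.
Variables (R : comNzRingType) (n N : nat) (x : 'I_n -> R).
Hypotheses (n0 : (0 < n)%N).

Lemma sum_tableaux (m : nat) (P : pred (SST n (hook N m))) (f : (nat -> nat) -> R) :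
    (m < N)%N ->
  (forall g h, (forall i, (i < n)%N -> g i = h i) -> f g = f h) ->
  \sum_(T | P T) f (fun i => content T i.+1) =
  \sum_(al : {ffun 'I_n -> 'I_N.+1} | asize al == N)
     f (nth 0%N (aseq al)) *+ #|[set T | P T & cont T == aseq al]|.
Proof.
move=> ltmN f_ext.
pose g (T : SST n (hook N m)) : {ffun 'I_n -> 'I_N.+1} := [ffun i =>
    inord (content T (val i).+1)].
have cle (T : SST n (hook N m)) (i : 'I_n) : (content T i.+1 < N.+1)%N.
  rewrite ltnS -[N in (_ <= N)%N](sumn_cont ltmN T) -nth_cont //=.
  have h : (i < size (cont T))%N by rewrite size_cont.
  by elim: (cont T) (val i) h => //= v s IHs [|k] h;
      rewrite ?leq_addr // (leq_trans (IHs _ h)) ?leq_addl.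
have gE T : aseq (g T) = cont T.
  apply: (@eq_from_nth _ 0%N); rewrite size_aseq ?size_cont // => i hi.
  rewrite -[i]/(val (Ordinal hi)) nth_aseq ffunE inordK; last exact: cle.
  by rewrite nth_mkseq.
rewrite (partition_big g (fun al => asize al == N)) /=; last first.
  by move=> T _; rewrite -sumn_aseq gE sumn_cont.
apply: eq_bigr => al _.
rewrite (eq_bigr (fun=> f (nth 0%N (aseq al)))).
  rewrite sumr_const; congr (_ *+ _); apply: eq_card => T; rewrite !inE.
  by rewrite -gE (inj_eq (@aseq_inj _ _)).
move=> T /andP[_ /eqP <-]; apply: f_ext => i hi.
by rewrite gE /cont nth_mkseq.
Qed.

Lemma schur_hook (m : nat) : (m < N)%N ->
  schur (hook N m) x =
  \sum_(al : {ffun 'I_n -> 'I_N.+1} | asize al == N)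
     (\prod_i x i ^+ al i) *+ 'C((anz al).-1, m).
Proof.
move=> ltmN; rewrite /schur.
rewrite (@sum_tableaux m xpredT (fun g => \prod_(i < n) x i ^+ g i)) //; last first.
  by move=> g h e; apply: eq_bigr => i _; rewrite e.
apply: eq_bigr => al /eqP hal;
    rewrite -count_aseq -(card_content ltmN n0) ?size_aseq ?sumn_aseq //.
congr (_ *+ _); first by apply: eq_bigr => i _; rewrite nth_aseq.
Qed.

(** The binomial theorem sums C(k - 1, m) (-y)^m to (1 - y)^(k - 1) for each composition with [k]
    nonzero entries; the extra factor 1 - y completes the power. *)
Lemma sum_schur_hook (y : R) : (0 < N)%N ->
  (1 - y) * \sum_(m < N) (- y) ^+ m * schur (hook N m) x =
  \sum_(al : {ffun 'I_n -> 'I_N.+1} | asize al == N)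
     (\prod_i x i ^+ al i) * (1 - y) ^+ anz al.
Proof.
move=> N0.
under eq_bigr => m _ do rewrite schur_hook // big_distrr /=.
rewrite exchange_big /= big_distrr /=; apply: eq_bigr => al /eqP hal.
have k0 : (0 < anz al)%N by rewrite anz_gt0 ?hal.
have kN : (anz al <= N)%N by rewrite (leq_trans (anz_le al)) ?hal.
case: (anz al) k0 kN => // r _ rN; rewrite exprS [in RHS]exprDn.
rewrite (big_ord_widen N (fun i => 1 ^+ (r - i) * (- y) ^+ i *+ 'C(r, i))) //.
rewrite [in RHS]mulrCA; congr (_ * _); rewrite big_distrr /= [RHS]big_mkcond /=.
apply: eq_bigr => i _; case: ltnP => h.
  by rewrite expr1n mul1r mulrnAr mulrC -mulrnAr.
by rewrite bin_small // mulr0n mulr0.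
Qed.

End SchurHook.

Lemma qsym_sum (F : fieldType) (n N : nat) (x : 'I_n -> F) y :
  qsym x N [set: 'I_n] y N =
  \sum_(al : {ffun 'I_n -> 'I_N.+1} | asize al == N)
     (\prod_i x i ^+ al i) * (1 - y) ^+ anz al.
Proof.
rewrite /qsym.
have -> : \prod_(i in [set: 'I_n]) geomq x N y i =
   \prod_(i < n) \sum_(a < N.+1) ((if val a == 0%N then 1 else 1 - y) * x i ^+ a) *: 'X^a.
  by apply: eq_big => [i|i _]; [rewrite inE | rewrite /geomq poly_def].
rewrite bigA_distr_bigA coef_sum [RHS]big_mkcond /=; apply: eq_bigr => al _.
have -> : \prod_(i < n) (((if val (al i) == 0%N then 1 else 1 - y) * x i ^+ al i) *:
    'X^(al i))
   = (\prod_(i < n) ((if val (al i) == 0%N then 1 else 1 - y) * x i ^+ al i)) *: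
       'X^(asize al)
   :> {poly F}.
  by rewrite scaler_prod -expr_sum.
rewrite coefZ coefXn eq_sym; case: eqP => _; last by rewrite mulr0.
rewrite mulr1 big_split /= mulrC; congr (_ * _).
rewrite /anz -prodr_const [RHS]big_mkcond /=; apply: eq_bigr => i _.
by rewrite inE lt0n; case: eqP.
Qed.

(** The exponent kappa(mu) - C(l,2) of [hlsum], plus the powers produced by [qbinom_prod_sub] with c
    = t and r = l - 1. Where the subtraction l - 1 - m would be truncated, the Gaussian binomial
    vanishes. *)
Definition kf_exp (m : nat) (mu : seq nat) : nat :=
  (kappa mu - 'C(size mu, 2) + ((size mu).-1 - m) + 'C((size mu).-1 - m, 2))%N.

(** The generating identity is read as an identity of polynomials in [y], freed of the common factor
    1 - y, and compared in degree [m]. *)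
Lemma schur_hook_hall_littlewood (F : fieldType) (N m : nat) (x : 'I_N -> F) (t : F) :
  injective x -> (forall i, x i != 0) ->
  (forall j, (0 < j)%N -> t ^+ j != 1) -> t != 0 -> (m < N)%N ->
  schur (hook N m) x = \sum_(mu <- partitions N)
    t ^+ kf_exp m mu * gaussq t (size mu).-1 m * hall_littlewood mu x t.
Proof.
move=> x_inj x_neq0 t_nroot t_neq0 ltmN.
have N0 : (0 < N)%N by exact: leq_ltn_trans ltmN.
pose p : {poly F} := \sum_(i < N) schur (hook N i) x *: (- 'X) ^+ i.
pose q : {poly F} := \sum_(mu <- partitions N)
  (t ^+ (kappa mu - 'C(size mu, 2)) * hall_littlewood mu x t) *:
    \prod_(j < (size mu).-1) ((t * t ^+ j)%:P - 'X).
have e : (1 - 'X) * p = (1 - 'X) * q.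
  apply: (poly_eq_on_powers t_nroot t_neq0) => s; set y := t ^+ s.
  rewrite !hornerM.
  have -> : (1 - 'X : {poly F}).[y] = 1 - y by rewrite !hornerE.
  have -> : p.[y] = \sum_(i < N) (- y) ^+ i * schur (hook N i) x.
    rewrite horner_sum; apply: eq_bigr => i _.
    by rewrite hornerZ horner_exp hornerN hornerX mulrC.
  rewrite (sum_schur_hook _ _ _ N0) // -qsym_sum -(hlsumE x_inj x_neq0 t_nroot t_neq0) //.
  rewrite horner_sum big_distrr /= /hlsum cardsT card_ord big_mkcond /=.
  rewrite big_seq_cond [RHS]big_seq_cond; apply: eq_bigr => mu;
      rewrite andbT mem_partitions => hmu.
  rewrite (partition_size_le hmu) hornerZ horner_prod hall_littlewoodE
      ?partition_size_le //.
  (* A nonempty partition has the factor 1 - y in its [gfac]. *)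
  have : (0 < size mu)%N.
    by case: (mu) hmu => // /and3P[_ _ /eqP /= h]; move: N0; rewrite -h.
  case: (size mu) => // l _ /=.
  have -> : gfac t l.+1 y = (1 - y) * \prod_(j < l) (t * t ^+ j - y).
    by rewrite /gfac big_ord_recl expr0; congr (_ * _); apply: eq_bigr => j _;
        rewrite lift0 exprS.
  under [X in _ = _ * (_ * X)]eq_bigr => j _ do rewrite hornerD hornerN hornerX hornerC.
  ring.
have X1 : (1 - 'X : {poly F}) != 0.
  by rewrite -size_poly_gt0 -opprB size_polyN size_XsubC.
have sgn i : (- 'X) ^+ i = (-1) ^+ i *: 'X^i :> {poly F} by rewrite -scaleN1r exprZn.
have := congr1 (fun r : {poly F} => r`_m) (mulfI X1 e).
rewrite /p /q !coef_sum (bigD1 (Ordinal ltmN)) //= big1 ?addr0; last first.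
  move=> i; rewrite -val_eqE /= => h.
  by rewrite sgn !coefZ coefXn eq_sym (negbTE h) !mulr0.
rewrite sgn !coefZ coefXn eqxx mulr1.
move=> h; have s2 : (-1) ^+ m * (-1) ^+ m = 1 :> F by rewrite -expr2 sqrr_sign.
transitivity (schur (hook N m) x * ((-1) ^+ m * (-1) ^+ m)); first by rewrite s2 mulr1.
rewrite mulrA h mulr_suml; apply: eq_bigr => mu _;
    rewrite coefZ qbinom_prod_sub /kf_exp !exprD.
set sg := (-1) ^+ m in s2 *; set RHS := (X in _ = X).
transitivity (sg * sg * RHS); last by rewrite s2 mul1r.
rewrite /RHS; ring.
Qed.

(** * Hall-Littlewood polynomials: linear independence *)

Lemma prod_diff_perm (R : comNzRingType) k (x : 'I_k -> R) (w : 'S_k) :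
  \prod_(i < k) \prod_(j < k | (i < j)%N) (x (w i) - x (w j)) =
  (-1) ^+ w * \prod_(i < k) \prod_(j < k | (i < j)%N) (x i - x j).
Proof.
pose a := \row_(i < k) - x i; pose b := \row_(i < k) - x (w i).
have -> : \prod_(i < k) \prod_(j < k | (i < j)%N) (x i - x j) = \det (Vandermonde k a).
  rewrite det_Vandermonde; apply: eq_bigr => i _; apply: eq_bigr => j _.
  by rewrite !mxE opprK addrC.
have -> : \prod_(i < k) \prod_(j < k | (i < j)%N) (x (w i) - x (w j)) = \det
    (Vandermonde k b).
  rewrite det_Vandermonde; apply: eq_bigr => i _; apply: eq_bigr => j _.
  by rewrite !mxE opprK addrC.
have -> : Vandermonde k b = col_perm w (Vandermonde k a).
  by apply/matrixP => i j; rewrite !mxE.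
by rewrite col_permE det_mulmx det_perm odd_permV mulrC.
Qed.

Lemma mulf_cancel_out (F : fieldType) (v a b s : F) :
  v != 0 -> v * (a * (b * (s * v^-1))) = s * a * b.
Proof. by move=> v0; field. Qed.

Lemma mulrACA3 (F : comNzRingType) (v a b d h : F) :
  d * a * (v * b * h) = v * (b * a) * (d * h).
Proof. ring. Qed.

(** (1 - t^j) / (1 - t) without division, so that v_mu lies in Z[t] and can be evaluated at t =
    0. *)
Definition geom_sum (R : nzRingType) (t : R) j := \sum_(l < j) t ^+ l.

Section Unique.
Variable N : nat.
Local Notation R := {mpoly {poly int}[N]}.
Local Notation x := (fun i : 'I_N => tofrac ('X_i : R)).
Local Notation T := (('X : {poly int})%:MP_[N] : R).
Local Notation t := (tofrac T).

Lemma frac_var_inj : injective x.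
Proof.
move=> i j /eqP; rewrite tofrac_eq => /eqP /(congr1 (mcoeff U_(j)%MM)).
rewrite !mcoeffXU eqxx; case: eqP => // _ /eqP.
by rewrite eq_sym oner_eq0.
Qed.

Lemma frac_var_neq0 i : x i != 0.
Proof.
rewrite tofrac_eq0; apply/eqP => /(congr1 (mcoeff U_(i)%MM)).
by rewrite mcoeffXU eqxx mcoeff0 => /eqP; rewrite oner_eq0.
Qed.

Lemma frac_t_neq0 : t != 0.
Proof. by rewrite tofrac_eq0 mpolyC_eq0 polyX_eq0. Qed.

Lemma frac_t_nroot j : (0 < j)%N -> t ^+ j != 1.
Proof.
move=> j0; rewrite -tofracXn -tofrac1 tofrac_eq -rmorphXn -(mpolyC1 N) mpolyC_eq.
apply/eqP => /(congr1 (fun p : {poly int} => p`_j)).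
by rewrite coefXn eqxx coef1 gtn_eqF.
Qed.

Definition hlV (mu : seq nat) : {poly int} :=
  \prod_(i <- undup (pad N mu)) \prod_(1 <= j < (count_mem i (pad N mu)).+1)
    geom_sum 'X j.

Lemma hlV_frac mu : hall_littlewood_v N mu t = tofrac (hlV mu)%:MP.
Proof.
rewrite /hlV /hall_littlewood_v !rmorph_prod /=; apply: eq_bigr => i _.
rewrite !rmorph_prod /=; apply: eq_bigr => j _.
have t1 : 1 - t != 0 by rewrite subr_eq0 eq_sym -[t]expr1 frac_t_nroot.
apply: (mulIf t1); rewrite mulfVK // /geom_sum !rmorph_sum /= mulrC.
rewrite -opprB subrX1 -mulNr opprB; congr (_ * _); apply: eq_bigr => l _.
by rewrite rmorphXn tofracXn.
Qed.

Lemma hlV_coef0 mu : (hlV mu).[0] = 1.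
Proof.
rewrite /hlV horner_prod big1 // => i _; rewrite horner_prod big1_seq // => j.
rewrite mem_index_iota => /andP[_ /andP[j0 _]].
rewrite /geom_sum horner_sum; case: j j0 => // j _.
rewrite big_ord_recl expr0 hornerC big1 ?addr0 // => l _.
by rewrite hornerXn expr0n.
Qed.

Lemma hlV_neq0 mu : hlV mu != 0.
Proof.
apply/eqP => h; have := hlV_coef0 mu.
by rewrite h horner0 => /eqP; rewrite eq_sym oner_eq0.
Qed.

(** The product of v_mu, the Vandermonde product and P_mu: a polynomial in the variables over Z[t],
    in which [t] may be set to 0. *)
Definition hlNum (mu : seq nat) : R :=
  \sum_(w : 'S_N) (-1) ^+ w * (\prod_(i < N) 'X_(w i) ^+ nth 0%N mu i) *
    \prod_(i < N) \prod_(j < N | (i < j)%N) ('X_(w i) - T * 'X_(w j)).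

Definition vand : R := \prod_(i < N) \prod_(j < N | (i < j)%N) ('X_i - 'X_j).

Lemma vand_neq0 : vand != 0.
Proof.
apply/prodf_neq0 => i _; apply/prodf_neq0 => j hij.
rewrite subr_eq0 -tofrac_eq; apply/eqP => /frac_var_inj e.
by move: hij; rewrite e ltnn.
Qed.

Lemma hall_littlewood_frac mu :
  tofrac vand * tofrac (hlV mu)%:MP * hall_littlewood mu x t = tofrac (hlNum mu).
Proof.
rewrite /hall_littlewood hlV_frac -mulrA mulVKf; last first.
  by rewrite tofrac_eq0 mpolyC_eq0 hlV_neq0.
rewrite big_distrr /= /hlNum rmorph_sum /=; apply: eq_bigr => w _.
have -> : \prod_(i < N) \prod_(j < N | (i < j)%N) ((x (w i) - t * x (w j)) / (x (w i)
    - x (w j))) =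
  (\prod_(i < N) \prod_(j < N | (i < j)%N) (x (w i) - t * x (w j))) /
  (\prod_(i < N) \prod_(j < N | (i < j)%N) (x (w i) - x (w j))).
  by rewrite -prodf_div; apply: eq_bigr => i _; rewrite -prodf_div.
rewrite (prod_diff_perm x).
have -> : \prod_(i < N) \prod_(j < N | (i < j)%N) (x i - x j) = tofrac vand.
  rewrite /vand !rmorph_prod /=; apply: eq_bigr => i _; rewrite rmorph_prod /=.
  by apply: eq_bigr => j _; rewrite rmorphB.
have : tofrac vand != 0 by rewrite tofrac_eq0 vand_neq0.
move: (tofrac vand) => V V0; rewrite !rmorphM /= rmorph_sign !rmorph_prod /=.
have -> : \prod_(i < N) tofrac ('X_(w i) ^+ nth 0%N mu i :
    R) = \prod_(i < N) x (w i) ^+ nth 0%N mu i.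
  by apply: eq_bigr => i _; rewrite rmorphXn.
have -> : \prod_(i < N) tofrac (\prod_(j < N | (i < j)%N) ('X_(w i) - T * 'X_(w j)) : R) =
  \prod_(i < N) \prod_(j < N | (i < j)%N) (x (w i) - t * x (w j)).
  apply: eq_bigr => i _; rewrite rmorph_prod /=; apply: eq_bigr => j _.
  by rewrite rmorphB rmorphM.
rewrite invfM invr_sign; exact: mulf_cancel_out.
Qed.

(** The exponents mu + delta; at t = 0 the numerator [hlNum] becomes the alternant with these
    exponents. *)
Definition muD (mu : seq nat) (i : 'I_N) := (nth 0%N mu i + (N - i.+1))%N.
Definition mon_muD mu : 'X_{1..N} := [multinom muD mu i | i < N].

Definition at0 := (horner_eval (0 : int)).

Lemma map_hlNum mu : map_mpoly at0 (hlNum mu) =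
  \sum_(w : 'S_N) (-1) ^+ w * 'X_[[multinom muD mu ((w^-1)%g i) | i < N]].
Proof.
rewrite /hlNum rmorph_sum /=; apply: eq_bigr => w _.
rewrite !rmorphM /= rmorph_sign -mulrA; congr (_ * _).
have mX i : map_mpoly at0 ('X_i : R) = 'X_i by exact: map_mpolyX.
rewrite !rmorph_prod /= -big_split /= (mpolyXE _ w); apply: eq_bigr => i _.
rewrite mnmE permK /muD exprD rmorphXn /= mX; congr (_ * _).
rewrite rmorph_prod /= (eq_bigr (fun=> 'X_(w i))); last first.
  move=> j _; rewrite rmorphB rmorphM /= !mX map_mpolyC /= /at0 horner_evalE hornerX.
  by rewrite mpolyC0 mul0r subr0.
rewrite prodr_const; congr (_ ^+ _).
have -> : #|[pred j : 'I_N | (i < j)%N]| = (N - i.+1)%N.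
  by rewrite -sum1_card -(big_geq_mkord i.+1 N xpredT (fun=>
      1%N)) sum_nat_const_nat muln1.
by [].
Qed.

Lemma muD_lt mu (i j : 'I_N) : sorted geq mu -> (i < j)%N -> (muD mu j < muD mu i)%N.
Proof.
move=> so ij; rewrite /muD.
have le : (nth 0 mu j <= nth 0 mu i)%N.
  case: (ltnP j (size mu)) => hj; last by rewrite nth_default.
  apply: (sorted_ltn_nth (leT := geq)) => //; last by rewrite inE (ltn_trans ij).
  exact: rev_trans leq_trans.
by have := ltn_ord j; lia.
Qed.

(** Both sequences are strictly decreasing, so one being a rearrangement of the other makes them
    equal. *)
Lemma muD_perm mu nu (w : 'S_N) : is_partition_of N mu -> is_partition_of N nu ->
  (forall i, muD mu (w i) = muD nu i) -> w = 1%g /\ mu = nu.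
Proof.
move=> hmu hnu e.
have [so m0 _] := and3P hmu; have [so' n0 _] := and3P hnu.
pose s f := [seq f i | i <- enum 'I_N] : seq nat.
have srt la : sorted geq la -> sorted gtn (s (muD la)).
  move=> sla; rewrite sorted_map.
  have : sorted ltn (map val (enum 'I_N)) by rewrite val_enum_ord iota_ltn_sorted.
  rewrite sorted_map; apply: sub_sorted => i j /=; exact: muD_lt.
have E : s (muD mu) = s (muD nu).
  apply: (irr_sorted_eq (rev_trans ltn_trans) ltnn); rewrite ?srt //.
  move=> v; apply/mapP/mapP => -[i _ ->].
    by exists ((w^-1)%g i); rewrite ?mem_enum // -e permKV.
  by exists (w i); rewrite ?mem_enum // e.
have sE f (j : 'I_N) : nth 0%N (s f) j = f j.
  by rewrite (nth_map j) ?size_enum_ord // nth_ord_enum.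
have Ei i : muD mu i = muD nu i by rewrite -(sE (muD mu)) -(sE (muD nu)) E.
have inj : injective (muD mu).
  move=> i j h; apply: val_inj; case: (ltngtP i j) => // lt;
  by have := muD_lt so lt; rewrite h ltnn.
split.
  by apply/permP => i; apply: inj; rewrite perm1 e Ei.
have sz la : is_partition_of N la -> la = filter (ltn 0%N) (mkseq (nth 0%N la) N).
  move=> hla; have [_ la0 _] := and3P hla; rewrite -{1}(filter_pad N la0).
  congr filter; apply: (@eq_from_nth _ 0%N).
    by rewrite size_mkseq size_cat size_nseq subnKC // partition_size_le.
  move=> i; rewrite size_cat size_nseq subnKC ?partition_size_le // => hi.
  rewrite nth_mkseq // nth_cat; case: ltnP => // h.
  by rewrite nth_nseq if_same nth_default.
rewrite (sz mu hmu) (sz nu hnu); congr filter; apply/eq_in_map => i.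
rewrite mem_iota add0n => /andP[_ hi]; have := Ei (Ordinal hi).
by rewrite /muD /= => /addIn.
Qed.

Lemma hlNum_coef0 mu nu : is_partition_of N mu -> is_partition_of N nu ->
  at0 ((hlNum mu)@_(mon_muD nu)) = (mu == nu)%:R.
Proof.
move=> hmu hnu; transitivity ((map_mpoly at0 (hlNum mu))@_(mon_muD nu)).
  by rewrite mcoeff_map_mpoly.
rewrite map_hlNum raddf_sum /=.
rewrite (bigD1 1%g) //= big1 ?addr0.
  rewrite odd_perm1 expr0 mul1r mcoeffX; congr (nat_of_bool _)%:R.
  apply/eqP/eqP => [/mnmP e|<-].
    have [|//] := @muD_perm mu nu 1%g hmu hnu.
    by move=> i; have := e i; rewrite !mnmE invg1 perm1.
  by apply/mnmP => i; rewrite !mnmE invg1 perm1.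
move=> w w1; rewrite -signr_odd.
have -> : ((-1) ^+ odd w * 'X_[[multinom muD mu ((w^-1)%g i) | i < N]] :
    {mpoly int[N]})@_(mon_muD nu)
   = (-1) ^+ odd w * ('X_[[multinom muD mu ((w^-1)%g i) | i < N]] :
       {mpoly int[N]})@_(mon_muD nu).
  by case: (odd w); rewrite ?expr1 ?expr0 ?mul1r // !mulN1r mcoeffN.
rewrite mcoeffX; case: eqP => [/mnmP e|_]; last by rewrite mulr0.
have [|h _] := @muD_perm mu nu (w^-1)%g hmu hnu.
  by move=> i; have := e i; rewrite !mnmE.
by move: w1; rewrite -(invgK w) h invg1 eqxx.
Qed.

(** After clearing denominators a relation becomes a vector in the left kernel of a square matrix
    over Z[t], formed by the coefficients of the numerators at the exponents nu + delta; its
    determinant is 1 at t = 0. *)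
Lemma hall_littlewood_free (D : seq nat -> {poly int}) :
  \sum_(mu <- partitions N) tofrac (D mu)%:MP * hall_littlewood mu x t = 0 ->
  {in partitions N, forall mu, D mu = 0}.
Proof.
move=> h0; pose p := size (partitions N).
pose pt (i : 'I_p) := nth [::] (partitions N) i.
have ptP i : is_partition_of N (pt i) by rewrite -mem_partitions mem_nth.
(* Each numerator carries its own v_mu; multiplying by those of the other partitions gives all terms
   a common factor. *)
pose D' i := D (pt i) * \prod_(j < p | j != i) hlV (pt j).
have E : \sum_(i < p) (D' i)%:MP * hlNum (pt i) = 0 :> R.
  apply/eqP; rewrite -tofrac_eq0 rmorph_sum /=.
  rewrite (eq_bigr (fun i => tofrac vand * tofrac (\prod_(j < p) hlV (pt j))%:MP *
     (tofrac (D (pt i))%:MP * hall_littlewood (pt i) x t))); last first.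
    move=> i _; rewrite tofracM -hall_littlewood_frac /D' [in RHS](bigD1 i) //=
        !mpolyCM !tofracM.
    exact: mulrACA3.
  rewrite -big_distrr /= -(big_mkord xpredT (fun i =>
      tofrac (D (nth [::] (partitions N) i))%:MP *
     hall_littlewood (nth [::] (partitions N) i) x t)) -(big_nth [::] xpredT (fun mu
         => tofrac (D mu)%:MP *
     hall_littlewood mu x t)) h0 mulr0 //.
pose M : 'M[{poly int}]_p := \matrix_(i, j) (hlNum (pt i))@_(mon_muD (pt j)).
pose v : 'rV[{poly int}]_p := \row_i D' i.
have vM : v *m M = 0.
  apply/rowP => j; rewrite !mxE.
  transitivity ((\sum_(i < p) (D' i)%:MP * hlNum (pt i) : R)@_(mon_muD (pt j)));
      last first.
    by rewrite E mcoeff0.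
  by rewrite raddf_sum; apply: eq_bigr => i _; rewrite !mxE /= mcoeffCM.
(* At [t = 0] the numerators are the alternants, whose leading exponents are
   pairwise distinct. *)
have M0 : map_mx at0 M = 1%:M.
  apply/matrixP => i j; rewrite !mxE hlNum_coef0 // nth_uniq ?partitions_uniq //.
have dM : \det M != 0.
  apply/eqP => d; have e : \det (map_mx at0 M) = at0 (\det M) by exact: det_map_mx.
  by move/eqP: e; rewrite M0 det1 d /at0 horner_evalE horner0 oner_eq0.
have v0 : v = 0.
  have := congr1 (fun u => u *m \adj M) vM; rewrite -mulmxA mul_mx_adj mul0mx.
  rewrite mul_mx_scalar => /rowP e; apply/rowP => i.
  by have := e i; rewrite !mxE => /eqP; rewrite mulf_eq0 (negbTE dM) => /eqP.
move=> mu hmu; have hi : (index mu (partitions N) < p)%N by rewrite index_mem.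
have := congr1 (fun u : 'rV__ => u 0 (Ordinal hi)) v0;
    rewrite !mxE /D' /pt /= nth_index //.
move/eqP; rewrite mulf_eq0 => /orP[/eqP //|/prodf_eq0[j _]].
by rewrite (negbTE (hlV_neq0 _)).
Qed.

End Unique.

(** * Kostka-Foulkes polynomials of hooks *)

Definition kf_hook (m : nat) (mu : seq nat) : {poly int} :=
  'X^(kf_exp m mu) * gaussq 'X (size mu).-1 m.

(** Exhibiting [kf_hook] as a solution of the expansion makes the choice by [epsilon] a solution
    too, and linear independence identifies the two on partitions of [N]. *)
Lemma kostka_foulkes_hook (N m : nat) (mu : seq nat) : (m < N)%N ->
  is_partition_of N mu -> kostka_foulkes (hook N m) mu = kf_hook m mu.
Proof.
move=> ltmN hmu.
have sN : sumn (hook N m) = N by rewrite /= sumn_nseq mul1n subnK // ltnW.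
have spec : kostka_foulkes_spec (hook N m) (kf_hook m).
  rewrite /kostka_foulkes_spec sN.
  rewrite (schur_hook_hall_littlewood (@frac_var_inj N) (@frac_var_neq0 N)
      (@frac_t_nroot N) (frac_t_neq0 N) ltmN).
  apply: eq_bigr => nu _; congr (_ * _); rewrite /kf_hook !rmorphM /= !rmorphXn /=.
  congr (_ * _).
  by rewrite (rmorph_gaussq (mpolyC N (R := {poly int}))) (rmorph_gaussq (@tofrac
      {mpoly {poly int}[N]})).
have : kostka_foulkes_spec (hook N m) (kostka_foulkes (hook N m)).
  exact: (epsilon_spec _ (kostka_foulkes_spec (hook N m)) (ex_intro _ _ spec)).
move: (kostka_foulkes (hook N m)) => K; move: spec.
rewrite /kostka_foulkes_spec sN => -> e.
have /(_ _ mu) H := @hall_littlewood_free N (fun nu => kf_hook m nu - K nu).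
apply/esym/eqP; rewrite -subr_eq0; apply/eqP; apply: H; last by rewrite mem_partitions.
under eq_bigr => nu _ do rewrite mpolyCB tofracB mulrBl.
by rewrite sumrB e subrr.
Qed.

(** * Sums over compositions *)

Lemma size_pad n mu : (size mu <= n)%N -> size (pad n mu) = n.
Proof. by move=> h; rewrite size_cat size_nseq subnKC. Qed.

Lemma nth_pad n mu i : nth 0%N (pad n mu) i = nth 0%N mu i.
Proof.
rewrite nth_cat; case: ltnP => // h.
by rewrite nth_nseq if_same nth_default.
Qed.

Lemma geq_trans : transitive geq. Proof. exact: rev_trans leq_trans. Qed.
Lemma geq_anti : antisymmetric geq.
Proof. by move=> a b h; apply: anti_leq; rewrite andbC. Qed.
Lemma geq_total : total geq. Proof. by move=> a b; exact: leq_total. Qed.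

Definition part_of (a : seq nat) := sort geq (filter (ltn 0%N) a).

Lemma part_ofP n N (a mu : seq nat) : size a = n -> is_partition_of N mu ->
  (part_of a == mu) && (size mu <= n)%N = perm_eq a (pad n mu).
Proof.
move=> sa /and3P[so mu0 _]; apply/andP/idP => [[/eqP e h]|e].
  rewrite -(perm_filterC (ltn 0%N)) perm_sym /pad; apply: perm_cat.
    by rewrite -e perm_sort.
  have -> : [seq x <- a | predC (ltn 0%N) x] = nseq (count (predC (ltn 0%N)) a) 0%N.
    rewrite -size_filter; apply/all_pred1P/allP => v; rewrite mem_filter => /andP[h1 _].
    by move: h1 => /=; lia.
  have := count_predC (ltn 0%N) a; rewrite sa -size_filter.
  have -> : size [seq x <- a | ltn 0%N x] = size mu by rewrite -e size_sort.
  by move=> <-; rewrite addKn.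
have mun : (size mu <= n)%N.
  rewrite -sa (perm_size e) size_cat; exact: leq_addr.
split=> //; apply/eqP; rewrite /part_of -[RHS](filter_pad n mu0).
apply: (sorted_eq geq_trans geq_anti).
- exact: (sort_sorted geq_total).
- by rewrite filter_pad.
- by rewrite perm_sort perm_filter.
Qed.

Lemma part_of_partition N (a : seq nat) : sumn a = N -> is_partition_of N (part_of a).
Proof.
move=> suma; apply/and3P; split.
- exact: (sort_sorted geq_total).
- by rewrite mem_sort mem_filter.
- rewrite (perm_sumn (permEl (perm_sort _ _))) -suma; apply/eqP.
  by elim: a {suma} => //= v s IHs; case: (posnP v) => [->|v0] /=; rewrite IHs.
Qed.

(** Compositions are grouped by the partition obtained by sorting their nonzero entries. *)
Lemma sum_compositions (V : nmodType) n N (phi : seq nat -> V) :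
  \sum_(al : {ffun 'I_n -> 'I_N.+1} | asize al == N) phi (aseq al) =
  \sum_(mu <- partitions N | (size mu <= n)%N) \sum_(a <- permutations (pad n mu)) phi a.
Proof.
transitivity (\sum_(al : {ffun 'I_n -> 'I_N.+1} | asize al == N)
   \sum_(mu <- partitions N | part_of (aseq al) == mu) phi (aseq al)).
  apply: eq_bigr => al /eqP hal; have h := part_of_partition (sumn_aseq al).
  rewrite hal in h; rewrite big_mkcond (bigD1_seq (part_of (aseq al)))
      ?partitions_uniq ?mem_partitions //=.
  rewrite eqxx big1 ?addr0 // => mu; rewrite eq_sym => /negbTE -> //.
rewrite (exchange_big_dep xpredT) //= [RHS]big_mkcond big_seq [RHS]big_seq; apply:
    eq_bigr => mu.
rewrite mem_partitions => hmu; have [_ _ /eqP smu] := and3P hmu.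
case: ifP => h; last first.
  rewrite big1 // => al /andP[_ /eqP e].
  by move: h; rewrite -e size_sort size_filter (leq_trans (count_size _ _)) // size_aseq.
rewrite -big_filter -(big_map (@aseq n N) xpredT phi); apply: perm_big; apply: uniq_perm.
- by rewrite (map_inj_uniq (@aseq_inj n N)) filter_uniq // index_enum_uniq.
- exact: permutations_uniq.
move=> a; rewrite mem_permutations; apply/mapP/idP => [[al]|pa].
  rewrite mem_filter => /andP[/andP[_ e] _] ->.
  by rewrite -(part_ofP (size_aseq al) hmu) e h.
have sa : size a = n by rewrite (perm_size pa) size_pad.
have suma : sumn a = N by rewrite (perm_sumn pa) sumn_pad.
have la (i : nat) : (nth 0 a i < N.+1)%N.
  rewrite ltnS -suma; case: (ltnP i (size a)) => hi; last by rewrite nth_default.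
  by rewrite (perm_sumn (perm_to_rem (mem_nth 0%N hi))) /= leq_addr.
pose al : {ffun 'I_n -> 'I_N.+1} := [ffun i => inord (nth 0%N a (val i))].
have e : aseq al = a.
  apply: (@eq_from_nth _ 0%N); rewrite size_aseq ?sa // => i hi.
  by rewrite -[i]/(val (Ordinal hi)) nth_aseq ffunE inordK.
exists al => //; rewrite mem_filter mem_index_enum -sumn_aseq e suma eqxx andbT /=.
by have := part_ofP sa hmu; rewrite pa => /andP[].
Qed.

Lemma kappa_rcons a z : kappa (rcons a z) = (kappa a + size a * z)%N.
Proof.
rewrite /kappa size_rcons big_ord_recr /= nth_rcons ltnn eqxx; congr (_ + _)%N.
by apply: eq_bigr => i _; rewrite nth_rcons ltn_ord.
Qed.

Lemma kappa_cons a z : kappa (z :: a) = (kappa a + sumn a)%N.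
Proof.
rewrite /kappa [size _]/= big_ord_recl mul0n add0n sumnE (big_nth 0%N) big_mkord.
rewrite -big_split /=; apply: eq_bigr => i _.
by rewrite /bump /= add1n mulSn addnC.
Qed.

(** Moving the last entry to the front changes [kappa] by the sum minus the length times that entry;
    for a root of unity whose order divides the length only the sum counts. *)
Lemma kappa_rotr a : (kappa (rotr 1 a) + size a * last 0%N a = kappa a + sumn a)%N.
Proof.
case/lastP: a => [|a z]; first by [].
by rewrite rotr1_rcons kappa_cons kappa_rcons last_rcons size_rcons sumn_rcons; lia.
Qed.

(** The nonzero entries occupy distinct places, so their weights are at least 0, 1, 2, and so on.
    This controls the power of [q] that is divided out. *)
Lemma bin2_count_le_kappa a : ('C(count (ltn 0%N) a, 2) <= kappa a)%N.
Proof.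
elim/last_ind: a => [|a z IHa]; first by [].
rewrite kappa_rcons -cats1 count_cat /= addn0; case: (posnP z) => [->|z0].
  by rewrite addn0 (leq_trans IHa) // leq_addr.
rewrite addn1 binS bin1 leq_add // (leq_trans (count_size (ltn 0%N) a)) // leq_pmulr //.
Qed.

Lemma kappa_hook N m : kappa (hook N m) = 'C(m.+1, 2).
Proof.
rewrite /hook kappa_cons sumn_nseq mul1n -bin2_sum big_nat_recr //= big_mkord;
    congr (_ + _)%N.
by rewrite /kappa size_nseq; apply: eq_bigr => i _; rewrite nth_nseq ltn_ord muln1.
Qed.

(* Rotating a multiplies the term of a by [z ^+ N <> 1]. *)
Lemma sum_permutations_root (R : idomainType) (z : R) n N mu : (0 < n)%N ->
  (size mu <= n)%N -> sumn mu = N -> z ^+ n = 1 -> z ^+ N != 1 ->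
  \sum_(a <- permutations (pad n mu)) z ^+ kappa a = 0.
Proof.
move=> n0 hs hN zn zN; set Z := \sum_(a <- _) _.
have hp : perm_eq [seq rotr 1 a | a <- permutations (pad n mu)] (permutations (pad n mu)).
  apply: uniq_perm.
  - by rewrite (map_inj_uniq (@rotr_inj 1 _)) permutations_uniq.
  - exact: permutations_uniq.
  move=> a; rewrite mem_permutations; apply/mapP/idP => [[b]|pa].
    by rewrite mem_permutations => pb ->; rewrite perm_rotr.
  by exists (rot 1 a); rewrite ?rotK // mem_permutations perm_rot.
have e : Z = z ^+ N * Z.
  rewrite {1}/Z -(perm_big _ hp) big_map big_distrr /= big_seq [RHS]big_seq.
  apply: eq_bigr => a; rewrite mem_permutations => pa.
  have sa : size a = n by rewrite (perm_size pa) size_pad.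
  have suma : sumn a = N by rewrite (perm_sumn pa) sumn_pad.
  have := congr1 (fun k => z ^+ k) (kappa_rotr a).
  by rewrite !exprD sa suma exprM zn expr1n mulr1 mulrC.
apply/eqP; have /eqP : (1 - z ^+ N) * Z = 0 by rewrite mulrBl mul1r -e subrr.
by rewrite mulf_eq0 subr_eq0 eq_sym (negbTE zN).
Qed.

(** * Orders of the powers of promotion *)

Section Orders.
Variables (n N m : nat).
Hypotheses (ltmN : (m < N)%N) (n_gt0 : (0 < n)%N).
Local Notation la := (hook N m).
Local Notation prn := (prn n N m).

Lemma SST_contentE (mu : seq nat) (T : SST n la) : (size mu <= n)%N ->
  (T \in SST_content n la mu) = (cont T == pad n mu).
Proof.
move=> h; rewrite inE; apply/forallP/eqP => [e|e k].
  apply: (@eq_from_nth _ 0%N); rewrite size_cont ?size_pad // => i hi.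
  by rewrite nth_mkseq // nth_pad; apply/eqP; exact: (e (Ordinal hi)).
by rewrite -(nth_pad n) -e nth_mkseq.
Qed.

Lemma count_pad k (mu : seq nat) : 0%N \notin mu -> count (ltn 0%N) (pad k mu) = size mu.
Proof. by move=> h; rewrite -size_filter filter_pad. Qed.

Lemma SST_content_neq0 mu : is_partition_of N mu -> (size mu <= n)%N ->
  SST_content n la mu != set0 -> (m <= (size mu).-1)%N.
Proof.
case/and3P=> _ mu0 _ h /set0Pn[T]; rewrite SST_contentE // => /eqP e.
by rewrite -(count_bits ltmN T) -(count_pad n mu0) -e -(size_bits T) count_size.
Qed.

Lemma ord_prn_content_dvd mu j : (size mu <= n)%N ->
  reflect (forall T : SST n la, cont T = pad n mu -> iter j (rot 1) (bits T) = bits T)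
    (ord_prn_content n la mu %| j)%N.
Proof.
move=> h; set S := SST_content n la mu.
(* [restr_perm] is the restriction only for permutations that stabilize [S]; here the content is
   preserved. *)
have nS : prn \in ('N(S | 'P))%g.
  apply/astabsP => T; rewrite /= apermE !SST_contentE //.
  by have [-> _] := prn_code ltmN n_gt0 T.
have rE T : T \in S -> ((restr_perm S prn ^+ j)%g T) = (prn ^+ j)%g T.
  move=> TS; rewrite -morphX // restr_permE //; exact: groupX.
rewrite /ord_prn_content order_dvdn; apply: (iffP eqP) => [e T eT|e].
  apply/eqP; rewrite -(prnX_fix ltmN n_gt0) -rE ?e ?perm1 //.
  by rewrite SST_contentE // eT.
apply/permP => T; rewrite perm1; case: (boolP (T \in S)) => hT.
  rewrite rE //; apply/eqP; rewrite prnX_fix //; apply/eqP/e/eqP.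
  by rewrite -SST_contentE.
have H : perm_on S (restr_perm S prn ^+ j)%g.
  by rewrite -morphX //; exact: restr_perm_on.
by rewrite (out_perm H).
Qed.

(** A nonempty block of ones followed by a nonempty block of zeros is fixed only by rotations that
    are multiples of its length. *)
Lemma ord_prn_content_hook mu : is_partition_of N mu -> (size mu <= n)%N ->
  (0 < m < (size mu).-1)%N -> ord_prn_content n la mu = (size mu).-1.
Proof.
move=> hmu h /andP[m0 mr]; have [_ mu0 /eqP smu] := and3P hmu.
set r := (size mu).-1 in mr *.
have key j : (ord_prn_content n la mu %| j)%N = (r %| j)%N.
  apply/(ord_prn_content_dvd j h)/idP => [H|/dvdnP[k ->] T eT]; last first.
    have sb : size (bits T) = r by rewrite size_bits eT count_pad.
    elim: k => [|k IHk] //; rewrite mulSn addnC iterD -{2}sb.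
    by rewrite iter_rot_size.
  have [T [ec eb]] : exists T : SST n la,
     cont T = pad n mu /\ bits T = nseq m true ++ nseq (r - m) false.
    apply: code_surj => //; rewrite ?size_pad ?sumn_pad //.
      by rewrite count_pad // size_cat !size_nseq subnKC // ltnW.
    by rewrite count_cat !count_nseq /= mul0n addn0 mul1n.
  have := H T ec; rewrite eb; set b := _ ++ _ => e.
  have sb : size b = r by rewrite size_cat !size_nseq subnKC // ltnW.
  have bE i : nth false b i = (i < m)%N.
    rewrite nth_cat size_nseq !nth_nseq; case: ltnP => //; by rewrite if_same.
  have r0 : (0 < r)%N by exact: leq_ltn_trans mr.
  rewrite /dvdn; have lt : (j %% r < r)%N by rewrite ltn_mod.
  case: (posnP (j %% r)) => // j0.
  (* The place m - (j mod r), truncated at 0, holds a one; the rotation brings there the bit of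
     place max(m, j mod r), which is a zero. *)
  have i0 : (m - j %% r < r)%N by clear -mr; lia.
  have := congr1 (fun s => nth false s (m - j %% r)) e.
  rewrite nth_iter_rot sb // !bE -modnDmr modn_small; last by clear -mr lt; lia.
  by clear -m0 j0; lia.
by apply/eqP; rewrite eqn_dvd key dvdnn -key dvdnn.
Qed.

Lemma ord_prn_content_dvd_ord mu : (size mu <= n)%N ->
  (ord_prn_content n la mu %| ord_prn n la)%N.
Proof.
move=> h; apply/ord_prn_content_dvd => // T _; apply/eqP.
by rewrite -(prnX_fix ltmN n_gt0) /ord_prn expg_order perm1.
Qed.

(** For 0 < m < r one has d_mu = r, and the j-th power of the root is 1 exactly when d divides l j d
    / r, that is when r divides l j, as [csp_rotfix] requires. For m = 0 and m = r the Gaussian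
    binomial is 1 at every root, and every rotation fixes the only vector. *)
Lemma card_rotfix_gaussq (omega : nat -> algC) mu l :
  (forall d : nat, (0 < d)%N -> d.-primitive_root (omega d)) ->
  is_partition_of N mu -> (size mu <= n)%N -> (m <= (size mu).-1)%N ->
  #|rotfix m (size mu).-1 l|%:R =
  gaussq (omega #[prn ^+ l]%g ^+ (ord_prn n la %/ ord_prn_content n la mu))
    (size mu).-1 m.
Proof.
move=> homega hmu h mr; set r := (size mu).-1 in mr *; set z := _ ^+ _.
have prim := homega _ (order_gt0 (prn ^+ l)%g).
have sing : (m == 0%N) || (m == r) -> #|rotfix m r l|%:R = gaussq z r m.
  case: (posnP r) => [r0|r0].
    move=> _; have -> : m = 0%N by clear -mr r0; lia.
    rewrite r0 /= (_ : rotfix 0 0 l = [set b : 0.-tuple bool | count id b == 0%N]).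
      by rewrite card_count_tuple.
    apply/setP => b; rewrite !inE; apply: andb_idr => _.
    by rewrite tuple0 /=; apply/eqP; apply: size0nil; rewrite size_iter_rot.
  have g0 : (0 < gcdn l r)%N by rewrite gcdn_gt0 r0 orbT.
  have gr : (gcdn l r %| r)%N by exact: dvdn_gcdr.
  rewrite card_rotfix // => /orP[/eqP->|/eqP->].
    by rewrite dvdn0 div0n bin0 gaussq0.
  have [-> ->] : (r %/ gcdn l r %| r)%N /\ (r %/ (r %/ gcdn l r) = gcdn l r)%N.
    have [k e] := dvdnP gr; move: r0 g0; move: (gcdn l r) e => g ->.
    rewrite muln_gt0 => /andP[k0 _] g0; rewrite mulnK // mulKn //.
    by rewrite dvdn_mulr.
  by rewrite binn gaussq_diag.
case: (boolP ((m == 0%N) || (m == r))) => [/sing //|/norP[m0 mr']].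
have hm : (0 < m < r)%N by clear -mr m0 mr'; lia.
have r0 : (0 < r)%N by clear -hm; lia.
have dr : ord_prn_content n la mu = r by exact: ord_prn_content_hook.
have rd : (r %| ord_prn n la)%N by rewrite -dr ord_prn_content_dvd_ord.
set d := ord_prn n la in rd *.
have d0 : (0 < d)%N by exact: order_gt0.
rewrite /z dr; apply: csp_rotfix => // j.
rewrite -exprM -(prim_order_dvd prim) order_dvdn -expgM -order_dvdn -/(ord_prn n la) -/d.
rewrite mulnCA -{1}(divnK rd) mulnC [(_ * (l * j))%N]mulnC dvdn_pmul2r //.
by rewrite divn_gt0 // dvdn_leq.
Qed.

End Orders.

(** * The sieving polynomial *)

Lemma expz_mulKf (F : fieldType) (t g : F) e k : t != 0 ->
  t ^ (- (e%:Z * k%:Z)) * ((t ^+ e) ^+ k * g) = g.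
Proof.
by move=> t0; rewrite -PoszM -invr_expz -exprM mulKf // expf_neq0.
Qed.

Lemma expf_subn (F : fieldType) (q : F) k l : q != 0 -> (k <= l)%N ->
  q ^- k * q ^+ l = q ^+ (l - k).
Proof. by move=> q0 h; rewrite -{1}(subnKC h) exprD mulKf // expf_neq0. Qed.

Section SievingPoly.
Variables (n N m : nat).
Hypotheses (ltmN : (m < N)%N) (n_gt0 : (0 < n)%N).
Local Notation la := (hook N m).

Definition contributes (mu :
    seq nat) := (size mu <= n)%N && (SST_content n la mu != set0).
Definition order_ratio mu := (ord_prn n la %/ ord_prn_content n la mu)%N.

(** [S_hook] with the powers of [t] cancelled and q^(-kappa(la)) distributed over the monomials, so
    that nonnegative integral coefficients become visible. *)
Definition sieving_poly : {poly {poly int}} :=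
  \sum_(mu <- partitions N | contributes mu)
    (gaussq 'X^(order_ratio mu) (size mu).-1 m)%:P *
    \sum_(a <- permutations (pad n mu)) 'X^(kappa a - kappa la).

(** At least m + 1 entries are nonzero and kappa(la) = C(m + 1, 2); hence the subtraction in
    [sieving_poly] is exact. *)
Lemma kappa_hook_le mu a : is_partition_of N mu -> (size mu <= n)%N ->
    (m <= (size mu).-1)%N ->
  perm_eq a (pad n mu) -> (kappa la <= kappa a)%N.
Proof.
move=> /and3P[_ mu0 /eqP smu] h hm pa; apply: leq_trans (bin2_count_le_kappa a).
have -> : count (ltn 0%N) a = size mu by rewrite (seq.permP pa) count_pad.
rewrite kappa_hook leq_bin2l //.
have : (0 < size mu)%N by case: (mu) smu => //= e; move: ltmN; rewrite -e.
by move: hm; case: (size mu).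
Qed.

(** With l parts and m < l, [kf_exp m mu] is kappa(mu) - m l + m(m + 1)/2; thus t^A_mu cancels
    exactly the power of [t] in K. *)
Lemma A_exp_hook mu : is_partition_of N mu -> (m <= (size mu).-1)%N ->
  A_exp n N m mu = - ((order_ratio mu)%:Z * (kf_exp m mu)%:Z).
Proof.
move=> hmu hm; have [_ mu0 /eqP smu] := and3P hmu.
rewrite /A_exp -/(order_ratio mu) -mulrN; congr (_ * _).
have -> : conj_part mu 1 = size mu.
  by rewrite -(count_pad 0 mu0) /pad cats0.
have : (0 < size mu)%N by case: (mu) smu => //= e; move: ltmN; rewrite -e.
have kle := bin2_le_kappa mu0.
rewrite /kf_exp; move: (kappa mu) hm kle => k.
case: (size mu) => // r /= hm kle _.
have [s er] : exists s, r = (m + s)%N by exists (r - m)%N; rewrite subnKC.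
have e1 : 'C(r.+1, 2) = ('C(m, 2) + ('C(s, 2) + s) + (m * s + m))%N.
  by rewrite er -addnS bin2D binS bin1 mulnS [(m + m * s)%N]addnC.
have e2 : (m * m.+1 %/ 2 = 'C(m, 2) + m)%N.
  by rewrite mulnC divn2 -[X in (_ * X)./2]/(m.+1.-1) -bin2 binS bin1.
have e3 : (m * m = 'C(m, 2) + 'C(m, 2) + m)%N.
  by clear; elim: m => // k IHk; rewrite binS bin1; lia.
rewrite e1 in kle *; rewrite e2 er addKn; move: e3 kle.
rewrite -addnS; clear; move: 'C(m, 2) 'C(s, 2) => u v e3 kle.
have e4 : (m * (m + s.+1) = u + u + m + m * s + m)%N by lia.
lia.
Qed.

Lemma horner_kf_hook (R : comNzRingType) (u : R) mu :
  (map_poly intr (kf_hook m mu)).[u] = u ^+ kf_exp m mu * gaussq u (size mu).-1 m.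
Proof.
rewrite /kf_hook rmorphM /= hornerM map_polyXn hornerXn; congr (_ * _).
rewrite (rmorph_gaussq (map_poly (intr : int -> R))) /= map_polyX.
have := rmorph_gaussq (horner_eval u) ('X : {poly R}) (size mu).-1 m.
by rewrite /= !horner_evalE hornerX.
Qed.

Lemma prod_exp_kappa (R : comNzRingType) (q : R) a : size a = n ->
  \prod_(i < n) (q ^+ i) ^+ nth 0%N a i = q ^+ kappa a.
Proof.
by move=> <-; rewrite /kappa expr_sum; apply: eq_bigr => i _; rewrite exprM.
Qed.

Lemma sieving_poly_frac : tofrac sieving_poly = S_hook n N m.
Proof.
rewrite /sieving_poly /S_hook rmorph_sum /= big_distrr /= big_seq_cond [RHS]big_seq_cond.
apply: eq_bigr => mu /andP[]; rewrite mem_partitions => hmu /andP[hn h0].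
have hm := SST_content_neq0 ltmN hmu hn h0.
rewrite kostka_foulkes_hook // A_exp_hook // -/(order_ratio mu) /monomial_sym hn
    horner_kf_hook.
set q := tofrac 'X; set t := tofrac 'Y; set e := order_ratio mu; set k := kf_exp m mu.
have q0 : q != 0 by rewrite tofrac_eq0 polyX_eq0.
have t0 : t != 0 by rewrite tofrac_eq0 polyC_eq0 polyX_eq0.
have -> : t ^ (- (e%:Z * k%:Z)) * ((t ^+ e) ^+ k * gaussq (t ^+ e) (size mu).-1 m) =
   gaussq (t ^+ e) (size mu).-1 m.
  exact: expz_mulKf.
have -> : gaussq (t ^+ e) (size mu).-1 m = tofrac (gaussq 'X^e (size mu).-1 m)%:P.
  rewrite (rmorph_gaussq (@polyC {poly int})) (rmorph_gaussq (@tofrac {poly {poly int}})).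
  by rewrite !rmorphXn.
rewrite tofracM mulrCA; congr (_ * _); rewrite rmorph_sum /= big_distrr /=.
rewrite big_seq [RHS]big_seq; apply: eq_bigr => a; rewrite mem_permutations => pa.
rewrite prod_exp_kappa; last by rewrite (perm_size pa) size_pad.
rewrite tofracXn -/q (expf_subn q0 (kappa_hook_le hmu hn hm pa)).
reflexivity.
Qed.

Lemma sieving_poly_ge0 i j : (0 <= sieving_poly`_i`_j)%R.
Proof.
rewrite /sieving_poly !coef_sum; apply: Num.Theory.sumr_ge0 => mu _.
rewrite coefCM coef_sum.
have -> : \sum_(a <- permutations (pad n mu)) ('X^(kappa a - kappa la) :
    {poly {poly int}})`_i =
    (\sum_(a <- permutations (pad n mu)) (i == kappa a - kappa la)%N : nat)%:R.
  by rewrite natr_sum; apply: eq_bigr => a _; rewrite coefXn.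
by rewrite mulr_natr coefMn Num.Theory.mulrn_wge0 // gaussq_Xn_ge0.
Qed.

Lemma eval_sieving_poly (a b : algC) : eval_qt sieving_poly a b =
  \sum_(mu <- partitions N | contributes mu) gaussq (b ^+ order_ratio mu) (size mu).-1 m *
    \sum_(s <- permutations (pad n mu)) a ^+ (kappa s - kappa la).
Proof.
rewrite /eval_qt /sieving_poly rmorph_sum /= !horner_sum; apply: eq_bigr => mu _.
rewrite rmorphM /= !hornerM; congr (_ * _).
  rewrite map_polyC /= hornerC (rmorph_gaussq (map_poly (intr : int -> algC))) /=.
  rewrite map_polyXn.
  have := rmorph_gaussq (horner_eval b) ('X^(order_ratio mu) :
      {poly algC}) (size mu).-1 m.
  by rewrite /= !horner_evalE hornerXn.
rewrite rmorph_sum /= !horner_sum; apply: eq_bigr => s _.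
by rewrite map_polyXn hornerXn -rmorphXn /= hornerC.
Qed.

End SievingPoly.

(** * Bicyclic sieving on hook tableaux *)

Theorem theorem4p10 (n N m : nat) (omega : nat -> algC) :
  (forall d : nat, (0 < d)%N -> d.-primitive_root (omega d)) ->
  (2 <= n)%N -> (m < N)%N -> (m.+1 < n)%N -> coprime n N ->
  #|<[coxeter n (hook N m)]>%g| = n /\
  exists f : {poly {poly int}},
    tofrac f = S_hook n N m /\
    bicyclic_sieving omega
      <[coxeter n (hook N m)]>%G 'P
      <[promotion n (hook N m) ^+ n]>%G 'P
      f.
Proof.
move=> homega n2 ltmN ltmn cop.
have n0 : (0 < n)%N by exact: ltnW.
have ordC : #[coxeter n (hook N m)]%g = n by apply: order_coxeter => //; exact: ltnW.
split; first exact: ordC.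
exists (sieving_poly n N m); split; first exact: sieving_poly_frac.
split; [exact: cycle_cyclic | exact: cycle_cyclic | | exact: sieving_poly_ge0 |].
  move=> g g' /cycleP[j ->] /cycleP[l ->] T; rewrite /= !apermE.
  exact: (coxeter_prn_comm ltmN n0).
move=> g g' /cycleP[j ->] /cycleP[l ->]; rewrite -/(prn n N m).
set C := coxeter n (hook N m) in ordC *; set P := prn n N m.
rewrite eval_sieving_poly.
(* As the Coxeter element has order [n], this separates its trivial powers from those that leave no
   content fixed. *)
have [jn|jn] := boolP (n %| j)%N.
  have Cj : (C ^+ j = 1)%g by apply/eqP; rewrite -order_dvdn ordC.
  rewrite Cj order1.
  have -> : omega 1%N = 1 by have /prim_expr_order := homega 1%N isT; rewrite expr1.
  have -> : [set x : SST n (hook N m) | ('P%act (('P%act x (P ^+ l)%g)) 1%g) == x] =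
     [set T | (P ^+ l)%g T == T].
    by apply/setP => T; rewrite !inE /= !apermE perm1.
  transitivity (\sum_(T | (P ^+ l)%g T == T) (1 : algC)).
    by rewrite sumr_const; congr (_%:R); apply: eq_card => T; rewrite !inE.
  rewrite (@sum_tableaux algC n N m (fun T => (P ^+ l)%g T == T) (fun=> 1)) //.
  rewrite (eq_bigr (fun al => #|rotfix m (count (ltn 0%N) (aseq al)).-1 l|%:R));
      last first.
    move=> al /eqP hal; congr (_ *+ _).
    rewrite -(card_prnX_fix ltmN n0) ?size_aseq ?sumn_aseq //.
    by apply: eq_card => T; rewrite !inE andbC.
  rewrite (sum_compositions n N (fun a => #|rotfix m (count (ltn 0%N) a).-1 l|%:R :
      algC)).
  rewrite [LHS]big_mkcond [RHS]big_mkcond big_seq [RHS]big_seq; apply: eq_bigr => mu.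
  rewrite mem_partitions => hmu; have [_ mu0 /eqP smu] := and3P hmu.
  rewrite /contributes; case: (boolP (size mu <= n)%N) => //= hn.
  have -> : \sum_(a <- permutations (pad n mu)) #|rotfix m (count (ltn 0%N) a).-1 l|%:R =
     #|rotfix m (size mu).-1 l|%:R * \sum_(s <- permutations (pad n mu)) 1 :> algC.
    rewrite big_distrr /= big_seq [RHS]big_seq; apply: eq_bigr => a.
    by rewrite mem_permutations => pa; rewrite (seq.permP pa) count_pad // mulr1.
  case: ifP => h0.
    congr (_ * _); last by apply: eq_bigr => a _; rewrite expr1n.
    apply: card_rotfix_gaussq => //; exact: (SST_content_neq0 ltmN hmu hn h0).
  (* A partition that does not contribute is the content of no tableau, so there are no fixed points
     to count. *)
  have -> : #|rotfix m (size mu).-1 l| = 0%N; last by rewrite mul0r.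
  rewrite -(count_pad n mu0) -(card_prnX_fix ltmN n0) ?size_pad ?sumn_pad //.
  apply/eqP; rewrite cards_eq0 -subset0; apply/subsetP => T; rewrite !inE => /andP[hT _].
  by move/negbFE/eqP/setP/(_ T): h0; rewrite SST_contentE // hT inE.
have o0 : (0 < #[C ^+ j]%g)%N by exact: order_gt0.
have prim := homega _ o0; set z := omega _ in prim *.
have Cn : (C ^+ n = 1)%g by apply/eqP; rewrite -order_dvdn ordC.
have on : (#[C ^+ j]%g %| n)%N by rewrite order_dvdn -expgM mulnC expgM Cn expg1n.
have zn : z ^+ n = 1 by apply/eqP; rewrite -(prim_order_dvd prim).
(* The order of C^j divides [n]; if it divided [N] as well it would be 1, contrary to [jn]. *)
have zN : z ^+ N != 1.
  rewrite -(prim_order_dvd prim); apply: contra jn => oN.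
  have : (#[C ^+ j]%g %| gcdn n N)%N by rewrite dvdn_gcd on oN.
  rewrite (eqP cop) dvdn1 => o1.
  have : (#[C]%g %| j)%N by rewrite order_dvdn -order_eq1.
  by rewrite ordC.
have z0 : z != 0.
  apply/eqP => e; move/eqP: zn; rewrite e expr0n gtn_eqF //.
  by rewrite eq_sym oner_eq0.
rewrite big_seq_cond big1.
  have -> : [set x : SST n (hook N m) | ('P%act (('P%act x (P ^+ l)%g)) (C ^+ j)%g)
      == x] = set0.
    apply/setP => T; rewrite !inE /= !apermE; apply/negP => /eqP e.
    case/negP: jn; apply: (@rot_free n N n0 (cont T)); rewrite ?size_cont ?sumn_cont //.
    apply/eqP; rewrite -iter_rotr_fix.
    have [h1 _] := coxeterX_code ltmN n0 j ((P ^+ l)%g T).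
    have [h2 _] := prnX_code ltmN n0 l T.
    by rewrite -{1}h2 -h1 e.
  by rewrite cards0.
move=> mu /andP[]; rewrite mem_partitions => hmu /andP[hn h0].
have [_ _ /eqP smu] := and3P hmu; have hm := SST_content_neq0 ltmN hmu hn h0.
apply/eqP; rewrite mulf_eq0; apply/orP; right.
(* Multiplication by z^kappa(la) undoes the shift of exponents and gives the sum that vanishes by
   rotation. *)
rewrite -(mulrI_eq0 _ (mulfI (expf_neq0 (kappa (hook N m)) z0))) big_distrr /=.
apply/eqP; rewrite -[RHS](sum_permutations_root n0 hn smu zn zN) big_seq [RHS]big_seq.
apply: eq_bigr => a; rewrite mem_permutations => pa.
by rewrite -exprD subnKC // (kappa_hook_le ltmN hmu hn hm pa).
Qed.
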